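(* Let $G$ and $X$ be pro-groups (objects of $\operatorname{Pro}(\mathbf{Grp})$) and let $a\colon G\times X\to X$ be a morphism in $\operatorname{Pro}(\mathbf{Set})$ which is an action of the group object $G$ on the group object $X$ in $\operatorname{Pro}(\mathbf{Set})$, i.e. the identities $a(gh,x)=a(g,a(h,x))$, $a(1,x)=x$, $a(g,xy)=a(g,x)a(g,y)$ hold as equalities of morphisms in $\operatorname{Pro}(\mathbf{Set})$. Then there exist a directed set $J$, inverse systems of groups $G'$ and $X'$ indexed by $J$ together with actions of $G'_j$ on $X'_j$ (by group automorphisms) compatible with the transition maps, such that: $G'=G\circ u$ for a cofinal functor $u\colon J\to\mathcal I_G$, with the induced isomorphism $G\to G'$ in $\operatorname{Pro}(\mathbf{Grp})$; there is an isomorphism $X\cong X'$ in $\operatorname{Pro}(\mathbf{Grp})$; and under these isomorphisms the split extension $X\to X\rtimes G\rightleftarrows G$ determined by $a$ (in $\mathrm{Grp}(\operatorname{Pro}(\mathbf{Set}))$) is isomorphic to the formal projective limit of the split extensions of groups $X'_j\to X'_j\rtimes G'_j\rightleftarrows G'_j$. Consequently, the functor $\operatorname{Pro}(\mathbf{Grp})\to\mathrm{Grp}(\operatorname{Pro}(\mathbf{Set}))$ induces a bijection between the set of actions of $G$ on $X$ in $\operatorname{Pro}(\mathbf{Grp})$ and the set of actions of $G$ on $X$ in $\mathrm{Grp}(\operatorname{Pro}(\mathbf{Set}))$.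
   Context: For a category $\mathcal C$, $\operatorname{Pro}(\mathcal C)$ is its pro-completion: objects are inverse systems, i.e. functors $X\colon \mathcal I_X^{op}\to\mathcal C$ with $\mathcal I_X$ a small filtered category, and $\operatorname{Hom}_{\operatorname{Pro}(\mathcal C)}(X,Y)=\varprojlim_{j\in\mathcal I_Y}\varinjlim_{i\in\mathcal I_X}\mathcal C(X_i,Y_j)$. A functor $u\colon\mathcal J\to\mathcal I$ between filtered categories is cofinal if for every $i\in\mathcal I$ there are $j\in\mathcal J$ and a morphism $i\to u(j)$ (in the convention where $X\colon\mathcal I^{op}\to\mathcal C$, so larger indices map to smaller ones); the morphism $X\to X\circ u$ with identity components is then an isomorphism in $\operatorname{Pro}(\mathcal C)$. $\mathrm{Grp}(\mathcal D)$ denotes group objects in a category $\mathcal D$ with finite products; the canonical functor $\operatorname{Pro}(\mathbf{Grp})\to\mathrm{Grp}(\operatorname{Pro}(\mathbf{Set}))$ uses levelwise operations. In a pointed finitely complete category, a split extension of $G$ by $X$ is a diagram $X\xrightarrow{i}Y\underset{s}{\overset{p}{\rightleftarrows}}G$ with $p\circ s=\mathrm{id}_G$ and $i$ a kernel of $p$; a morphism of such split extensions is $f\colon Y\to Y'$ with $f i=i'$, $f s=s'$, $p' f=p$; an action of $G$ on $X$ is an isomorphism class of split extensions of $G$ by $X$. In $\mathrm{Grp}(\operatorname{Pro}(\mathbf{Set}))$ actions correspond exactly to morphisms $a\colon G\times X\to X$ satisfying the classical action axioms, the semidirect product $X\rtimes G$ having underlying pro-set $X\times G$ with the classical semidirect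 product multiplication. *)

(* Defs.v *)
From Stdlib Require Import ClassicalEpsilon ProofIrrelevance.

Record FCat := {
  ob : Type;
  hom : ob -> ob -> Type;
  idc : forall i, hom i i;
  cmp : forall i j k, hom j k -> hom i j -> hom i k;
  cmp_idl : forall i j (f : hom i j), cmp i j j (idc j) f = f;
  cmp_idr : forall i j (f : hom i j), cmp i i j f (idc i) = f;
  cmp_assoc : forall i j k l (f : hom i j) (g : hom j k) (h : hom k l),
      cmp i k l h (cmp i j k g f) = cmp i j l (cmp j k l h g) f;
  f_nonempty : exists i : ob, True;
  f_cone : forall i j, exists k (p : hom i k) (q : hom j k), True;
  f_coeq : forall i j (f g : hom i j),
      exists k (h : hom j k), cmp i j k h f = cmp i j k h g
}.
Arguments hom {_} _ _.
Arguments idc {_} _.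
Arguments cmp {_ _ _ _} _ _.

Definition prodCat (I J : FCat) : FCat.
Proof.
  refine {| ob := (ob I * ob J)%type;
            hom := fun a b => (hom (fst a) (fst b) * hom (snd a) (snd b))%type;
            idc := fun a => (idc (fst a), idc (snd a));
            cmp := fun a b c g f => (cmp (fst g) (fst f), cmp (snd g) (snd f)) |}.
  - intros a b [f1 f2]; cbn; rewrite !cmp_idl; reflexivity.
  - intros a b [f1 f2]; cbn; rewrite !cmp_idr; reflexivity.
  - intros a b c d [f1 f2] [g1 g2] [h1 h2]; cbn; rewrite !cmp_assoc; reflexivity.
  - destruct (f_nonempty I) as [i _], (f_nonempty J) as [j _].
    exists (i, j); exact Logic.I.
  - intros [i1 i2] [j1 j2].
    destruct (f_cone I i1 j1) as [k1 [p1 [q1 _]]].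
    destruct (f_cone J i2 j2) as [k2 [p2 [q2 _]]].
    exists (k1, k2), (p1, p2), (q1, q2); exact Logic.I.
  - intros [i1 i2] [j1 j2] [f1 f2] [g1 g2].
    destruct (f_coeq I _ _ f1 g1) as [k1 [h1 e1]].
    destruct (f_coeq J _ _ f2 g2) as [k2 [h2 e2]].
    exists (k1, k2), (h1, h2); simpl; f_equal; assumption.
Defined.

Definition unitCat : FCat.
Proof.
  refine {| ob := unit; hom := fun _ _ => unit; idc := fun _ => tt;
            cmp := fun _ _ _ _ _ => tt |}.
  - intros _ _ []; reflexivity.
  - intros _ _ []; reflexivity.
  - intros; reflexivity.
  - exists tt; exact Logic.I.
  - intros; exists tt, tt, tt; exact Logic.I.
  - intros; exists tt, tt; reflexivity.
Defined.

Record DirSet := {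
  dcar : Type;
  dle : dcar -> dcar -> Prop;
  dle_refl : forall i, dle i i;
  dle_trans : forall i j k, dle i j -> dle j k -> dle i k;
  d_nonempty : exists i : dcar, True;
  d_upper : forall i j, exists k, dle i k /\ dle j k
}.
Arguments dle {_} _ _.

Definition posetCat (D : DirSet) : FCat.
Proof.
  refine {| ob := dcar D; hom := fun i j => dle i j; idc := dle_refl D;
            cmp := fun i j k q p => dle_trans D i j k p q |}.
  - intros; apply proof_irrelevance.
  - intros; apply proof_irrelevance.
  - intros; apply proof_irrelevance.
  - exact (d_nonempty D).
  - intros i j; destruct (d_upper D i j) as [k [p q]].
    exists k, p, q; exact Logic.I.
  - intros i j f g; exists j, (dle_refl D j); apply proof_irrelevance.
Defined.

Record FFun (C D : FCat) := {
  fob : ob C -> ob D;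
  fhom : forall c c', hom c c' -> hom (fob c) (fob c')
}.
Arguments fob {_ _} _ _.
Arguments fhom {_ _} _ {_ _} _.

Definition IsFunctor {C D : FCat} (u : FFun C D) : Prop :=
  (forall c, fhom u (idc c) = idc (fob u c)) /\
  (forall c c' c'' (p : hom c c') (q : hom c' c''),
      fhom u (cmp q p) = cmp (fhom u q) (fhom u p)).

Definition IsCofinal {C D : FCat} (u : FFun C D) : Prop :=
  forall d : ob D, exists c (p : hom d (fob u c)), True.

Record ProSet := {
  pidx : FCat;
  pobj : ob pidx -> Type;
  pmap : forall i i', hom i i' -> pobj i' -> pobj i
}.
Arguments pmap _ {_ _} _ _.

Definition IsSys (A : ProSet) : Prop :=
  (forall i (x : pobj A i), pmap A (idc i) x = x) /\
  (forall i j k (p : hom i j) (q : hom j k) (x : pobj A k),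
      pmap A (cmp q p) x = pmap A p (pmap A q x)).

Definition Germ (A : ProSet) (S : Type) : Type :=
  { i : ob (pidx A) & pobj A i -> S }.

(* equality in colim_i Set(A_i, S) *)
Definition geq {A : ProSet} {S : Type} (u v : Germ A S) : Prop :=
  exists k (p : hom (projT1 u) k) (q : hom (projT1 v) k),
    forall x : pobj A k, projT2 u (pmap A p x) = projT2 v (pmap A q x).

Definition Mor (A B : ProSet) : Type := forall j : ob (pidx B), Germ A (pobj B j).

Definition gpost {A : ProSet} {S T : Type} (h : S -> T) (u : Germ A S) : Germ A T :=
  existT _ (projT1 u) (fun x => h (projT2 u x)).

(* compatibility: the family defines an element of lim_j colim_i *)
Definition IsMor {A B : ProSet} (F : Mor A B) : Prop :=
  forall j j' (b : hom j j'), geq (gpost (pmap B b) (F j')) (F j).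

Definition meq {A B : ProSet} (F G : Mor A B) : Prop := forall j, geq (F j) (G j).

Definition mid (A : ProSet) : Mor A A := fun j => existT _ j (fun x => x).

Definition mcomp {A B C : ProSet} (G : Mor B C) (F : Mor A B) : Mor A C :=
  fun k => existT _ (projT1 (F (projT1 (G k))))
                    (fun x => projT2 (G k) (projT2 (F (projT1 (G k))) x)).

Definition IsIsoP {A B : ProSet} (F : Mor A B) : Prop :=
  IsMor F /\ exists G : Mor B A, IsMor G /\ meq (mcomp G F) (mid A) /\ meq (mcomp F G) (mid B).

Definition prodP (A B : ProSet) : ProSet :=
  {| pidx := prodCat (pidx A) (pidx B);
     pobj := fun ij => (pobj A (fst ij) * pobj B (snd ij))%type;
     pmap := fun ij ij' pq xy => (pmap A (fst pq) (fst xy), pmap B (snd pq) (snd xy)) |}.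

Definition termP : ProSet :=
  {| pidx := unitCat; pobj := fun _ => unit; pmap := fun _ _ _ x => x |}.

Definition pick_ob (I : FCat) : ob I :=
  proj1_sig (constructive_indefinite_description _ (f_nonempty I)).

Definition cone_pick {I : FCat} (i j : ob I) : { k : ob I & (hom i k * hom j k)%type }.
Proof.
  destruct (constructive_indefinite_description _ (f_cone I i j)) as [k H].
  destruct (constructive_indefinite_description _ H) as [p H'].
  destruct (constructive_indefinite_description _ H') as [q _].
  exact (existT _ k (p, q)).
Defined.

Definition mprod {A B C D : ProSet} (F : Mor A C) (G : Mor B D) :
    Mor (prodP A B) (prodP C D) :=
  fun cd => existT (fun ab : ob (pidx (prodP A B)) => pobj (prodP A B) ab -> pobj (prodP C D) cd)
    (projT1 (F (fst cd)), projT1 (G (snd cd)))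
    (fun xy => (projT2 (F (fst cd)) (fst xy), projT2 (G (snd cd)) (snd xy))).

Definition mfst (A B : ProSet) : Mor (prodP A B) A :=
  fun i => existT (fun ab : ob (pidx (prodP A B)) => pobj (prodP A B) ab -> pobj A i)
    (i, pick_ob (pidx B)) (fun xy => fst xy).

Definition msnd (A B : ProSet) : Mor (prodP A B) B :=
  fun j => existT (fun ab : ob (pidx (prodP A B)) => pobj (prodP A B) ab -> pobj B j)
    (pick_ob (pidx A), j) (fun xy => snd xy).

Definition mpair {Z A B : ProSet} (F : Mor Z A) (G : Mor Z B) : Mor Z (prodP A B) :=
  fun ab =>
    let c := cone_pick (projT1 (F (fst ab))) (projT1 (G (snd ab))) in
    existT _ (projT1 c)
      (fun z => (projT2 (F (fst ab)) (pmap Z (fst (projT2 c)) z),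
                 projT2 (G (snd ab)) (pmap Z (snd (projT2 c)) z))).

Definition mbang (A : ProSet) : Mor A termP :=
  fun _ => existT _ (pick_ob (pidx A)) (fun _ => tt).

Definition massoc (A B C : ProSet) : Mor (prodP (prodP A B) C) (prodP A (prodP B C)) :=
  fun i => existT (fun ab : ob (pidx (prodP (prodP A B) C)) =>
                     pobj (prodP (prodP A B) C) ab -> pobj (prodP A (prodP B C)) i)
    ((fst i, fst (snd i)), snd (snd i))
    (fun x => (fst (fst x), (snd (fst x), snd x))).

Definition mlunit (A : ProSet) : Mor A (prodP termP A) :=
  fun i => existT (fun a : ob (pidx A) => pobj A a -> pobj (prodP termP A) i)
    (snd i) (fun x => (tt, x)).

Definition mrunit (A : ProSet) : Mor A (prodP A termP) :=
  fun i => existT (fun a : ob (pidx A) => pobj A a -> pobj (prodP A termP) i)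
    (fst i) (fun x => (x, tt)).

Record Grp := {
  gcar : Type;
  gmul : gcar -> gcar -> gcar;
  gone : gcar;
  ginv : gcar -> gcar
}.
Arguments gmul {_} _ _.
Arguments gone {_}.
Arguments ginv {_} _.

Definition IsGroup (H : Grp) : Prop :=
  (forall x y z : gcar H, gmul x (gmul y z) = gmul (gmul x y) z) /\
  (forall x : gcar H, gmul gone x = x) /\ (forall x : gcar H, gmul x gone = x) /\
  (forall x : gcar H, gmul (ginv x) x = gone) /\ (forall x : gcar H, gmul x (ginv x) = gone).

Definition IsHom (H K : Grp) (f : gcar H -> gcar K) : Prop :=
  forall x y, f (gmul x y) = gmul (f x) (f y).

Definition IsGAction (H K : Grp) (al : gcar H -> gcar K -> gcar K) : Prop :=
  (forall g h x, al (gmul g h) x = al g (al h x)) /\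
  (forall x, al gone x = x) /\
  (forall g x y, al g (gmul x y) = gmul (al g x) (al g y)).

Record ProGrp := {
  gidx : FCat;
  ggrp : ob gidx -> Grp;
  gmap : forall i i', hom i i' -> gcar (ggrp i') -> gcar (ggrp i)
}.
Arguments gmap _ {_ _} _ _.

Definition uP (P : ProGrp) : ProSet :=
  {| pidx := gidx P; pobj := fun i => gcar (ggrp P i); pmap := fun i i' p => gmap P p |}.

Definition IsProGrp (P : ProGrp) : Prop :=
  IsSys (uP P) /\ (forall i, IsGroup (ggrp P i)) /\
  (forall i i' (p : hom i i'), IsHom (ggrp P i') (ggrp P i) (gmap P p)).

Definition IsGMor {P Q : ProGrp} (F : Mor (uP P) (uP Q)) : Prop :=
  IsMor F /\ forall j, IsHom (ggrp P (projT1 (F j))) (ggrp Q j) (projT2 (F j)).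

Definition IsGIso {P Q : ProGrp} (F : Mor (uP P) (uP Q)) : Prop :=
  IsGMor F /\ exists G : Mor (uP Q) (uP P),
    IsGMor G /\ meq (mcomp G F) (mid _) /\ meq (mcomp F G) (mid _).

Definition lmul (P : ProGrp) : Mor (prodP (uP P) (uP P)) (uP P) :=
  fun i => existT (fun ab : ob (pidx (prodP (uP P) (uP P))) =>
                     pobj (prodP (uP P) (uP P)) ab -> pobj (uP P) i)
    (i, i) (fun xy => gmul (fst xy) (snd xy)).
Definition lone (P : ProGrp) : Mor termP (uP P) :=
  fun i => existT (fun _ : ob (pidx termP) => unit -> gcar (ggrp P i)) tt (fun _ => gone).
Definition linv (P : ProGrp) : Mor (uP P) (uP P) :=
  fun i => existT (fun a : ob (pidx (uP P)) => pobj (uP P) a -> pobj (uP P) i) i ginv.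

Record GObj := {
  gos : ProSet;
  gom : Mor (prodP gos gos) gos;
  goe : Mor termP gos;
  goi : Mor gos gos
}.

Definition IsGObj (Y : GObj) : Prop :=
  let A := gos Y in
  IsSys A /\ IsMor (gom Y) /\ IsMor (goe Y) /\ IsMor (goi Y) /\
  meq (mcomp (gom Y) (mprod (gom Y) (mid A)))
      (mcomp (gom Y) (mcomp (mprod (mid A) (gom Y)) (massoc A A A))) /\
  meq (mcomp (gom Y) (mcomp (mprod (goe Y) (mid A)) (mlunit A))) (mid A) /\
  meq (mcomp (gom Y) (mcomp (mprod (mid A) (goe Y)) (mrunit A))) (mid A) /\
  meq (mcomp (gom Y) (mpair (goi Y) (mid A))) (mcomp (goe Y) (mbang A)) /\
  meq (mcomp (gom Y) (mpair (mid A) (goi Y))) (mcomp (goe Y) (mbang A)).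

Definition IsGOMor {Y Y' : GObj} (f : Mor (gos Y) (gos Y')) : Prop :=
  IsMor f /\ meq (mcomp f (gom Y)) (mcomp (gom Y') (mprod f f)).

Definition IsGOIso {Y Y' : GObj} (f : Mor (gos Y) (gos Y')) : Prop :=
  IsGOMor f /\ exists g : Mor (gos Y') (gos Y),
    IsGOMor g /\ meq (mcomp g f) (mid _) /\ meq (mcomp f g) (mid _).

Definition FG (P : ProGrp) : GObj :=
  {| gos := uP P; gom := lmul P; goe := lone P; goi := linv P |}.

Definition zeroGO (Y Y' : GObj) : Mor (gos Y) (gos Y') := mcomp (goe Y') (mbang (gos Y)).

Definition IsKernelPG {K Y Q : ProGrp} (i : Mor (uP K) (uP Y)) (p : Mor (uP Y) (uP Q)) : Prop :=
  meq (mcomp p i) (zeroGO (FG K) (FG Q)) /\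
  forall Z : ProGrp, IsProGrp Z -> forall f : Mor (uP Z) (uP Y), IsGMor f ->
    meq (mcomp p f) (zeroGO (FG Z) (FG Q)) ->
    (exists h : Mor (uP Z) (uP K), IsGMor h /\ meq (mcomp i h) f) /\
    (forall h h' : Mor (uP Z) (uP K), IsGMor h -> IsGMor h' ->
       meq (mcomp i h) f -> meq (mcomp i h') f -> meq h h').

Definition IsKernelGO {K Y Q : GObj} (i : Mor (gos K) (gos Y)) (p : Mor (gos Y) (gos Q)) : Prop :=
  meq (mcomp p i) (zeroGO K Q) /\
  forall Z : GObj, IsGObj Z -> forall f : Mor (gos Z) (gos Y), @IsGOMor Z Y f ->
    meq (mcomp p f) (zeroGO Z Q) ->
    (exists h : Mor (gos Z) (gos K), @IsGOMor Z K h /\ meq (mcomp i h) f) /\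
    (forall h h' : Mor (gos Z) (gos K), @IsGOMor Z K h -> @IsGOMor Z K h' ->
       meq (mcomp i h) f -> meq (mcomp i h') f -> meq h h').

Record SplitExtPG (X G : ProGrp) := {
  seY : ProGrp;
  sei : Mor (uP X) (uP seY);
  sep : Mor (uP seY) (uP G);
  ses : Mor (uP G) (uP seY)
}.
Arguments seY {_ _} _.
Arguments sei {_ _} _.
Arguments sep {_ _} _.
Arguments ses {_ _} _.

Definition IsSplitExtPG {X G : ProGrp} (E : SplitExtPG X G) : Prop :=
  IsProGrp (seY E) /\ IsGMor (sei E) /\ IsGMor (sep E) /\ IsGMor (ses E) /\
  meq (mcomp (sep E) (ses E)) (mid _) /\ IsKernelPG (sei E) (sep E).

Definition IsoSEPG {X G : ProGrp} (E E' : SplitExtPG X G) : Prop :=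
  exists f : Mor (uP (seY E)) (uP (seY E')), IsGIso f /\
    meq (mcomp f (sei E)) (sei E') /\ meq (mcomp f (ses E)) (ses E') /\
    meq (mcomp (sep E') f) (sep E).

Record SplitExtGO (X G : GObj) := {
  sgY : GObj;
  sgi : Mor (gos X) (gos sgY);
  sgp : Mor (gos sgY) (gos G);
  sgs : Mor (gos G) (gos sgY)
}.
Arguments sgY {_ _} _.
Arguments sgi {_ _} _.
Arguments sgp {_ _} _.
Arguments sgs {_ _} _.

Definition IsSplitExtGO {X G : GObj} (E : SplitExtGO X G) : Prop :=
  IsGObj (sgY E) /\ @IsGOMor X (sgY E) (sgi E) /\ @IsGOMor (sgY E) G (sgp E) /\
  @IsGOMor G (sgY E) (sgs E) /\
  meq (mcomp (sgp E) (sgs E)) (mid _) /\ @IsKernelGO X (sgY E) G (sgi E) (sgp E).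

Definition IsoSEGO {X G : GObj} (E E' : SplitExtGO X G) : Prop :=
  exists f : Mor (gos (sgY E)) (gos (sgY E')), @IsGOIso (sgY E) (sgY E') f /\
    meq (mcomp f (sgi E)) (sgi E') /\ meq (mcomp f (sgs E)) (sgs E') /\
    meq (mcomp (sgp E') f) (sgp E).

Definition FSE {X G : ProGrp} (E : SplitExtPG X G) : SplitExtGO (FG X) (FG G) :=
  Build_SplitExtGO (FG X) (FG G) (FG (seY E)) (sei E) (sep E) (ses E).

Definition IsProSetAction (G X : ProGrp) (a : Mor (prodP (uP G) (uP X)) (uP X)) : Prop :=
  IsMor a /\
  meq (mcomp a (mprod (lmul G) (mid (uP X))))
      (mcomp a (mcomp (mprod (mid (uP G)) a) (massoc (uP G) (uP G) (uP X)))) /\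
  meq (mcomp a (mcomp (mprod (lone G) (mid (uP X))) (mlunit (uP X)))) (mid (uP X)) /\
  meq (mcomp a (mprod (mid (uP G)) (lmul X)))
      (mcomp (lmul X)
        (mpair (mcomp a (mprod (mid (uP G)) (mfst (uP X) (uP X))))
               (mcomp a (mprod (mid (uP G)) (msnd (uP X) (uP X)))))).

(* the semidirect product X x| G in Grp(Pro(Set)): underlying pro-set X x G,
   (x,g)(x',g') = (x a(g,x'), g g'),  unit (1,1),  (x,g)^-1 = (a(g^-1,x^-1), g^-1) *)
Definition sdGO (G X : ProGrp) (a : Mor (prodP (uP G) (uP X)) (uP X)) : GObj :=
  let Y := prodP (uP X) (uP G) in
  let x  := mcomp (mfst (uP X) (uP G)) (mfst Y Y) in
  let g  := mcomp (msnd (uP X) (uP G)) (mfst Y Y) in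
  let x' := mcomp (mfst (uP X) (uP G)) (msnd Y Y) in
  let g' := mcomp (msnd (uP X) (uP G)) (msnd Y Y) in
  {| gos := Y;
     gom := mpair (mcomp (lmul X) (mpair x (mcomp a (mpair g x'))))
                  (mcomp (lmul G) (mpair g g'));
     goe := mpair (lone X) (lone G);
     goi := mpair (mcomp a (mpair (mcomp (linv G) (msnd (uP X) (uP G)))
                                  (mcomp (linv X) (mfst (uP X) (uP G)))))
                  (mcomp (linv G) (msnd (uP X) (uP G))) |}.

Definition sdExt (G X : ProGrp) (a : Mor (prodP (uP G) (uP X)) (uP X)) :
    SplitExtGO (FG X) (FG G) :=
  Build_SplitExtGO (FG X) (FG G) (sdGO G X a)
    (mpair (mid (uP X)) (mcomp (lone G) (mbang (uP X))))
    (msnd (uP X) (uP G))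
    (mpair (mcomp (lone X) (mbang (uP G))) (mid (uP G))).

Definition reindex (P : ProGrp) {C : FCat} (u : FFun C (gidx P)) : ProGrp :=
  {| gidx := C; ggrp := fun c => ggrp P (fob u c);
     gmap := fun c c' p => gmap P (fhom u p) |}.

Definition canon (P : ProGrp) {C : FCat} (u : FFun C (gidx P)) :
    Mor (uP P) (uP (reindex P u)) :=
  fun c => existT (fun i : ob (gidx P) => gcar (ggrp P i) -> gcar (ggrp P (fob u c)))
                  (fob u c) (fun x => x).

Definition mkPG (D : DirSet) (Xg : dcar D -> Grp)
    (Xm : forall j j', dle j j' -> gcar (Xg j') -> gcar (Xg j)) : ProGrp :=
  {| gidx := posetCat D; ggrp := Xg; gmap := Xm |}.

Definition sdGrp (K H : Grp) (al : gcar H -> gcar K -> gcar K) : Grp :=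
  {| gcar := (gcar K * gcar H)%type;
     gmul := fun a b => (gmul (fst a) (al (snd a) (fst b)), gmul (snd a) (snd b));
     gone := (gone, gone);
     ginv := fun a => (al (ginv (snd a)) (ginv (fst a)), ginv (snd a)) |}.

Definition sdLim (G : ProGrp) (D : DirSet) (u : FFun (posetCat D) (gidx G))
    (Xg : dcar D -> Grp) (Xm : forall j j', dle j j' -> gcar (Xg j') -> gcar (Xg j))
    (al : forall j, gcar (ggrp G (fob u j)) -> gcar (Xg j) -> gcar (Xg j)) : ProGrp :=
  {| gidx := posetCat D;
     ggrp := fun j => sdGrp (Xg j) (ggrp G (fob u j)) (al j);
     gmap := fun j j' p xg => (Xm j j' p (fst xg), gmap G (fhom u p) (snd xg)) |}.

Definition sdLim_i G D u Xg Xm al :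
    Mor (uP (mkPG D Xg Xm)) (uP (sdLim G D u Xg Xm al)) :=
  fun j => existT (fun k : ob (posetCat D) => gcar (Xg k) -> gcar (Xg j) * gcar (ggrp G (fob u j)))
                  j (fun x => (x, gone)).
Definition sdLim_s G D u Xg Xm al :
    Mor (uP (reindex G u)) (uP (sdLim G D u Xg Xm al)) :=
  fun j => existT (fun k : ob (posetCat D) => gcar (ggrp G (fob u k)) -> gcar (Xg j) * gcar (ggrp G (fob u j)))
                  j (fun g => (gone, g)).
Definition sdLim_p G D u Xg Xm al :
    Mor (uP (sdLim G D u Xg Xm al)) (uP (reindex G u)) :=
  fun j => existT (fun k : ob (posetCat D) => gcar (Xg k) * gcar (ggrp G (fob u k)) -> gcar (ggrp G (fob u j)))
                  j (fun xg => snd xg).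

(* Main.v *)
(* An action [a : G x X -> X] in pro-sets need not be levelwise, because at level [j] it is only
   a map [alpha : G_i x X_i -> X_j].  After refining [i], [alpha] is multiplicative in [x] and
   [alpha (h g, x) = alpha (h, beta (g, x))] for all [h] in [G_i], where [beta] represents [a] at
   level [i].  Replace [X_j] by the group of functions [h |-> prod_n alpha (h g_n, x_n)] on [G_i],
   that is, by words in the [(g_n, x_n)] modulo equality of values; [G_i] acts on it by
   translating the [g_n].  The value at [h = 1] and the map sending [x] to the word [(1, x)]
   show that these groups form a pro-group isomorphic to [X], and their transition maps are
   defined on words.  The index category is made directed by finite diagrams with a cocone.

   For the bijection, a split extension of group objects is the semidirect product for the
   conjugation action, which exists because the kernel of a morphism of group objects is already
   a kernel for morphisms from arbitrary pro-sets; applying the levelwise representation to this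
   action yields a split extension of pro-groups.  Conversely, kernels of pro-groups are kernels
   of pro-sets since levelwise free groups represent pro-set morphisms into pro-groups.  Full
   faithfulness holds since a germ of maps which is multiplicative up to refinement becomes a
   homomorphism at a later level. *)

(* Associativity cannot be made to hold inside a single level: [alpha] takes arguments in [X_i] but
   values in [X_j], so the inner action has to come from a deeper representative. Functions of [h]
   avoid composing [alpha] with itself, since translating [h] is an honest action of [G_i]. Words,
   rather than their values, carry the transition maps, because a function on [G_i] does not pass
   down to a lower level; but restricting words along an arbitrary refinement need not preserve
   equality of values. The order on the indices therefore demands this preservation. It is available
   cofinally: for [c] far enough above [b], with the target of [c] above the source of [b],
   associativity gives [prod alpha_b (h g_n, x_n) = alpha_b (h, y)], where [y] is the image of the
   value at [h = 1] of the word at [c]. The values at [b] thus depend on a single value at [c]. This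
   identity yields both the directedness of the index set and the comparison with [X]. *)
From Stdlib Require Import List RelationClasses Classical ClassicalEpsilon Lia.
From Stdlib Require Import ProofIrrelevance FunctionalExtensionality PropExtensionality.
Require Import Defs.

(** * Quotients *)

(** A class is encoded as the predicate it defines, so that equality of classes comes from
    extensionality and representatives come from choice. *)
Definition Quot {W : Type} (R : W -> W -> Prop) : Type :=
  { P : W -> Prop | exists w, P = R w }.

Definition cls {W : Type} (R : W -> W -> Prop) (w : W) : Quot R :=
  exist _ (R w) (ex_intro _ w eq_refl).

Definition rep {W : Type} {R : W -> W -> Prop} (q : Quot R) : W :=
  proj1_sig (constructive_indefinite_description _ (proj2_sig q)).

Lemma cls_rep {W : Type} (R : W -> W -> Prop) (q : Quot R) : cls R (rep q) = q.
Proof.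
  unfold rep; destruct (constructive_indefinite_description _ (proj2_sig q)) as [w e]; simpl.
  apply eq_sig_hprop; [intros; apply proof_irrelevance | symmetry; exact e].
Qed.

Lemma cls_eq {W : Type} (R : W -> W -> Prop) {E : Equivalence R} (w w' : W) :
  R w w' -> cls R w = cls R w'.
Proof.
  intro r; apply eq_sig_hprop; [intros; apply proof_irrelevance | simpl].
  extensionality v; apply propositional_extensionality; split; intro h.
  - transitivity w; [symmetry; exact r | exact h].
  - transitivity w'; [exact r | exact h].
Qed.

Lemma cls_inv {W : Type} (R : W -> W -> Prop) {E : Equivalence R} (w w' : W) :
  cls R w = cls R w' -> R w w'.
Proof.
  intro e; apply (f_equal (@proj1_sig _ _)) in e; simpl in e.
  rewrite e; reflexivity.
Qed.

Lemma rep_cls {W : Type} (R : W -> W -> Prop) {E : Equivalence R} (w : W) :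
  R (rep (cls R w)) w.
Proof. apply cls_inv; [exact E | apply cls_rep]. Qed.

(** * Germs *)

Lemma geq_ext {A : ProSet} {S : Type} (i : ob (pidx A)) (f g : pobj A i -> S) :
  (forall x, f x = g x) -> @geq A S (existT _ i f) (existT _ i g).
Proof. intro h; exists i, (idc i), (idc i); intro x; apply h. Qed.

Lemma geq_refl {A : ProSet} {S : Type} (u : Germ A S) : geq u u.
Proof. exists (projT1 u), (idc _), (idc _); reflexivity. Qed.

Lemma geq_sym {A : ProSet} {S : Type} (u v : Germ A S) : geq u v -> geq v u.
Proof. intros [k [p [q h]]]; exists k, q, p; intro x; symmetry; apply h. Qed.

Lemma geq_trans {A : ProSet} (HA : IsSys A) {S : Type} (u v w : Germ A S) :
  geq u v -> geq v w -> geq u w.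
Proof.
  intros [k1 [p1 [q1 h1]]] [k2 [p2 [q2 h2]]].
  destruct HA as [_ HA].
  destruct (f_cone _ k1 k2) as [k3 [r1 [r2 _]]].
  (* The two paths out of the index of [v] have to agree before [h1] and [h2] can be chained. *)
  destruct (f_coeq _ _ _ (cmp r1 q1) (cmp r2 p2)) as [k4 [h e]].
  exists k4, (cmp (cmp h r1) p1), (cmp (cmp h r2) q2); intro x.
  rewrite !cmp_assoc in e.
  rewrite (HA _ _ _ p1), (HA _ _ _ q2), h1, <- h2, <- (HA _ _ _ q1), <- (HA _ _ _ p2), e.
  reflexivity.
Qed.

Lemma geq_res {A : ProSet} (HA : IsSys A) {S : Type} (i k : ob (pidx A)) (p : hom i k)
    (f : pobj A i -> S) :
  @geq A S (existT _ i f) (existT _ k (fun x => f (pmap A p x))).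
Proof.
  exists k, p, (idc k); intro x; simpl; rewrite (proj1 HA); reflexivity.
Qed.

Lemma geq_gpost {A : ProSet} {S T : Type} (h : S -> T) (u v : Germ A S) :
  geq u v -> geq (gpost h u) (gpost h v).
Proof. intros [k [p [q e]]]; exists k, p, q; intro x; simpl; f_equal; apply e. Qed.

(** Filtered colimits commute with binary products. The two components are compared along different
    arrows, so the arrows out of [u] are merged first and those out of [v] next. *)
Lemma geq_pair {A : ProSet} (HA : IsSys A) {S T : Type} (u v : Germ A (S * T)) :
  geq (gpost fst u) (gpost fst v) -> geq (gpost snd u) (gpost snd v) -> geq u v.
Proof.
  intros [k1 [p1 [q1 h1]]] [k2 [p2 [q2 h2]]]; simpl in *.
  destruct HA as [_ HA].
  destruct (f_cone _ k1 k2) as [k3 [r1 [r2 _]]].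
  destruct (f_coeq _ _ _ (cmp r1 p1) (cmp r2 p2)) as [k4 [s es]].
  destruct (f_coeq _ _ _ (cmp s (cmp r1 q1)) (cmp s (cmp r2 q2))) as [k5 [t et]].
  exists k5, (cmp t (cmp s (cmp r1 p1))), (cmp t (cmp s (cmp r1 q1))); intro x.
  apply injective_projections.
  - rewrite !HA; apply h1.
  - rewrite et, es, !HA; apply h2.
Qed.

(** By computation [mcomp G F k] is [gpre (G k) F], and it is also [gpost] of a component of [G]
    applied to a component of [F]. Composites are handled below in whichever form fits. *)
Definition gpre {A B : ProSet} {S : Type} (u : Germ B S) (F : Mor A B) : Germ A S :=
  existT _ (projT1 (F (projT1 u))) (fun x => projT2 u (projT2 (F (projT1 u)) x)).

(** Two representatives of a germ call on components of [F] at different indices; compatibility of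
    [F] moves both to the common index [k]. *)
Lemma geq_gpre {A B : ProSet} (HA : IsSys A) {S : Type} (u v : Germ B S) (F : Mor A B) :
  IsMor F -> geq u v -> geq (gpre u F) (gpre v F).
Proof.
  intros HF [k [p [q e]]].
  apply (geq_trans HA _ (gpost (projT2 u) (gpost (pmap B p) (F k)))).
  { apply geq_sym, (geq_gpost (projT2 u)), HF. }
  apply (geq_trans HA _ (gpost (projT2 v) (gpost (pmap B q) (F k)))).
  { apply geq_ext; intro x; apply e. }
  apply (geq_gpost (projT2 v)), HF.
Qed.

Lemma geq_gpre_meq {A B : ProSet} {S : Type} (u : Germ B S) (F F' : Mor A B) :
  meq F F' -> geq (gpre u F) (gpre u F').
Proof. intro e; apply (geq_gpost (projT2 u)), e. Qed.

Lemma meq_refl {A B : ProSet} (F : Mor A B) : meq F F.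
Proof. intro j; apply geq_refl. Qed.

Lemma meq_sym {A B : ProSet} (F G : Mor A B) : meq F G -> meq G F.
Proof. intros h j; apply geq_sym, h. Qed.

Lemma meq_trans {A B : ProSet} (HA : IsSys A) (F G H : Mor A B) :
  meq F G -> meq G H -> meq F H.
Proof. intros h h' j; apply (geq_trans HA _ (G j)); [apply h | apply h']. Qed.

Lemma IsMor_meq {A B : ProSet} (HA : IsSys A) (F G : Mor A B) :
  meq F G -> IsMor F -> IsMor G.
Proof.
  intros e HF j j' b.
  apply (geq_trans HA _ (F j)); [| apply e].
  apply (geq_trans HA _ (gpost (pmap B b) (F j'))); [| apply HF].
  apply geq_gpost, geq_sym, e.
Qed.

Lemma IsMor_mcomp {A B C : ProSet} (HA : IsSys A) (G : Mor B C) (F : Mor A B) :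
  IsMor G -> IsMor F -> IsMor (mcomp G F).
Proof.
  intros HG HF j j' b.
  apply (geq_gpre HA (gpost (pmap C b) (G j')) (G j) F HF), HG.
Qed.

Lemma mcomp_meq {A B C : ProSet} (HA : IsSys A) (G G' : Mor B C) (F F' : Mor A B) :
  IsMor F -> meq G G' -> meq F F' -> meq (mcomp G F) (mcomp G' F').
Proof.
  intros HF eG eF k.
  apply (geq_trans HA _ (gpre (G' k) F)).
  - apply (geq_gpre HA _ _ F HF), eG.
  - apply (geq_gpre_meq _ _ _ eF).
Qed.

Lemma IsMor_mid (A : ProSet) (HA : IsSys A) : IsMor (mid A).
Proof. intros j j' b; apply geq_sym, (geq_res HA j j' b (fun x => x)). Qed.

(** * Products of pro-sets *)

Lemma IsSys_prodP (A B : ProSet) : IsSys A -> IsSys B -> IsSys (prodP A B).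
Proof.
  intros [a1 a2] [b1 b2]; split.
  - intros i [x y]; simpl; rewrite a1, b1; reflexivity.
  - intros i j k p q [x y]; simpl; rewrite a2, b2; reflexivity.
Qed.

Lemma IsSys_termP : IsSys termP.
Proof. split; reflexivity. Qed.

Definition gpair {Z : ProSet} {S T : Type} (u : Germ Z S) (v : Germ Z T) : Germ Z (S * T) :=
  let c := cone_pick (projT1 u) (projT1 v) in
  existT _ (projT1 c) (fun z => (projT2 u (pmap Z (fst (projT2 c)) z),
                                 projT2 v (pmap Z (snd (projT2 c)) z))).

Lemma gpair_fst {Z : ProSet} (HZ : IsSys Z) {S T : Type} (u : Germ Z S) (v : Germ Z T) :
  geq (gpost fst (gpair u v)) u.
Proof.
  destruct u as [i f]; apply geq_sym, (geq_res HZ i).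
Qed.

Lemma gpair_snd {Z : ProSet} (HZ : IsSys Z) {S T : Type} (u : Germ Z S) (v : Germ Z T) :
  geq (gpost snd (gpair u v)) v.
Proof.
  destruct v as [i f]; apply geq_sym, (geq_res HZ i).
Qed.

Lemma geq_gpair {Z : ProSet} (HZ : IsSys Z) {S T : Type} (u : Germ Z S) (v : Germ Z T)
    (w : Germ Z (S * T)) :
  geq u (gpost fst w) -> geq v (gpost snd w) -> geq (gpair u v) w.
Proof.
  intros hu hv; apply (geq_pair HZ).
  - apply (geq_trans HZ _ u); [apply (gpair_fst HZ) | exact hu].
  - apply (geq_trans HZ _ v); [apply (gpair_snd HZ) | exact hv].
Qed.

Lemma IsMor_mpair {Z A B : ProSet} (HZ : IsSys Z) (F : Mor Z A) (G : Mor Z B) :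
  IsMor F -> IsMor G -> IsMor (mpair F G).
Proof.
  intros HF HG [i i'] [j j'] [b b']; apply (geq_pair HZ).
  - apply (geq_trans HZ _ (F i)); [| apply geq_sym, (gpair_fst HZ (F i) (G i'))].
    apply (geq_trans HZ _ (gpost (pmap A b) (F j))); [| apply HF].
    apply (geq_gpost (pmap A b) _ _ (gpair_fst HZ (F j) (G j'))).
  - apply (geq_trans HZ _ (G i')); [| apply geq_sym, (gpair_snd HZ (F i) (G i'))].
    apply (geq_trans HZ _ (gpost (pmap B b') (G j'))); [| apply HG].
    apply (geq_gpost (pmap B b') _ _ (gpair_snd HZ (F j) (G j'))).
Qed.

(** The index that [mfst] takes in the second factor is an arbitrary choice; computations at a fixed
    level need to move it to a given [k]. *)
Lemma mfst_at (A B : ProSet) (i : ob (pidx A)) (k : ob (pidx B)) :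
  @geq (prodP A B) _ (mfst A B i)
    (existT (fun c : ob (pidx (prodP A B)) => pobj (prodP A B) c -> pobj A i) (i, k) fst).
Proof.
  destruct (f_cone _ (pick_ob (pidx B)) k) as [l [p [q _]]].
  exists (i, l), (idc i, p), (idc i, q); reflexivity.
Qed.

Lemma msnd_at (A B : ProSet) (i : ob (pidx A)) (k : ob (pidx B)) :
  @geq (prodP A B) _ (msnd A B k)
    (existT (fun c : ob (pidx (prodP A B)) => pobj (prodP A B) c -> pobj B k) (i, k) snd).
Proof.
  destruct (f_cone _ (pick_ob (pidx A)) i) as [l [p [q _]]].
  exists (l, k), (p, idc k), (q, idc k); reflexivity.
Qed.

Lemma IsMor_mfst (A B : ProSet) : IsSys A -> IsSys B -> IsMor (mfst A B).
Proof.
  intros HA HB j j' b.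
  exists (j', pick_ob _), (idc j', idc _), (b, idc _); intros [x y]; simpl.
  rewrite (proj1 HA); reflexivity.
Qed.

Lemma IsMor_msnd (A B : ProSet) : IsSys A -> IsSys B -> IsMor (msnd A B).
Proof.
  intros HA HB j j' b.
  exists (pick_ob _, j'), (idc _, idc j'), (idc _, b); intros [x y]; simpl.
  rewrite (proj1 HB); reflexivity.
Qed.

Lemma IsMor_mbang (A : ProSet) : IsMor (mbang A).
Proof. intros j j' b; apply geq_refl. Qed.

Lemma meq_termP {A : ProSet} (F G : Mor A termP) : meq F G.
Proof.
  intro j; destruct (f_cone _ (projT1 (F j)) (projT1 (G j))) as [k [p [q _]]].
  exists k, p, q; intro x.
  destruct (projT2 (F j) (pmap A p x)), (projT2 (G j) (pmap A q x)); reflexivity.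
Qed.

Lemma meq_prodP {Z A B : ProSet} (HZ : IsSys Z) (HA : IsSys A) (HB : IsSys B)
    (F G : Mor Z (prodP A B)) :
  IsMor F -> IsMor G ->
  meq (mcomp (mfst A B) F) (mcomp (mfst A B) G) ->
  meq (mcomp (msnd A B) F) (mcomp (msnd A B) G) -> meq F G.
Proof.
  intros HF HG e1 e2 [i k]; apply (geq_pair HZ).
  - apply (geq_trans HZ _ (gpre (mfst A B i) F)).
    { apply geq_sym, (geq_gpre HZ _ _ F HF (mfst_at A B i k)). }
    apply (geq_trans HZ _ (gpre (mfst A B i) G)); [apply e1 |].
    apply (geq_gpre HZ _ _ G HG (mfst_at A B i k)).
  - apply (geq_trans HZ _ (gpre (msnd A B k) F)).
    { apply geq_sym, (geq_gpre HZ _ _ F HF (msnd_at A B i k)). }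
    apply (geq_trans HZ _ (gpre (msnd A B k) G)); [apply e2 |].
    apply (geq_gpre HZ _ _ G HG (msnd_at A B i k)).
Qed.

Lemma mfst_mpair {Z A B : ProSet} (HZ : IsSys Z) (F : Mor Z A) (G : Mor Z B) :
  meq (mcomp (mfst A B) (mpair F G)) F.
Proof. intro i; apply (gpair_fst HZ (F i) (G (pick_ob _))). Qed.

Lemma msnd_mpair {Z A B : ProSet} (HZ : IsSys Z) (F : Mor Z A) (G : Mor Z B) :
  meq (mcomp (msnd A B) (mpair F G)) G.
Proof. intro i; apply (gpair_snd HZ (F (pick_ob _)) (G i)). Qed.

Lemma mprod_mpair {A B C D : ProSet} (HA : IsSys A) (HB : IsSys B)
    (F : Mor A C) (G : Mor B D) :
  meq (mprod F G) (mpair (mcomp F (mfst A B)) (mcomp G (msnd A B))).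
Proof.
  intros [c d]; apply geq_sym.
  apply (geq_gpair (IsSys_prodP _ _ HA HB)
           (mcomp F (mfst A B) c) (mcomp G (msnd A B) d) (mprod F G (c, d))).
  - apply (geq_gpost (projT2 (F c)) _ _ (mfst_at A B _ (projT1 (G d)))).
  - apply (geq_gpost (projT2 (G d)) _ _ (msnd_at A B (projT1 (F c)) _)).
Qed.

Lemma massoc_mpair {A B C : ProSet} (HA : IsSys A) (HB : IsSys B) (HC : IsSys C) :
  meq (massoc A B C)
    (mpair (mcomp (mfst A B) (mfst (prodP A B) C))
           (mpair (mcomp (msnd A B) (mfst (prodP A B) C)) (msnd (prodP A B) C))).
Proof.
  pose proof (IsSys_prodP _ _ HA HB) as HAB.
  pose proof (IsSys_prodP _ _ HAB HC) as HABC.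
  intros [a [b c]]; apply geq_sym.
  apply (geq_gpair HABC (mcomp (mfst A B) (mfst (prodP A B) C) a) (mpair _ _ (b, c))).
  - apply (geq_trans HABC _
      (gpost fst (existT (fun z : ob (pidx (prodP (prodP A B) C)) =>
          pobj (prodP (prodP A B) C) z -> pobj (prodP A B) (a, b)) ((a, b), c) fst))).
    2: apply geq_refl.
    apply (geq_trans HABC _ (gpre (existT (fun z : ob (pidx (prodP A B)) =>
          pobj (prodP A B) z -> pobj A a) (a, b) fst) (mfst (prodP A B) C))).
    + apply (geq_gpre HABC); [apply IsMor_mfst; assumption | apply (mfst_at A B)].
    + apply (geq_gpost fst _ _ (mfst_at (prodP A B) C (a, b) c)).
  - apply (geq_gpair HABC (mcomp (msnd A B) (mfst (prodP A B) C) b) (msnd (prodP A B) C c)).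
    + apply (geq_trans HABC _ (gpre (existT (fun z : ob (pidx (prodP A B)) =>
          pobj (prodP A B) z -> pobj B b) (a, b) snd) (mfst (prodP A B) C))).
      * apply (geq_gpre HABC); [apply IsMor_mfst; assumption | apply (msnd_at A B)].
      * apply (geq_gpost snd _ _ (mfst_at (prodP A B) C (a, b) c)).
    + apply (msnd_at (prodP A B) C (a, b) c).
Qed.

Lemma mlunit_mpair {A : ProSet} (HA : IsSys A) :
  meq (mlunit A) (mpair (mbang A) (mid A)).
Proof.
  intros [t i]; apply geq_sym.
  apply (geq_gpair HA (mbang A t) (mid A i)).
  - apply (meq_termP (mbang A) (fun _ => existT _ i (fun _ => tt)) t).
  - apply geq_refl.
Qed.

Lemma mrunit_mpair {A : ProSet} (HA : IsSys A) :
  meq (mrunit A) (mpair (mid A) (mbang A)).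
Proof.
  intros [i t]; apply geq_sym.
  apply (geq_gpair HA (mid A i) (mbang A t)).
  - apply geq_refl.
  - apply (meq_termP (mbang A) (fun _ => existT _ i (fun _ => tt)) t).
Qed.

(** * The category of pro-sets with morphisms up to equality *)

Record Sys := mkSys { sob :> ProSet; sysP : IsSys sob }.

Definition homR (A B : Sys) (F G : {F : Mor A B | IsMor F}) : Prop :=
  meq (proj1_sig F) (proj1_sig G).

#[local] Instance homR_equiv (A B : Sys) : Equivalence (homR A B).
Proof.
  split.
  - intro F; apply meq_refl.
  - intros F G; apply meq_sym.
  - intros F G H; apply (meq_trans (sysP A)).
Qed.

Definition Hom (A B : Sys) : Type := Quot (homR A B).

Definition raw {A B : Sys} (f : Hom A B) : Mor A B := proj1_sig (rep f).

Definition homc {A B : Sys} (F : Mor A B) (H : IsMor F) : Hom A B :=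
  cls (homR A B) (exist _ F H).

(** The bridge between families up to [meq] and morphisms up to equality. [raw] is a chosen
    representative about which nothing is known by computation, so every explicit family is tied to
    its class through this relation. *)
Definition reps {A B : Sys} (F : Mor A B) (f : Hom A B) : Prop :=
  exists H : IsMor F, homc F H = f.

Lemma IsMor_raw {A B : Sys} (f : Hom A B) : IsMor (raw f).
Proof. exact (proj2_sig (rep f)). Qed.

Lemma reps_raw {A B : Sys} (f : Hom A B) : reps (raw f) f.
Proof.
  exists (IsMor_raw f); transitivity (cls (homR A B) (rep f)); [| apply cls_rep].
  apply cls_eq; [typeclasses eauto | apply meq_refl].
Qed.

Lemma reps_homc {A B : Sys} (F : Mor A B) (H : IsMor F) : reps F (homc F H).
Proof. exists H; reflexivity. Qed.

Lemma reps_IsMor {A B : Sys} {F : Mor A B} {f : Hom A B} : reps F f -> IsMor F.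
Proof. intros [H _]; exact H. Qed.

Lemma reps_eq {A B : Sys} {F G : Mor A B} {f g : Hom A B} :
  reps F f -> reps G g -> meq F G -> f = g.
Proof. intros [HF <-] [HG <-] e; apply cls_eq; [typeclasses eauto | exact e]. Qed.

Lemma reps_meq {A B : Sys} {F G : Mor A B} {f g : Hom A B} :
  reps F f -> reps G g -> f = g -> meq F G.
Proof.
  intros [HF <-] [HG <-] e; unfold homc in e.
  apply cls_inv in e; [exact e | typeclasses eauto].
Qed.

Lemma meq_reps {A B : Sys} {F G : Mor A B} {f : Hom A B} :
  meq F G -> reps F f -> reps G f.
Proof.
  intros e [HF <-]; exists (IsMor_meq (sysP A) _ _ e HF).
  apply cls_eq; [typeclasses eauto | apply meq_sym, e].
Qed.

Definition comp {A B C : Sys} (g : Hom B C) (f : Hom A B) : Hom A C :=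
  homc (mcomp (raw g) (raw f)) (IsMor_mcomp (sysP A) _ _ (IsMor_raw g) (IsMor_raw f)).

Notation "g \; f" := (comp g f) (at level 40, left associativity).

Lemma reps_comp {A B C : Sys} {G : Mor B C} {F : Mor A B} {g : Hom B C} {f : Hom A B} :
  reps G g -> reps F f -> reps (mcomp G F) (g \; f).
Proof.
  intros HG HF.
  apply (meq_reps (F := mcomp (raw g) (raw f))); [| apply reps_homc].
  apply (mcomp_meq (sysP A)).
  - apply IsMor_raw.
  - apply (reps_meq (reps_raw g) HG eq_refl).
  - apply (reps_meq (reps_raw f) HF eq_refl).
Qed.

Definition idh (A : Sys) : Hom A A := homc (mid A) (IsMor_mid A (sysP A)).

Lemma reps_id (A : Sys) : reps (mid A) (idh A).
Proof. apply reps_homc. Qed.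

Lemma comp_assoc {A B C D : Sys} (h : Hom C D) (g : Hom B C) (f : Hom A B) :
  h \; (g \; f) = h \; g \; f.
Proof.
  apply (reps_eq (F := mcomp (raw h) (mcomp (raw g) (raw f)))
                 (G := mcomp (mcomp (raw h) (raw g)) (raw f)));
    [repeat apply reps_comp; apply reps_raw .. | apply meq_refl].
Qed.

Lemma comp_idl {A B : Sys} (f : Hom A B) : idh B \; f = f.
Proof.
  apply (reps_eq (reps_comp (reps_id B) (reps_raw f)) (reps_raw f)).
  intro j; apply (geq_refl (raw f j)).
Qed.

Lemma comp_idr {A B : Sys} (f : Hom A B) : f \; idh A = f.
Proof.
  apply (reps_eq (reps_comp (reps_raw f) (reps_id A)) (reps_raw f)).
  intro j; apply (geq_refl (raw f j)).
Qed.

(** Canonical, so that a bare [prodP] is recognised as the carrier of a [Sys]. *)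
Canonical pS (A B : Sys) : Sys := mkSys (prodP A B) (IsSys_prodP _ _ (sysP A) (sysP B)).
Canonical oneS : Sys := mkSys termP IsSys_termP.

Definition pi1 {A B : Sys} : Hom (pS A B) A :=
  @homc (pS A B) A (mfst A B) (IsMor_mfst A B (sysP A) (sysP B)).
Definition pi2 {A B : Sys} : Hom (pS A B) B :=
  @homc (pS A B) B (msnd A B) (IsMor_msnd A B (sysP A) (sysP B)).
Definition bang (A : Sys) : Hom A oneS := @homc A oneS (mbang A) (IsMor_mbang A).
Definition pairh {Z A B : Sys} (f : Hom Z A) (g : Hom Z B) : Hom Z (pS A B) :=
  @homc Z (pS A B) (mpair (raw f) (raw g))
    (IsMor_mpair (sysP Z) _ _ (IsMor_raw f) (IsMor_raw g)).

Notation "<< f , g >>" := (pairh f g) (at level 0, f at level 50, g at level 50).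

Lemma reps_fst (A B : Sys) : reps (mfst A B) (@pi1 A B).
Proof. apply reps_homc. Qed.
Lemma reps_snd (A B : Sys) : reps (msnd A B) (@pi2 A B).
Proof. apply reps_homc. Qed.
Lemma reps_bang (A : Sys) : reps (mbang A) (bang A).
Proof. apply reps_homc. Qed.

Lemma pi1_pair {Z A B : Sys} (f : Hom Z A) (g : Hom Z B) : pi1 \; << f, g >> = f.
Proof.
  apply (reps_eq (reps_comp (reps_fst A B) (reps_homc _ _)) (reps_raw f)).
  apply (mfst_mpair (sysP Z)).
Qed.

Lemma pi2_pair {Z A B : Sys} (f : Hom Z A) (g : Hom Z B) : pi2 \; << f, g >> = g.
Proof.
  apply (reps_eq (reps_comp (reps_snd A B) (reps_homc _ _)) (reps_raw g)).
  apply (msnd_mpair (sysP Z)).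
Qed.

Lemma pair_ext {Z A B : Sys} (f g : Hom Z (pS A B)) :
  pi1 \; f = pi1 \; g -> pi2 \; f = pi2 \; g -> f = g.
Proof.
  intros e1 e2; apply (reps_eq (reps_raw f) (reps_raw g)).
  apply (meq_prodP (sysP Z) (sysP A) (sysP B)); [apply IsMor_raw .. | |].
  - exact (reps_meq (reps_comp (reps_fst A B) (reps_raw f))
                    (reps_comp (reps_fst A B) (reps_raw g)) e1).
  - exact (reps_meq (reps_comp (reps_snd A B) (reps_raw f))
                    (reps_comp (reps_snd A B) (reps_raw g)) e2).
Qed.

Lemma pair_comp {Z Z' A B : Sys} (f : Hom Z A) (g : Hom Z B) (h : Hom Z' Z) :
  << f, g >> \; h = << f \; h, g \; h >>.
Proof.
  apply pair_ext; rewrite comp_assoc, ?pi1_pair, ?pi2_pair; reflexivity.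
Qed.

Lemma pair_eta {A B : Sys} : << pi1, pi2 >> = idh (pS A B).
Proof. apply pair_ext; rewrite comp_idr, ?pi1_pair, ?pi2_pair; reflexivity. Qed.

Lemma bang_uniq {A : Sys} (f g : Hom A oneS) : f = g.
Proof. apply (reps_eq (reps_raw f) (reps_raw g)), meq_termP. Qed.

Lemma bang_comp {A B : Sys} (f : Hom A B) : bang B \; f = bang A.
Proof. apply bang_uniq. Qed.

Lemma reps_pair {Z A B : Sys} {F : Mor Z A} {G : Mor Z B} {f : Hom Z A} {g : Hom Z B} :
  reps F f -> reps G g -> reps (mpair F G : Mor Z (pS A B)) << f, g >>.
Proof.
  intros HF HG.
  assert (H : IsMor (mpair F G)).
  { apply (IsMor_mpair (sysP Z)); [apply (reps_IsMor HF) | apply (reps_IsMor HG)]. }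
  exists H.
  change (@homc Z (pS A B) (mpair F G) H = << f, g >>); apply pair_ext; rewrite ?pi1_pair, ?pi2_pair.
  - apply (reps_eq (reps_comp (reps_fst A B) (reps_homc _ _)) HF), (mfst_mpair (sysP Z)).
  - apply (reps_eq (reps_comp (reps_snd A B) (reps_homc _ _)) HG), (msnd_mpair (sysP Z)).
Qed.

Lemma reps_prod {A B C D : Sys} {F : Mor A C} {G : Mor B D} {f : Hom A C} {g : Hom B D} :
  reps F f -> reps G g ->
  reps (mprod F G : Mor (pS A B) (pS C D)) << f \; pi1, g \; pi2 >>.
Proof.
  intros HF HG; eapply meq_reps.
  - apply meq_sym, (mprod_mpair (sysP A) (sysP B)).
  - apply (@reps_pair (pS A B) C D); apply (@reps_comp (pS A B)); first [assumption | apply reps_homc].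
Qed.

Lemma reps_assoc (A B C : Sys) :
  reps (massoc A B C : Mor (pS (pS A B) C) (pS A (pS B C)))
    << pi1 \; pi1, << pi2 \; pi1, pi2 >> >>.
Proof.
  eapply meq_reps; [apply meq_sym, (massoc_mpair (sysP A) (sysP B) (sysP C)) |].
  apply (@reps_pair (pS (pS A B) C) A (pS B C)).
  - apply (@reps_comp (pS (pS A B) C) (pS A B) A); apply reps_homc.
  - apply (@reps_pair (pS (pS A B) C) B C).
    + apply (@reps_comp (pS (pS A B) C) (pS A B) B); apply reps_homc.
    + apply (reps_snd (pS A B) C).
Qed.

Lemma reps_lunit (A : Sys) : reps (mlunit A : Mor A (pS oneS A)) << bang A, idh A >>.
Proof.
  eapply meq_reps; [apply meq_sym, (mlunit_mpair (sysP A)) |].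
  apply (@reps_pair A oneS A); apply reps_homc.
Qed.

Lemma reps_runit (A : Sys) : reps (mrunit A : Mor A (pS A oneS)) << idh A, bang A >>.
Proof.
  eapply meq_reps; [apply meq_sym, (mrunit_mpair (sysP A)) |].
  apply (@reps_pair A A oneS); apply reps_homc.
Qed.

#[global] Opaque comp pairh.

(** * Cofinal directed sets *)

Lemma posetCat_hom_eq {D : DirSet} (i j : ob (posetCat D)) (p q : hom i j) : p = q.
Proof. exact (proof_irrelevance (dle i j) p q). Qed.


(* [IsCofinal] alone does not make [canon] an isomorphism: parallel arrows into
   [u c] must also be merged by an arrow coming from [C]. *)
Definition StrongCofinal {C D : FCat} (u : FFun C D) : Prop :=
  IsCofinal u /\
  forall d c (f g : hom d (fob u c)), exists c' (p : hom c c'),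
    cmp (fhom u p) f = cmp (fhom u p) g.

Section FiniteDiagrams.
Variable I : FCat.

Definition arrow : Type := { i : ob I & { j : ob I & hom i j } }.
Definition arr {i j : ob I} (f : hom i j) : arrow := existT _ i (existT _ j f).

(** [rank] excludes cycles [d < d' < d] in the order defined below; in such a cycle the two
    transition maps would have to compose to an identity. *)
Record diagram := {
  objs : list (ob I);
  arrs : list arrow;
  vtx : ob I;
  leg : forall i, In i objs -> hom i vtx;
  leg_comm : forall i j (f : hom i j) (hi : In i objs) (hj : In j objs),
      In (arr f) arrs -> cmp (leg j hj) f = leg i hi;
  rank : nat
}.

Lemma cocone_objs (l : list (ob I)) :
  exists v, inhabited (forall i, In i l -> hom i v).
Proof.
  enough (exists v, forall i, In i l -> exists f : hom i v, True) as [v H].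
  { exists v; constructor; intros i hi.
    exact (proj1_sig (constructive_indefinite_description _ (H i hi))). }
  induction l as [| a l [v IH]].
  - destruct (f_nonempty I) as [v _]; exists v; intros i [].
  - destruct (f_cone I a v) as [w [p [q _]]]; exists w; intros i [<- | hi].
    + exists p; exact Logic.I.
    + destruct (IH i hi) as [f _]; exists (cmp q f); exact Logic.I.
Qed.

Lemma cocone_exists (l : list (ob I)) (r : list arrow) :
  exists v, exists lg : forall i, In i l -> hom i v,
    forall i j (f : hom i j) (hi : In i l) (hj : In j l),
      In (arr f) r -> cmp (lg j hj) f = lg i hi.
Proof.
  induction r as [| [i [j f]] r [v [lg IH]]].
  - destruct (cocone_objs l) as [v [lg]]; exists v, lg; intros i j f hi hj [].
  (* An arrow whose ends are not both listed imposes nothing; otherwise all legs are prolonged by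
     one coequalising arrow. *)
  - destruct (classic (In i l /\ In j l)) as [[hi hj] | n].
    + destruct (f_coeq I _ _ (cmp (lg j hj) f) (lg i hi)) as [w [h e]].
      exists w, (fun k hk => cmp h (lg k hk)); intros i' j' f' hi' hj' [e' | hf'].
      * change (arr f = arr f') in e'.
        pose proof (f_equal (@projT1 _ _) e') as ei; simpl in ei; subst i'.
        apply inj_pair2 in e'.
        pose proof (f_equal (@projT1 _ _) e') as ej; simpl in ej; subst j'.
        apply inj_pair2 in e'; subst f'.
        rewrite (proof_irrelevance _ hi' hi), (proof_irrelevance _ hj' hj), <- cmp_assoc; exact e.
      * rewrite <- cmp_assoc; f_equal; apply IH, hf'.
    + exists v, lg; intros i' j' f' hi' hj' [e' | hf']; [| apply IH, hf'].
      exfalso; apply n.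
      change (arr f = arr f') in e'.
      pose proof (f_equal (@projT1 _ _) e') as ei; simpl in ei; subst i'.
      apply inj_pair2 in e'.
      pose proof (f_equal (@projT1 _ _) e') as ej; simpl in ej; subst j'.
      split; assumption.
Qed.

Lemma diagram_exists (l : list (ob I)) (r : list arrow) (n : nat) :
  exists d : diagram, objs d = l /\ arrs d = r /\ rank d = n.
Proof.
  destruct (cocone_exists l r) as [v [lg h]].
  exists {| objs := l; arrs := r; vtx := v; leg := lg; leg_comm := h; rank := n |}.
  repeat split.
Qed.

Lemma In_image {S T : Type} (l : list S) (F : forall i, In i l -> T) :
  exists r : list T, forall i hi, In (F i hi) r.
Proof.
  induction l as [| a l IH].
  - exists nil; intros i [].
  - destruct (IH (fun i hi => F i (or_intror hi))) as [r hr].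
    exists (F a (or_introl eq_refl) :: r); intros i [<- | hi]; [left | right]; [reflexivity |].
    apply hr.
Qed.

(** The transition map of [d < d'] is the leg of [d'] at the vertex of [d]. Having the legs of [d]
    among the arrows of [d'] makes these maps compose: for [d < d' < d''], [leg_comm] of [d'']
    applies to the leg of [d'] at the vertex of [d]. *)
Definition dlt (d d' : diagram) : Prop :=
  rank d < rank d' /\ In (vtx d) (objs d') /\ incl (objs d) (objs d') /\
  incl (arrs d) (arrs d') /\ forall i hi, In (arr (leg d i hi)) (arrs d').

Lemma dlt_trans (d d' d'' : diagram) : dlt d d' -> dlt d' d'' -> dlt d d''.
Proof.
  intros [r [v [o [a l]]]] [r' [v' [o' [a' l']]]]; split; [lia |].
  split; [apply o', v |].
  split; [intros x hx; apply o', o, hx |].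
  split; [intros x hx; apply a', a, hx |].
  intros i hi; apply a', l.
Qed.

(** The prescribed lists [l] and [r] serve strong cofinality, where the upper bound must also
    contain two given parallel arrows. *)
Lemma dlt_upper (d d' : diagram) (l : list (ob I)) (r : list arrow) :
  exists d'', dlt d d'' /\ dlt d' d'' /\ incl l (objs d'') /\ incl r (arrs d'').
Proof.
  destruct (In_image (objs d) (fun i hi => arr (leg d i hi))) as [s hs].
  destruct (In_image (objs d') (fun i hi => arr (leg d' i hi))) as [s' hs'].
  destruct (diagram_exists (vtx d :: vtx d' :: objs d ++ objs d' ++ l)
              (arrs d ++ arrs d' ++ s ++ s' ++ r) (S (rank d + rank d')))
    as [d'' [eo [ea er]]].
  exists d''; unfold dlt, incl; rewrite eo, ea, er.
  repeat split; try lia; intros; simpl; rewrite ?in_app_iff; auto 10.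
Qed.

Definition dord (d d' : diagram) : Prop := d = d' \/ dlt d d'.

Definition dirDiagram : DirSet.
Proof.
  refine {| dcar := diagram; dle := dord |}.
  - left; reflexivity.
  - intros i j k [-> | h] [-> | h']; [left; reflexivity | right; assumption .. |].
    right; apply (dlt_trans _ j); assumption.
  - destruct (diagram_exists nil nil 0) as [d _]; exists d; exact Logic.I.
  - intros d d'; destruct (dlt_upper d d' nil nil) as [e [h [h' _]]].
    exists e; split; right; assumption.
Defined.

Lemma dlt_of_dord (d d' : diagram) : dord d d' -> d <> d' -> In (vtx d) (objs d').
Proof. intros [e | h] n; [contradiction | exact (proj1 (proj2 h))]. Qed.

Definition dtrans (d d' : diagram) (p : dord d d') : hom (vtx d) (vtx d') :=
  match excluded_middle_informative (d = d') with
  | left e => match e in _ = y return hom (vtx d) (vtx y) with eq_refl => idc _ end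
  | right n => leg d' (vtx d) (dlt_of_dord d d' p n)
  end.

Lemma dtrans_refl (d : diagram) (p : dord d d) : dtrans d d p = idc _.
Proof.
  unfold dtrans; destruct (excluded_middle_informative (d = d)) as [e | n].
  - rewrite (proof_irrelevance _ e eq_refl); reflexivity.
  - destruct (n eq_refl).
Qed.

Lemma dtrans_lt (d d' : diagram) (p : dord d d') (h : dlt d d') (hv : In (vtx d) (objs d')) :
  dtrans d d' p = leg d' (vtx d) hv.
Proof.
  unfold dtrans; destruct (excluded_middle_informative (d = d')) as [e | n].
  - subst d'; destruct h as [h _]; lia.
  - f_equal; apply proof_irrelevance.
Qed.

Definition diagFun : FFun (posetCat dirDiagram) I :=
  Build_FFun (posetCat dirDiagram) I vtx dtrans.

Lemma diagFun_functor : IsFunctor diagFun.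
Proof.
  split.
  - intro d; apply dtrans_refl.
  - intros d d' d'' p q; simpl in *.
    destruct (classic (d = d')) as [<- | n].
    { rewrite dtrans_refl, cmp_idr; f_equal; apply proof_irrelevance. }
    destruct (classic (d' = d'')) as [<- | n'].
    { rewrite dtrans_refl, cmp_idl; f_equal; apply proof_irrelevance. }
    destruct p as [e | p]; [contradiction |].
    destruct q as [e | q]; [contradiction |].
    pose proof (proj1 (proj2 p)) as hp.
    pose proof (proj1 (proj2 q)) as hq.
    pose proof (dlt_trans _ _ _ p q) as pq.
    pose proof (proj1 (proj2 pq)) as hpq.
    rewrite (dtrans_lt d d' _ p hp), (dtrans_lt d' d'' _ q hq), (dtrans_lt d d'' _ pq hpq).
    symmetry; apply leg_comm; exact (proj2 (proj2 (proj2 (proj2 q))) _ hp).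
Qed.

(** Parallel arrows into a vertex are merged by listing both in a larger diagram, whose legs commute
    with each of them. *)
Lemma diagFun_cofinal : StrongCofinal diagFun.
Proof.
  split.
  - intro i; destruct (diagram_exists (i :: nil) nil 0) as [d [e _]].
    assert (h : In i (objs d)) by (rewrite e; left; reflexivity).
    exists d, (leg d i h); exact Logic.I.
  - intros i d f g; simpl in *.
    destruct (dlt_upper d d (i :: nil) (arr f :: arr g :: nil)) as [d' [h [_ [ho ha]]]].
    exists d', (or_intror h); simpl.
    pose proof (proj1 (proj2 h)) as hv.
    assert (hi : In i (objs d')) by (apply ho; left; reflexivity).
    rewrite (dtrans_lt d d' _ h hv).
    rewrite (leg_comm d' i _ f hi), (leg_comm d' i _ g hi); [reflexivity | |];
      apply ha; simpl; auto.
Qed.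

End FiniteDiagrams.

Definition funPair {C D E : FCat} (u : FFun C D) (v : FFun C E) : FFun C (prodCat D E) :=
  Build_FFun C (prodCat D E) (fun c => (fob u c, fob v c)) (fun c c' p => (fhom u p, fhom v p)).

Definition funFst {C D E : FCat} (u : FFun C (prodCat D E)) : FFun C D :=
  Build_FFun C D (fun c => fst (fob u c)) (fun c c' p => fst (fhom u p)).

Definition funSnd {C D E : FCat} (u : FFun C (prodCat D E)) : FFun C E :=
  Build_FFun C E (fun c => snd (fob u c)) (fun c c' p => snd (fhom u p)).

Lemma funFst_functor {C D E : FCat} (u : FFun C (prodCat D E)) :
  IsFunctor u -> IsFunctor (funFst u).
Proof.
  intros [h1 h2]; split; intros; simpl; [rewrite h1 | rewrite h2]; reflexivity.
Qed.

Lemma funSnd_functor {C D E : FCat} (u : FFun C (prodCat D E)) :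
  IsFunctor u -> IsFunctor (funSnd u).
Proof.
  intros [h1 h2]; split; intros; simpl; [rewrite h1 | rewrite h2]; reflexivity.
Qed.

Lemma funPair_functor {C D E : FCat} (u : FFun C D) (v : FFun C E) :
  IsFunctor u -> IsFunctor v -> IsFunctor (funPair u v).
Proof.
  intros [h1 h2] [k1 k2]; split; intros; simpl; [rewrite h1, k1 | rewrite h2, k2]; reflexivity.
Qed.

Lemma funFst_cofinal {C D E : FCat} (u : FFun C (prodCat D E)) :
  StrongCofinal u -> StrongCofinal (funFst u).
Proof.
  intros [h1 h2]; split.
  - intro d; destruct (f_nonempty E) as [e _].
    destruct (h1 (d, e)) as [c [p _]]; exists c, (fst p); exact Logic.I.
  - intros d c f g.
    destruct (h2 (d, snd (fob u c)) c (f, idc _) (g, idc _)) as [c' [p e]].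
    exists c', p; exact (f_equal fst e).
Qed.

Lemma funSnd_cofinal {C D E : FCat} (u : FFun C (prodCat D E)) :
  StrongCofinal u -> StrongCofinal (funSnd u).
Proof.
  intros [h1 h2]; split.
  - intro d; destruct (f_nonempty D) as [e _].
    destruct (h1 (e, d)) as [c [p _]]; exists c, (snd p); exact Logic.I.
  - intros d c f g.
    destruct (h2 (fst (fob u c), d) c (idc _, f) (idc _, g)) as [c' [p e]].
    exists c', p; exact (f_equal snd e).
Qed.

Lemma funPair_cofinal {C D E : FCat} (u : FFun C D) (v : FFun C E) :
  IsFunctor u -> IsFunctor v -> StrongCofinal u -> StrongCofinal v ->
  StrongCofinal (funPair u v).
Proof.
  intros Fu Fv [h1 h2] [k1 k2]; split.
  - intros [d e]; destruct (h1 d) as [c [p _]], (k1 e) as [c' [p' _]].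
    destruct (f_cone C c c') as [c'' [q [q' _]]].
    exists c''.
    exists ((cmp (fhom u q) p, cmp (fhom v q') p') : @hom (prodCat D E) (d, e) (fob (funPair u v) c'')).
    exact Logic.I.
  - intros [d e] c [f f'] [g g']; simpl in *.
    destruct (h2 d c f g) as [c1 [p ep]].
    destruct (k2 e c f' g') as [c2 [q eq]].
    destruct (f_cone C c1 c2) as [c3 [r [s _]]].
    destruct (f_coeq C _ _ (cmp r p) (cmp s q)) as [c4 [t et]].
    exists c4, (cmp t (cmp r p)); simpl; f_equal.
    + rewrite !(proj2 Fu), <- !cmp_assoc, ep; reflexivity.
    + rewrite et, !(proj2 Fv), <- !cmp_assoc, eq; reflexivity.
Qed.

(** * Reindexing *)

Section Reindex.
Variables (P : ProGrp) (C : FCat) (u : FFun C (gidx P)).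
Hypotheses (HP : IsProGrp P) (Fu : IsFunctor u) (Cu : StrongCofinal u).

Lemma IsProGrp_reindex : IsProGrp (reindex P u).
Proof.
  destruct HP as [[h1 h2] [h3 h4]]; repeat split; simpl; intros; try apply h3.
  - rewrite (proj1 Fu); apply h1.
  - rewrite (proj2 Fu); apply h2.
  - intros x y; apply h4.
Qed.

Definition decanon : Mor (uP (reindex P u)) (uP P) := fun i =>
  let c := constructive_indefinite_description _ (proj1 Cu i) in
  let p := constructive_indefinite_description _ (proj2_sig c) in
  existT (fun c : ob C => gcar (ggrp P (fob u c)) -> gcar (ggrp P i))
    (proj1_sig c) (gmap P (proj1_sig p)).

(** Makes the choices in [decanon] harmless. The arrows [p] and [p'], moved to a common index of
    [C], become parallel, and the second half of strong cofinality merges them. *)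
Lemma reindex_geq {S : Type} (i : ob (gidx P)) (f : gcar (ggrp P i) -> S)
    (c c' : ob C) (p : hom i (fob u c)) (p' : hom i (fob u c')) :
  @geq (uP (reindex P u)) S (existT _ c (fun x => f (gmap P p x)))
    (existT _ c' (fun x => f (gmap P p' x))).
Proof.
  destruct HP as [[_ h2] _]; simpl in h2.
  destruct (f_cone C c c') as [d [q [q' _]]].
  destruct (proj2 Cu i d (cmp (fhom u q) p) (cmp (fhom u q') p')) as [d' [r e]].
  exists d', (cmp r q), (cmp r q'); intro x; simpl.
  rewrite <- !h2, !(proj2 Fu), <- !cmp_assoc, e; reflexivity.
Qed.

Lemma canon_GMor : IsGMor (canon P u).
Proof.
  split.
  - intros c c' p.
    apply geq_sym, (geq_res (A := uP P) (proj1 HP) _ _ (fhom u p) (fun x => x)).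
  - intros c x y; reflexivity.
Qed.

Lemma canon_GIso : IsGIso (canon P u).
Proof.
  split; [apply canon_GMor |].
  exists decanon; split; [split | split].
  - intros i i' b; unfold decanon.
    destruct (constructive_indefinite_description _ (proj1 Cu i)) as [c hc].
    destruct (constructive_indefinite_description _ (proj1 Cu i')) as [c' hc']; simpl.
    destruct (constructive_indefinite_description _ hc) as [p hp].
    destruct (constructive_indefinite_description _ hc') as [p' hp']; simpl.
    pose proof (reindex_geq i (fun x => x) c' c (cmp p' b) p) as [k [q [q' e]]].
    exists k, q, q'; intro x; eapply eq_trans; [| exact (e x)]; simpl.
    symmetry; apply (proj2 (proj1 HP)).
  - intro i; apply (proj2 (proj2 HP)).
  - intro i; unfold decanon.
    apply geq_sym, (geq_res (A := uP P) (proj1 HP) _ _ _ (fun x => x)).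
  - intro c; unfold decanon, mcomp, mid; simpl.
    destruct (constructive_indefinite_description _ (proj1 Cu (fob u c))) as [c' hc']; simpl.
    destruct (constructive_indefinite_description _ hc') as [p hp]; simpl.
    pose proof (reindex_geq _ (fun x => x) c' c p (idc _)) as [k [q [q' e]]].
    exists k, q, q'; intro x; eapply eq_trans; [exact (e x) |]; simpl.
    apply (proj1 (proj1 HP)).
Qed.

End Reindex.

(** Turns an equality in the colimit into a pointwise identity at all sufficiently high levels of
    [D], with the transition map of [D] on both sides. The two unrelated arrows [p] and [q] of the
    germ equality are absorbed by strong cofinality, one after the other. *)
Lemma geq_level {A : ProSet} (HA : IsSys A) {D : DirSet} (w : FFun (posetCat D) (pidx A))
    (Fw : IsFunctor w) (Cw : StrongCofinal w) {S : Type} (i : dcar D)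
    (f g : pobj A (fob w i) -> S) :
  @geq A S (existT _ (fob w i) f) (existT _ (fob w i) g) ->
  exists k, dle i k /\ forall l (p : @hom (posetCat D) i l), dle k l ->
    forall x, f (pmap A (fhom w p) x) = g (pmap A (fhom w p) x).
Proof.
  intros [o [p [q e]]]; simpl in p, q, e.
  destruct (proj1 Cw o) as [c [r _]].
  destruct (f_cone (posetCat D) i c) as [d [s [t _]]].
  destruct (proj2 Cw _ d (cmp (fhom w t) (cmp r p)) (fhom w s)) as [d1 [h1 e1]].
  destruct (proj2 Cw _ d1 (cmp (fhom w h1) (cmp (fhom w t) (cmp r q)))
              (cmp (fhom w h1) (fhom w s))) as [d2 [h2 e2]].
  exists d2; split; [exact (cmp h2 (cmp h1 s)) |].
  intros l pl kl x.
  assert (ep : fhom w pl = cmp (fhom w (kl : @hom (posetCat D) d2 l))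
                 (cmp (fhom w h2) (cmp (fhom w h1) (fhom w s)))).
  { rewrite <- !(proj2 Fw); f_equal; apply posetCat_hom_eq. }
  destruct HA as [_ HA].
  set (z := cmp (fhom w (kl : @hom (posetCat D) d2 l)) (cmp (fhom w h2) (cmp (fhom w h1) (cmp (fhom w t) r)))).
  assert (e1' : fhom w pl = cmp z p).
  { rewrite ep, <- e1; unfold z; rewrite !cmp_assoc; reflexivity. }
  assert (e2' : fhom w pl = cmp z q).
  { rewrite ep, <- e2; unfold z; rewrite !cmp_assoc; reflexivity. }
  rewrite e1' at 1; rewrite e2', !HA; apply e.
Qed.

(** * Groups of words *)

Section WordGroup.
Variables (S : Type) (inv : S -> S) (R : list S -> list S -> Prop).
Context {E : Equivalence R}.
Hypotheses
  (R_app : forall v v' w w', R v v' -> R w w' -> R (v ++ w) (v' ++ w'))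
  (R_invr : forall s, R (s :: inv s :: nil) nil)
  (R_invl : forall s, R (inv s :: s :: nil) nil).

(** Words modulo a congruence for which [inv] is a formal inverse of letters. It serves twice: for
    the level groups that replace [X_j] and for free groups. *)
Definition wordGrp : Grp :=
  {| gcar := Quot R;
     gmul := fun q q' => cls R (rep q ++ rep q');
     gone := cls R nil;
     ginv := fun q => cls R (rev (map inv (rep q))) |}.

Lemma wordGrp_mul (w w' : list S) :
  @gmul wordGrp (cls R w) (cls R w') = cls R (w ++ w').
Proof. apply cls_eq; [exact E |]; apply R_app; apply rep_cls; exact E. Qed.

Lemma word_invr (w : list S) : R (w ++ rev (map inv w)) nil.
Proof.
  induction w as [| s w IH]; simpl; [reflexivity |].
  rewrite app_assoc.
  transitivity ((s :: nil) ++ nil ++ (inv s :: nil)); [| apply R_invr].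
  change (R ((s :: nil) ++ ((w ++ rev (map inv w)) ++ (inv s :: nil)))
            ((s :: nil) ++ nil ++ (inv s :: nil))).
  apply R_app; [reflexivity | apply R_app; [exact IH | reflexivity]].
Qed.

Lemma word_invl (w : list S) : R (rev (map inv w) ++ w) nil.
Proof.
  induction w as [| s w IH]; simpl; [reflexivity |].
  rewrite <- app_assoc; simpl.
  transitivity (rev (map inv w) ++ nil ++ w); [| exact IH].
  change (inv s :: s :: w) with ((inv s :: s :: nil) ++ w).
  apply R_app; [reflexivity | apply R_app; [apply R_invl | reflexivity]].
Qed.

Lemma wordGrp_group : IsGroup wordGrp.
Proof.
  repeat split.
  - intros x y z; rewrite <- (cls_rep _ x), <- (cls_rep _ y), <- (cls_rep _ z), !wordGrp_mul.
    rewrite app_assoc; reflexivity.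
  - intro x; rewrite <- (cls_rep _ x); apply wordGrp_mul.
  - intro x; rewrite <- (cls_rep _ x); change gone with (cls R nil).
    rewrite wordGrp_mul, app_nil_r; reflexivity.
  - intro q; pose proof (wordGrp_mul (rev (map inv (rep q))) (rep q)) as e; rewrite cls_rep in e.
    eapply eq_trans; [exact e |]; apply cls_eq; [exact E | apply word_invl].
  - intro q; pose proof (wordGrp_mul (rep q) (rev (map inv (rep q)))) as e; rewrite cls_rep in e.
    eapply eq_trans; [exact e |]; apply cls_eq; [exact E | apply word_invr].
Qed.

End WordGroup.

(** * Levelwise representation of an action *)

Lemma grp_idem {H : Grp} (HH : IsGroup H) (x : gcar H) : gmul x x = x -> x = gone.
Proof.
  destruct HH as [a [l [r [il ir]]]]; intro e.
  rewrite <- (l x), <- (il x), <- a, e; reflexivity.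
Qed.

Lemma grp_inv_uniq {H : Grp} (HH : IsGroup H) (x y : gcar H) : gmul x y = gone -> y = ginv x.
Proof.
  destruct HH as [a [l [r [il ir]]]]; intro e.
  rewrite <- (l y), <- (il x), <- a, e, r; reflexivity.
Qed.

Lemma IsHom_one {H K : Grp} (HH : IsGroup H) (HK : IsGroup K) (f : gcar H -> gcar K) :
  IsHom H K f -> f gone = gone.
Proof.
  intro hf; apply (grp_idem HK); rewrite <- hf; f_equal; apply HH.
Qed.

Lemma IsHom_inv {H K : Grp} (HH : IsGroup H) (HK : IsGroup K) (f : gcar H -> gcar K) :
  IsHom H K f -> forall x, f (ginv x) = ginv (f x).
Proof.
  intros hf x; apply (grp_inv_uniq HK); rewrite <- hf.
  rewrite (proj2 (proj2 (proj2 (proj2 HH)))); apply (IsHom_one HH HK f hf).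
Qed.

Lemma IsMor_mprod {A B C D : ProSet} (HA : IsSys A) (HB : IsSys B)
    (F : Mor A C) (G : Mor B D) : IsMor F -> IsMor G -> IsMor (mprod F G).
Proof.
  intros HF HG; pose proof (IsSys_prodP _ _ HA HB) as HAB.
  apply (IsMor_meq HAB _ _ (meq_sym _ _ (mprod_mpair HA HB F G))).
  apply (IsMor_mpair HAB); apply (IsMor_mcomp HAB); try assumption.
  - apply IsMor_mfst; assumption.
  - apply IsMor_msnd; assumption.
Qed.

Lemma IsMor_lmul (P : ProGrp) (HP : IsProGrp P) : IsMor (lmul P).
Proof.
  destruct HP as [[h1 h2] [h3 h4]]; simpl in *; intros j j' b.
  exists (j', j'), (idc j', idc j'), (b, b); intros [x y]; simpl.
  rewrite !h1; apply h4.
Qed.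

Lemma IsMor_lone (P : ProGrp) (HP : IsProGrp P) : IsMor (lone P).
Proof.
  destruct HP as [HS [h3 h4]]; intros j j' b; exists tt, tt, tt; intro x; simpl.
  apply IsHom_one; auto.
Qed.

Lemma IsMor_linv (P : ProGrp) (HP : IsProGrp P) : IsMor (linv P).
Proof.
  destruct HP as [[h1 h2] [h3 h4]]; simpl in *; intros j j' b.
  exists j', (idc j'), b; intro x; simpl; rewrite h1.
  apply IsHom_inv; auto.
Qed.

Lemma lmul_mpair {Z : ProSet} (P : ProGrp) (F F' : Mor Z (uP P)) (j : ob (gidx P)) :
  mcomp (lmul P) (mpair F F') j =
  gpost (fun xy => gmul (fst xy) (snd xy)) (gpair (F j) (F' j)).
Proof. reflexivity. Qed.

Section Levelwise.

Variables (G X : ProGrp) (HG : IsProGrp G) (HX : IsProGrp X).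
Variables (a : Mor (prodP (uP G) (uP X)) (uP X)) (Ha : IsProSetAction G X a).
Variables (D : DirSet) (u : FFun (posetCat D) (prodCat (gidx G) (gidx X))).
Hypotheses (Fu : IsFunctor u) (Cu : StrongCofinal u).

Let GX := prodP (uP G) (uP X).
Let HGX : IsSys GX := IsSys_prodP _ _ (proj1 HG) (proj1 HX).

Let uG : FFun (posetCat D) (gidx G) := funFst u.
Let uX : FFun (posetCat D) (gidx X) := funSnd u.
Let FuG : IsFunctor uG := funFst_functor u Fu.
Let FuX : IsFunctor uX := funSnd_functor u Fu.
Let CuG : StrongCofinal uG := funFst_cofinal u Cu.
Let CuX : StrongCofinal uX := funSnd_cofinal u Cu.

Let Gl (i : dcar D) : Grp := ggrp G (fob uG i).
Let Xl (i : dcar D) : Grp := ggrp X (fob uX i).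

Let gGl (i : dcar D) : IsGroup (Gl i) := proj1 (proj2 HG) _.
Let gXl (i : dcar D) : IsGroup (Xl i) := proj1 (proj2 HX) _.

Definition Gr {i j : dcar D} (p : dle i j) : gcar (Gl j) -> gcar (Gl i) :=
  gmap G (fhom uG (p : @hom (posetCat D) i j)).
Definition Xr {i j : dcar D} (p : dle i j) : gcar (Xl j) -> gcar (Xl i) :=
  gmap X (fhom uX (p : @hom (posetCat D) i j)).

Lemma Gr_comp {i j k : dcar D} (p : dle i j) (q : dle j k) (r : dle i k) (x : gcar (Gl k)) :
  Gr p (Gr q x) = Gr r x.
Proof.
  unfold Gr; rewrite (posetCat_hom_eq i k r (dle_trans D i j k p q)).
  change (dle_trans D i j k p q) with (@cmp (posetCat D) i j k q p).
  rewrite (proj2 FuG); symmetry; apply (proj2 (proj1 HG)).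
Qed.

Lemma Xr_comp {i j k : dcar D} (p : dle i j) (q : dle j k) (r : dle i k) (x : gcar (Xl k)) :
  Xr p (Xr q x) = Xr r x.
Proof.
  unfold Xr; rewrite (posetCat_hom_eq i k r (dle_trans D i j k p q)).
  change (dle_trans D i j k p q) with (@cmp (posetCat D) i j k q p).
  rewrite (proj2 FuX); symmetry; apply (proj2 (proj1 HX)).
Qed.

Lemma Gr_id {i : dcar D} (p : dle i i) (x : gcar (Gl i)) : Gr p x = x.
Proof.
  unfold Gr; rewrite (posetCat_hom_eq i i p (@idc (posetCat D) i)), (proj1 FuG).
  apply (proj1 (proj1 HG)).
Qed.

Lemma Xr_id {i : dcar D} (p : dle i i) (x : gcar (Xl i)) : Xr p x = x.
Proof.
  unfold Xr; rewrite (posetCat_hom_eq i i p (@idc (posetCat D) i)), (proj1 FuX).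
  apply (proj1 (proj1 HX)).
Qed.

Lemma Gr_mul {i j : dcar D} (p : dle i j) x y : Gr p (gmul x y) = gmul (Gr p x) (Gr p y).
Proof. apply (proj2 (proj2 HG)). Qed.
Lemma Xr_mul {i j : dcar D} (p : dle i j) x y : Xr p (gmul x y) = gmul (Xr p x) (Xr p y).
Proof. apply (proj2 (proj2 HX)). Qed.
Lemma Gr_one {i j : dcar D} (p : dle i j) : Gr p gone = gone.
Proof. apply (IsHom_one (gGl j) (gGl i)), (proj2 (proj2 HG)). Qed.
Lemma Xr_one {i j : dcar D} (p : dle i j) : Xr p gone = gone.
Proof. apply (IsHom_one (gXl j) (gXl i)), (proj2 (proj2 HX)). Qed.

(** * Representatives of the action between two levels *)

Definition lact (i j : dcar D) : Type := gcar (Gl i) -> gcar (Xl i) -> gcar (Xl j).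

Definition agerm {i j : dcar D} (f : lact i j) : Germ GX (gcar (Xl j)) :=
  existT (fun c : ob (pidx GX) => pobj GX c -> gcar (Xl j)) (fob uG i, fob uX i)
    (fun gx => f (fst gx) (snd gx)).

Definition represents {i j : dcar D} (f : lact i j) : Prop := geq (agerm f) (a (fob uX j)).

Definition ares {i j k : dcar D} (p : dle i k) (f : lact i j) : lact k j :=
  fun g x => f (Gr p g) (Xr p x).

Lemma represents_exists (j : dcar D) : exists i (f : lact i j), represents f.
Proof.
  destruct (proj1 Cu (projT1 (a (fob uX j)))) as [i [p _]].
  exists i, (fun g x => projT2 (a (fob uX j)) (pmap GX (i' := (fob uG i, fob uX i)) p (g, x))).
  apply geq_sym.
  pose proof (geq_res HGX (projT1 (a (fob uX j))) (fob uG i, fob uX i) p (projT2 (a (fob uX j)))) as e.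
  destruct e as [k [q [r e]]]; exists k, q, r; intro x.
  eapply eq_trans; [apply (e x) |]; simpl.
  reflexivity.
Qed.

Lemma represents_ares {i j k : dcar D} (p : dle i k) (f : lact i j) :
  represents f -> represents (ares p f).
Proof.
  intro h; apply (geq_trans HGX _ (agerm f)); [| exact h].
  apply geq_sym.
  apply (geq_res HGX (fob uG i, fob uX i) (fob uG k, fob uX k)
           (fhom uG (p : @hom (posetCat D) i k), fhom uX (p : @hom (posetCat D) i k))).
Qed.

Lemma represents_post {i j k : dcar D} (q : dle k j) (f : lact i j) :
  represents f -> represents (fun g x => Xr q (f g x)).
Proof.
  intro h.
  apply (geq_trans HGX _ (gpost (Xr q) (a (fob uX j)))).
  - apply (geq_gpost (Xr q) _ _ h).
  - apply (proj1 Ha _ _ (fhom uX (q : @hom (posetCat D) k j))).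
Qed.

Lemma represents_level {i i' j : dcar D} (f : lact i j) (f' : lact i' j) :
  represents f -> represents f' ->
  exists k, dle i k /\ dle i' k /\
    forall l (p : dle i l) (p' : dle i' l), dle k l ->
      forall g x, ares p f g x = ares p' f' g x.
Proof.
  intros h h'.
  destruct (d_upper D i i') as [m [q q']].
  assert (e : geq (agerm (ares q f)) (agerm (ares q' f'))).
  { apply (geq_trans HGX _ (a (fob uX j))); [| apply geq_sym]; apply represents_ares; assumption. }
  apply (geq_level HGX (funPair uG uX)) in e;
    [| apply funPair_functor | apply funPair_cofinal]; try assumption.
  destruct e as [k [mk e]].
  exists k; split; [exact (dle_trans D _ _ _ q mk) |].
  split; [exact (dle_trans D _ _ _ q' mk) |].
  intros l p p' kl g x.
  pose (ml := dle_trans D _ _ _ mk kl).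
  assert (e' : f (Gr q (Gr ml g)) (Xr q (Xr ml x)) = f' (Gr q' (Gr ml g)) (Xr q' (Xr ml x)))
    by exact (e l ml kl (g, x)).
  rewrite (Gr_comp q ml p), (Gr_comp q' ml p'), (Xr_comp q ml p), (Xr_comp q' ml p') in e'.
  exact e'.
Qed.

Let GXX := prodP (uP G) (prodP (uP X) (uP X)).
Let HGXX : IsSys GXX :=
  IsSys_prodP _ _ (proj1 HG) (IsSys_prodP _ _ (proj1 HX) (proj1 HX)).

Definition germ3 {S : Type} (i : dcar D)
    (f : gcar (Gl i) -> gcar (Xl i) -> gcar (Xl i) -> S) : Germ GXX S :=
  existT (fun c : ob (pidx GXX) => pobj GXX c -> S) (fob uG i, (fob uX i, fob uX i))
    (fun z => f (fst z) (fst (snd z)) (snd (snd z))).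

Lemma germ3_level {S : Type} (i : dcar D) (f f' : gcar (Gl i) -> gcar (Xl i) -> gcar (Xl i) -> S) :
  geq (germ3 i f) (germ3 i f') ->
  exists k, dle i k /\ forall l (p : dle i l), dle k l ->
    forall g x y, f (Gr p g) (Xr p x) (Xr p y) = f' (Gr p g) (Xr p x) (Xr p y).
Proof.
  intro e; apply (geq_level HGXX (funPair uG (funPair uX uX))) in e.
  - destruct e as [k [ik e]]; exists k; split; [exact ik |]; intros l p kl g x y.
    exact (e l p kl (g, (x, y))).
  - repeat apply funPair_functor; assumption.
  - repeat apply funPair_cofinal; try assumption; apply funPair_functor; assumption.
Qed.

Lemma represents_mul_l {i j : dcar D} (f : lact i j) :
  represents f ->
  geq (germ3 i (fun g x y => f g (gmul x y)))
      (gpre (a (fob uX j)) (mprod (mid (uP G)) (lmul X))).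
Proof.
  intro h; apply (geq_gpre HGXX (agerm f) _ (mprod (mid (uP G)) (lmul X))); [| exact h].
  apply IsMor_mprod.
  - apply HG.
  - apply IsSys_prodP; apply HX.
  - apply IsMor_mid, HG.
  - apply IsMor_lmul, HX.
Qed.

Lemma represents_fst {i j : dcar D} (f : lact i j) :
  represents f ->
  geq (mcomp a (mprod (mid (uP G)) (mfst (uP X) (uP X))) (fob uX j)) (germ3 i (fun g x y => f g x)).
Proof.
  intro h.
  apply (geq_trans HGXX _ (gpre (agerm f) (mprod (mid (uP G)) (mfst (uP X) (uP X))))).
  - apply geq_sym, (geq_gpre HGXX (agerm f) _ (mprod (mid (uP G)) (mfst (uP X) (uP X)))); [| exact h].
    apply IsMor_mprod.
    + apply HG.
    + apply IsSys_prodP; apply HX.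
    + apply IsMor_mid, HG.
    + apply IsMor_mfst; apply HX.
  - destruct (mfst_at (uP X) (uP X) (fob uX i) (fob uX i)) as [k [p [q e]]].
    exists (fob uG i, k), (idc _, p), (idc _, q); intros [g x].
    exact (f_equal (f _) (e x)).
Qed.

Lemma represents_snd {i j : dcar D} (f : lact i j) :
  represents f ->
  geq (mcomp a (mprod (mid (uP G)) (msnd (uP X) (uP X))) (fob uX j)) (germ3 i (fun g x y => f g y)).
Proof.
  intro h.
  apply (geq_trans HGXX _ (gpre (agerm f) (mprod (mid (uP G)) (msnd (uP X) (uP X))))).
  - apply geq_sym, (geq_gpre HGXX (agerm f) _ (mprod (mid (uP G)) (msnd (uP X) (uP X)))); [| exact h].
    apply IsMor_mprod.
    + apply HG.
    + apply IsSys_prodP; apply HX.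
    + apply IsMor_mid, HG.
    + apply IsMor_msnd; apply HX.
  - destruct (msnd_at (uP X) (uP X) (fob uX i) (fob uX i)) as [k [p [q e]]].
    exists (fob uG i, k), (idc _, p), (idc _, q); intros [g x].
    exact (f_equal (f _) (e x)).
Qed.

(** Each action axiom is an equality of germs. Writing both sides through the representative [f] and
    testing at a high level of [D] gives a pointwise identity; [represents_one] and
    [represents_assoc] follow the same pattern. *)
Lemma represents_mul {i j : dcar D} (f : lact i j) :
  represents f ->
  exists k, dle i k /\ forall l (p : dle i l), dle k l ->
    forall g x y, ares p f g (gmul x y) = gmul (ares p f g x) (ares p f g y).
Proof.
  intro h.
  destruct (germ3_level i (fun g x y => f g (gmul x y)) (fun g x y => gmul (f g x) (f g y)))
    as [k [ik e]].
  2: { exists k; split; [exact ik |]; intros l p kl g x y.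
       unfold ares; rewrite Xr_mul; apply (e l p kl). }
  eapply (geq_trans HGXX); [apply represents_mul_l, h |].
  eapply (geq_trans HGXX); [apply (proj2 (proj2 (proj2 Ha)) (fob uX j)) |].
  rewrite lmul_mpair.
  apply (geq_gpost (fun xy => gmul (fst xy) (snd xy)) _
           (germ3 i (fun g x y => (f g x, f g y)))).
  apply (geq_gpair HGXX); [apply (represents_fst f h) | apply (represents_snd f h)].
Qed.

Lemma represents_one {i j : dcar D} (f : lact i j) (ji : dle j i) :
  represents f ->
  exists k, dle i k /\ forall l (p : dle i l) (r : dle j l), dle k l ->
    forall x, ares p f gone x = Xr r x.
Proof.
  intro h.
  pose proof (proj1 HG) as SG; pose proof (proj1 HX) as SX.
  assert (e : @geq (uP X) (gcar (Xl j))
     (existT (fun c : ob (gidx X) => gcar (ggrp X c) -> gcar (Xl j)) (fob uX i) (fun x => f gone x))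
     (existT (fun c : ob (gidx X) => gcar (ggrp X c) -> gcar (Xl j)) (fob uX i) (Xr ji))).
  2: { apply (geq_level SX uX FuX CuX) in e; destruct e as [k [ik e]].
       exists k; split; [exact ik |]; intros l p r kl x.
       rewrite <- (Xr_comp ji p r); unfold ares; rewrite Gr_one; exact (e l p kl x). }
  destruct Ha as [Ma [_ [H _]]].
  set (F := mcomp (mprod (lone G) (mid (uP X))) (mlunit (uP X))) in *.
  apply (geq_trans SX _ (gpre (a (fob uX j)) F)).
  { apply (geq_gpre SX (agerm f) _ F); [| exact h].
    apply (IsMor_mcomp SX).
    - apply IsMor_mprod; try assumption; [apply IsSys_termP | apply IsMor_lone; assumption |].
      apply IsMor_mid; assumption.
    - apply (reps_IsMor (reps_lunit (mkSys (uP X) SX))). }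
  eapply (geq_trans SX); [apply (H (fob uX j)) |].
  apply (geq_res SX (fob uX j) (fob uX i) (fhom uX (ji : @hom (posetCat D) j i)) (fun x => x)).
Qed.

Let GGX := prodP (prodP (uP G) (uP G)) (uP X).
Let HGGX : IsSys GGX :=
  IsSys_prodP _ _ (IsSys_prodP _ _ (proj1 HG) (proj1 HG)) (proj1 HX).

Definition germ3' {S : Type} (i j k : dcar D)
    (f : gcar (Gl i) -> gcar (Gl j) -> gcar (Xl k) -> S) : Germ GGX S :=
  existT (fun c : ob (pidx GGX) => pobj GGX c -> S) ((fob uG i, fob uG j), fob uX k)
    (fun z => f (fst (fst z)) (snd (fst z)) (snd z)).

Lemma germ3'_level {S : Type} (i : dcar D) (f f' : gcar (Gl i) -> gcar (Gl i) -> gcar (Xl i) -> S) :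
  geq (germ3' i i i f) (germ3' i i i f') ->
  exists k, dle i k /\ forall l (p : dle i l), dle k l ->
    forall h g x, f (Gr p h) (Gr p g) (Xr p x) = f' (Gr p h) (Gr p g) (Xr p x).
Proof.
  intro e; apply (geq_level HGGX (funPair (funPair uG uG) uX)) in e.
  - destruct e as [k [ik e]]; exists k; split; [exact ik |]; intros l p kl h g x.
    exact (e l p kl ((h, g), x)).
  - repeat apply funPair_functor; assumption.
  - repeat apply funPair_cofinal; try assumption; apply funPair_functor; assumption.
Qed.

Lemma germ3'_res {S : Type} {i j k m : dcar D} (p : dle i m) (q : dle j m) (r : dle k m)
    (f : gcar (Gl i) -> gcar (Gl j) -> gcar (Xl k) -> S) :
  geq (germ3' i j k f) (germ3' m m m (fun h g x => f (Gr p h) (Gr q g) (Xr r x))).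
Proof.
  apply (geq_res HGGX ((fob uG i, fob uG j), fob uX k) ((fob uG m, fob uG m), fob uX m)
    ((fhom uG (p : @hom (posetCat D) i m), fhom uG (q : @hom (posetCat D) j m)),
     fhom uX (r : @hom (posetCat D) k m))).
Qed.

Let actl := mprod (lmul G) (mid (uP X)).
Let actr := mcomp (mprod (mid (uP G)) a) (massoc (uP G) (uP G) (uP X)).

Lemma represents_assoc_l {i j : dcar D} (f : lact i j) :
  represents f ->
  geq (germ3' i i i (fun h g x => f (gmul h g) x)) (gpre (a (fob uX j)) actl).
Proof.
  intro h; apply (geq_gpre HGGX (agerm f) _ actl); [| exact h].
  apply IsMor_mprod.
  - apply IsSys_prodP; apply HG.
  - apply HX.
  - apply IsMor_lmul, HG.
  - apply IsMor_mid, HX.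
Qed.

Lemma represents_assoc_r {i i' j : dcar D} (f : lact i j) (f' : lact i' i) :
  represents f -> represents f' ->
  geq (gpre (a (fob uX j)) actr) (germ3' i i' i' (fun h g x => f h (f' g x))).
Proof.
  intros h h'.
  apply (geq_trans HGGX _ (gpre (agerm f) actr)).
  - apply geq_sym, (geq_gpre HGGX (agerm f) _ actr); [| exact h].
    apply (IsMor_mcomp HGGX).
    + apply IsMor_mprod.
      * apply HG.
      * exact HGX.
      * apply IsMor_mid, HG.
      * apply Ha.
    + apply (reps_IsMor (reps_assoc (mkSys _ (proj1 HG)) (mkSys _ (proj1 HG)) (mkSys _ (proj1 HX)))).
  - apply geq_sym; destruct h' as [[k1 k2] [[r1 r2] [[s1 s2] e]]].
    (* The outer group variable is untouched, so the witnesses for [f'] are extended by identities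
       on its factor. *)
    exists ((fob uG i, k1), k2), ((idc _, r1), r2), ((idc _, s1), s2); intros [[y g] x].
    exact (f_equal (f _) (e (g, x))).
Qed.

Lemma represents_assoc {i i' j : dcar D} (f : lact i j) (f' : lact i' i) :
  represents f -> represents f' ->
  exists k, dle i k /\ dle i' k /\
    forall l (p : dle i l) (p' : dle i' l), dle k l ->
    forall h g x, ares p f (gmul h g) x = f (Gr p h) (f' (Gr p' g) (Xr p' x)).
Proof.
  intros r r'.
  destruct (d_upper D i i') as [m [q q']].
  destruct (germ3'_level m (fun h g x => f (gmul (Gr q h) (Gr q g)) (Xr q x))
      (fun h g x => f (Gr q h) (f' (Gr q' g) (Xr q' x)))) as [k [mk e]].
  - eapply (geq_trans HGGX).
    { apply geq_sym, (germ3'_res q q q (fun h g x => f (gmul h g) x)). }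
    eapply (geq_trans HGGX); [apply represents_assoc_l, r |].
    eapply (geq_trans HGGX); [apply (proj1 (proj2 Ha) (fob uX j)) |].
    eapply (geq_trans HGGX); [apply (represents_assoc_r f f' r r') |].
    apply (germ3'_res q q' q').
  - exists k; split; [exact (dle_trans D _ _ _ q mk) |].
    split; [exact (dle_trans D _ _ _ q' mk) |].
    intros l p p' kl h g x.
    pose (ml := dle_trans D _ _ _ mk kl).
    specialize (e l ml kl h g x); simpl in e.
    rewrite !(Gr_comp q ml p), (Gr_comp q' ml p'), (Xr_comp q ml p), (Xr_comp q' ml p') in e.
    unfold ares; rewrite Gr_mul; exact e.
Qed.

(** In the last clause the outer map takes arguments at level [i], so the inner value must lie in
    [X_i]: the inner action is a representative [f'] with target [i], available only at a deeper
    level [i']. *)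
Definition good {i j : dcar D} (f : lact i j) : Prop :=
  represents f /\
  (forall g x y, f g (gmul x y) = gmul (f g x) (f g y)) /\
  (exists ji : dle j i, forall x, f gone x = Xr ji x) /\
  (exists i' (p : dle i i') (f' : lact i' i), represents f' /\
     forall h g x, f (gmul h (Gr p g)) (Xr p x) = f h (f' g x)).

(* The element [h] in the last clause of [good] ranges over the whole level [i],
   so associativity is first achieved above [i] and [f] is then restricted. *)
Lemma good_exists {i j : dcar D} (f : lact i j) :
  represents f ->
  exists k, dle i k /\ forall l (p : dle i l), dle k l -> good (ares p f).
Proof.
  intro h.
  destruct (represents_mul f h) as [k1 [ik1 e1]].
  destruct (d_upper D i j) as [m [im jm]].
  destruct (represents_one (ares im f) jm (represents_ares im f h)) as [k2 [mk2 e2]].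
  destruct (represents_exists i) as [i0 [f0 h0]].
  destruct (represents_assoc f f0 h h0) as [k3 [ik3 [i0k3 e3]]].
  destruct (d_upper D k1 k2) as [k12 [a1 a2]].
  destruct (d_upper D k12 k3) as [k [b1 b2]].
  exists k; split; [exact (dle_trans D _ _ _ ik3 b2) |].
  intros l p kl.
  assert (k1l : dle k1 l) by exact (dle_trans D _ _ _ a1 (dle_trans D _ _ _ b1 kl)).
  assert (k2l : dle k2 l) by exact (dle_trans D _ _ _ a2 (dle_trans D _ _ _ b1 kl)).
  assert (k3l : dle k3 l) by exact (dle_trans D _ _ _ b2 kl).
  assert (ml : dle m l) by exact (dle_trans D _ _ _ mk2 k2l).
  assert (jl : dle j l) by exact (dle_trans D _ _ _ jm ml).
  assert (i0l : dle i0 l) by exact (dle_trans D _ _ _ i0k3 k3l).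
  split; [apply represents_ares, h |].
  split; [apply e1, k1l |].
  split.
  { exists jl; intro x; rewrite <- (e2 l ml jl k2l x); unfold ares.
    rewrite (Gr_comp _ _ p), (Xr_comp _ _ p); reflexivity. }
  destruct (represents_exists l) as [n0 [f1 h1]].
  (* Projected along [p], [f1] represents the same germ as [f0]; from [n] on, the identity [e3]
     stated with [f0] can be restated with [f1], whose target is the required [l]. *)
  destruct (represents_level _ f0 (represents_post p f1 h1) h0) as [n [n0n [i0n e]]].
  destruct (d_upper D n l) as [n' [nn' ln']].
  assert (n0n' : dle n0 n') by exact (dle_trans D _ _ _ n0n nn').
  assert (i0n' : dle i0 n') by exact (dle_trans D _ _ _ i0n nn').
  exists n', ln', (ares n0n' f1); split; [apply represents_ares, h1 |].
  intros y g x.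
  rewrite (e3 l p i0l k3l); unfold ares at 1; f_equal.
  rewrite (Gr_comp _ _ i0n'), (Xr_comp _ _ i0n').
  symmetry; apply (e n' n0n' i0n' nn').
Qed.

(** * The groups of words and their directed index set *)

Record index := {
  src : dcar D;
  tgt : dcar D;
  iact : lact src tgt;
  iact_good : good iact
}.

Definition word (b : index) : Type := list (gcar (Gl (src b)) * gcar (Xl (src b))).

Definition ev (b : index) (h : gcar (Gl (src b))) : word b -> gcar (Xl (tgt b)) :=
  fold_right (fun gx acc => gmul (iact b (gmul h (fst gx)) (snd gx)) acc) gone.

Definition wres {b c : index} (p : dle (src b) (src c)) : word c -> word b :=
  map (fun gx => (Gr p (fst gx), Xr p (snd gx))).

Definition wact {b : index} (g : gcar (Gl (src b))) : word b -> word b :=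
  map (fun gx => (gmul g (fst gx), snd gx)).

Lemma iact_mul (b : index) g x y : iact b g (gmul x y) = gmul (iact b g x) (iact b g y).
Proof. apply (iact_good b). Qed.

Lemma iact_tgt (b : index) (g : gcar (Gl (src b))) : IsHom (Xl (src b)) (Xl (tgt b)) (iact b g).
Proof. intros x y; apply iact_mul. Qed.

Lemma tgt_le (b : index) : dle (tgt b) (src b).
Proof. destruct (iact_good b) as [_ [_ [[ji _] _]]]; exact ji. Qed.

Lemma iact_one (b : index) (p : dle (tgt b) (src b)) x : iact b gone x = Xr p x.
Proof.
  destruct (iact_good b) as [_ [_ [[ji e] _]]]; rewrite e.
  rewrite (posetCat_hom_eq _ _ ji p); reflexivity.
Qed.

Lemma ev_app (b : index) h (w w' : word b) : ev b h (w ++ w') = gmul (ev b h w) (ev b h w').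
Proof.
  destruct (gXl (tgt b)) as [as_ [l _]]; induction w as [| gx w IH]; simpl.
  - rewrite l; reflexivity.
  - rewrite IH, as_; reflexivity.
Qed.

Lemma ev_one (b : index) h gx : ev b h (gx :: nil) = iact b (gmul h (fst gx)) (snd gx).
Proof. apply (gXl (tgt b)). Qed.

Lemma ev_wact (b : index) h g (w : word b) : ev b h (wact g w) = ev b (gmul h g) w.
Proof.
  induction w as [| gx w IH]; simpl; [reflexivity |].
  rewrite IH, (proj1 (gGl (src b))); reflexivity.
Qed.

Lemma wres_comp {b c d : index} (p : dle (src b) (src c)) (q : dle (src c) (src d))
    (r : dle (src b) (src d)) (w : word d) : wres p (wres q w) = wres r w.
Proof.
  induction w as [| gx w IH]; simpl; [reflexivity |].
  rewrite IH, (Gr_comp p q r), (Xr_comp p q r); reflexivity.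
Qed.

Lemma wres_id {b : index} (p : dle (src b) (src b)) (w : word b) : wres p w = w.
Proof.
  induction w as [| [g x] w IH]; simpl; [reflexivity |].
  rewrite IH, Gr_id, Xr_id; reflexivity.
Qed.

Lemma wres_wact {b c : index} (p : dle (src b) (src c)) g (w : word c) :
  wres p (wact g w) = wact (Gr p g) (wres p w).
Proof.
  induction w as [| gx w IH]; simpl; [reflexivity |].
  rewrite IH, Gr_mul; reflexivity.
Qed.

Definition weq (b : index) (w w' : word b) : Prop := forall h, ev b h w = ev b h w'.

#[local] Instance weq_equiv (b : index) : Equivalence (weq b).
Proof.
  split.
  - intros w h; reflexivity.
  - intros w w' e h; symmetry; apply e.
  - intros w w' w'' e e' h; rewrite e; apply e'.
Qed.

Lemma weq_app (b : index) (v v' w w' : word b) :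
  weq b v v' -> weq b w w' -> weq b (v ++ w) (v' ++ w').
Proof. intros e e' h; rewrite !ev_app, e, e'; reflexivity. Qed.

Definition wgrp (b : index) : Grp :=
  wordGrp _ (fun gx => (fst gx, ginv (snd gx))) (weq b).

Lemma wgrp_mul (b : index) (w w' : word b) :
  @gmul (wgrp b) (cls (weq b) w) (cls (weq b) w') = cls (weq b) (w ++ w').
Proof. apply wordGrp_mul; [typeclasses eauto | apply weq_app]. Qed.

Lemma wgrp_group (b : index) : IsGroup (wgrp b).
Proof.
  destruct (gXl (tgt b)) as [as_ [l [r [il ir]]]].
  apply wordGrp_group; [typeclasses eauto | apply weq_app | |]; intros [g x] h; simpl;
    rewrite (IsHom_inv (gXl (src b)) (gXl (tgt b)) _ (iact_tgt b _)), r; [apply ir | apply il].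
Qed.

Definition wal (b : index) (g : gcar (Gl (src b))) (q : gcar (wgrp b)) : gcar (wgrp b) :=
  cls (weq b) (wact g (rep q)).

Lemma wal_cls (b : index) g (w : word b) : wal b g (cls (weq b) w) = cls (weq b) (wact g w).
Proof.
  apply cls_eq; [typeclasses eauto |]; intro h.
  rewrite !ev_wact; apply (rep_cls (weq b)).
Qed.

Lemma wal_action (b : index) : IsGAction (Gl (src b)) (wgrp b) (wal b).
Proof.
  destruct (gGl (src b)) as [as_ [l [r _]]].
  repeat split.
  - intros g h q; rewrite <- (cls_rep (weq b) q), !wal_cls.
    apply cls_eq; [typeclasses eauto |]; intro k; rewrite !ev_wact, as_; reflexivity.
  - intro q; rewrite <- (cls_rep (weq b) q), wal_cls.
    apply cls_eq; [typeclasses eauto |]; intro k; rewrite !ev_wact, r; reflexivity.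
  - intros g q q'; rewrite <- (cls_rep (weq b) q), <- (cls_rep (weq b) q'), wgrp_mul, !wal_cls, wgrp_mul.
    unfold wact; rewrite map_app; reflexivity.
Qed.

(** Comparability of the sources alone does not make restriction of words respect equality of
    values, so that condition is part of the order. Targets are not compared. *)
Definition ble (b c : index) : Prop :=
  exists p : dle (src b) (src c), forall w w', weq c w w' -> weq b (wres p w) (wres p w').

Lemma ble_src {b c : index} : ble b c -> dle (src b) (src c).
Proof. intros [p _]; exact p. Qed.

Lemma ble_weq {b c : index} (p : dle (src b) (src c)) (w w' : word c) :
  ble b c -> weq c w w' -> weq b (wres p w) (wres p w').
Proof. intros [q h] e; rewrite (proof_irrelevance _ p q); apply h, e. Qed.

(** A cofinally available reason for [ble]: all values at [b] of a restricted word are determined by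
    its single value at [c] for [h = 1]. This is the formula on which the comparison with [X]
    rests. *)
Definition dom (b c : index) : Prop :=
  exists (p : dle (src b) (src c)) (t : dle (src b) (tgt c)),
    forall w h, ev b h (wres p w) = iact b h (Xr t (ev c gone w)).

Lemma dom_ble (b c : index) : dom b c -> ble b c.
Proof.
  intros [p [t e]]; exists p; intros w w' h y; rewrite !e, h; reflexivity.
Qed.

(** For a one-letter word this is the last clause of [good] for [b], with its [f'] replaced by the
    projection of [f]: both represent the same germ, so they agree at high levels. Multiplicativity
    of [iact b] extends the formula to all words. *)
Lemma dom_level (b : index) {i j : dcar D} (f : lact i j) (t : dle (src b) j) :
  represents f ->
  exists k, dle i k /\ forall l (p : dle i l) (gf : good (ares p f)), dle k l ->
    dom b (Build_index l j (ares p f) gf).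
Proof.
  intro h.
  destruct (iact_good b) as [_ [_ [_ [i' [q [f' [h' e]]]]]]].
  destruct (represents_level _ f' (represents_post t f h) h') as [k [ik [i'k ek]]].
  exists k; split; [exact ik |]; intros l p gf kl.
  assert (i'l : dle i' l) by exact (dle_trans D _ _ _ i'k kl).
  assert (bl : dle (src b) l) by exact (dle_trans D _ _ _ q i'l).
  unfold dom; simpl; exists bl, t; intros w y.
  induction w as [| gx w IH]; simpl.
  - rewrite Xr_one; symmetry.
    apply (IsHom_one (gXl (src b)) (gXl (tgt b)) _ (iact_tgt b y)).
  - rewrite IH, Xr_mul, iact_mul; f_equal.
    rewrite (proj1 (proj2 (gGl l))).
    change (Xr t (ares p f (fst gx) (snd gx)))
      with (ares p (fun g x => Xr t (f g x)) (fst gx) (snd gx)).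
    rewrite (ek l p i'l kl); unfold ares; rewrite <- e.
    rewrite (Gr_comp q i'l bl), (Xr_comp q i'l bl); reflexivity.
Qed.

(** The bound [j0] on the target is used when two arrows of an index category have been merged at
    level [j0] and the merging must persist at [c]. *)
Lemma dom_exists (b b' : index) (j0 : dcar D) :
  exists c, dle j0 (tgt c) /\ dom b c /\ dom b' c.
Proof.
  destruct (d_upper D (src b) (src b')) as [j1 [t1 t1']].
  destruct (d_upper D j0 j1) as [j [t0 s]].
  destruct (represents_exists j) as [i [f h]].
  destruct (good_exists f h) as [k [ik gf]].
  destruct (dom_level b f (dle_trans D _ _ _ t1 s) h) as [k1 [ik1 e1]].
  destruct (dom_level b' f (dle_trans D _ _ _ t1' s) h) as [k2 [ik2 e2]].
  destruct (d_upper D k k1) as [k3 [r r1]].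
  destruct (d_upper D k3 k2) as [l [r3 r2]].
  pose (p := dle_trans D _ _ _ ik2 r2).
  assert (kl : dle k l) by exact (dle_trans D _ _ _ r r3).
  assert (k1l : dle k1 l) by exact (dle_trans D _ _ _ r1 r3).
  exists (Build_index l j (ares p f) (gf l p kl)); split; [exact t0 |]; split.
  - apply e1, k1l.
  - apply e2, r2.
Qed.

Lemma index_exists (j : dcar D) : exists b : index, tgt b = j.
Proof.
  destruct (represents_exists j) as [i [f h]].
  destruct (good_exists f h) as [k [ik gf]].
  exists (Build_index k j (ares ik f) (gf k ik (dle_refl D k))); reflexivity.
Qed.

Definition indexDir : DirSet.
Proof.
  refine {| dcar := index; dle := ble |}.
  - intro b; exists (dle_refl D _); intros w w' e; rewrite !wres_id; exact e.
  - intros b c d [p hp] [q hq]; exists (dle_trans D _ _ _ p q); intros w w' e.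
    rewrite <- !(wres_comp p q); apply hp, hq, e.
  - destruct (d_nonempty D) as [j _], (index_exists j) as [b _]; exists b; exact Logic.I.
  - intros b c; destruct (d_nonempty D) as [j _].
    destruct (dom_exists b c j) as [d [_ [h h']]]; exists d; split; apply dom_ble; assumption.
Defined.

Definition indexFun : FFun (posetCat indexDir) (gidx G) :=
  Build_FFun (posetCat indexDir) (gidx G) (fun b => fob uG (src b))
    (fun b c p => fhom uG (ble_src p : @hom (posetCat D) (src b) (src c))).

Lemma indexFun_functor : IsFunctor indexFun.
Proof.
  split.
  - intro b; eapply eq_trans; [| apply (proj1 FuG)].
    apply (f_equal (@fhom _ _ uG (src b) (src b))), posetCat_hom_eq.
  - intros b c d p q; eapply eq_trans; [| apply (proj2 FuG)].
    apply (f_equal (@fhom _ _ uG (src b) (src d))), posetCat_hom_eq.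
Qed.

Lemma indexFun_cofinal : StrongCofinal indexFun.
Proof.
  split.
  - intro o; destruct (proj1 CuG o) as [j [p _]].
    destruct (index_exists j) as [b e].
    pose proof (tgt_le b) as t; rewrite e in t.
    exists b, (cmp (fhom uG (t : @hom (posetCat D) j (src b))) p); exact Logic.I.
  - intros o b f g; simpl in *.
    destruct (proj2 CuG o (src b) f g) as [j [p e]].
    destruct (dom_exists b b j) as [c [jc [h _]]].
    exists c, (dom_ble _ _ h); simpl.
    pose proof (dle_trans D _ _ _ jc (tgt_le c)) as q.
    assert (eq : fhom uG (ble_src (dom_ble b c h) : @hom (posetCat D) (src b) (src c)) =
      cmp (fhom uG (q : @hom (posetCat D) j (src c))) (fhom uG p)).
    { eapply eq_trans; [| apply (proj2 FuG)].
      apply (f_equal (@fhom _ _ uG (src b) (src c))), posetCat_hom_eq. }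
    change (cmp (fhom uG (ble_src (dom_ble b c h) : @hom (posetCat D) (src b) (src c))) f =
            cmp (fhom uG (ble_src (dom_ble b c h) : @hom (posetCat D) (src b) (src c))) g).
    rewrite eq, <- !cmp_assoc, e; reflexivity.
Qed.

Definition wmap (b c : index) (p : ble b c) (q : gcar (wgrp c)) : gcar (wgrp b) :=
  cls (weq b) (wres (ble_src p) (rep q)).

Lemma wmap_cls {b c : index} (p : ble b c) (r : dle (src b) (src c)) (w : word c) :
  wmap b c p (cls (weq c) w) = cls (weq b) (wres r w).
Proof.
  unfold wmap; rewrite (proof_irrelevance _ (ble_src p) r).
  apply cls_eq; [typeclasses eauto |]; apply (ble_weq r _ _ p), rep_cls; typeclasses eauto.
Qed.

Lemma wmap_id (b : index) (p : ble b b) (q : gcar (wgrp b)) : wmap b b p q = q.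
Proof. rewrite <- (cls_rep (weq b) q), (wmap_cls _ (dle_refl D _)), wres_id; reflexivity. Qed.

Lemma wmap_comp (b c d : index) (p : ble b c) (q : ble c d) (r : ble b d) (x : gcar (wgrp d)) :
  wmap b d r x = wmap b c p (wmap c d q x).
Proof.
  rewrite <- (cls_rep (weq d) x), (wmap_cls q (ble_src q)), (wmap_cls p (ble_src p)).
  rewrite (wmap_cls _ (ble_src r)), (wres_comp _ _ (ble_src r)); reflexivity.
Qed.

Lemma wmap_hom (b c : index) (p : ble b c) : IsHom (wgrp c) (wgrp b) (wmap b c p).
Proof.
  intros x y; rewrite <- (cls_rep (weq c) x), <- (cls_rep (weq c) y), wgrp_mul.
  rewrite !(wmap_cls p (ble_src p)), wgrp_mul; unfold wres; rewrite map_app; reflexivity.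
Qed.

Lemma wsys_ProGrp : IsProGrp (mkPG indexDir wgrp wmap).
Proof.
  split; [split | split].
  - intros b q; apply wmap_id.
  - intros b c d p q x; apply wmap_comp.
  - intro b; apply wgrp_group.
  - intros b c p; apply wmap_hom.
Qed.

Lemma wmap_wal (b c : index) (p : ble b c) g q :
  wmap b c p (wal c g q) = wal b (Gr (ble_src p) g) (wmap b c p q).
Proof.
  rewrite <- (cls_rep (weq c) q), wal_cls, !(wmap_cls p (ble_src p)), wal_cls, wres_wact; reflexivity.
Qed.

(** * The isomorphism between [X] and the pro-group of words *)

Definition wpsi : Mor (uP X) (uP (mkPG indexDir wgrp wmap)) := fun b =>
  existT (fun i : ob (gidx X) => gcar (ggrp X i) -> gcar (wgrp b)) (fob uX (src b))
    (fun x => cls (weq b) ((gone, x) :: nil)).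

Lemma wpsi_GMor : IsGMor wpsi.
Proof.
  split.
  - intros b c p; simpl in *.
    apply geq_sym.
    destruct (geq_res (A := uP X) (proj1 HX) (fob uX (src b)) (fob uX (src c))
      (fhom uX (ble_src p : @hom (posetCat D) (src b) (src c)))
      (fun x => cls (weq b) ((gone, x) :: nil))) as [k [r [s e]]].
    exists k, r, s; intro x; eapply eq_trans; [exact (e x) |]; simpl.
    rewrite (wmap_cls p (ble_src p)); simpl; rewrite Gr_one; reflexivity.
  - intros b x y; simpl.
    eapply eq_trans; [| symmetry; apply wgrp_mul].
    apply cls_eq; [typeclasses eauto |]; intro h; rewrite ev_app, !ev_one; simpl.
    apply iact_mul.
Qed.

Definition wchi_at (o : ob (gidx X)) (b : index) (e : hom o (fob uX (tgt b))) (q : gcar (wgrp b)) :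
  gcar (ggrp X o) := gmap X e (ev b gone (rep q)).

Lemma wchi_ex (o : ob (gidx X)) : exists b, exists e : hom o (fob uX (tgt b)), True.
Proof.
  destruct (proj1 CuX o) as [j [p _]]; destruct (index_exists j) as [b <-].
  exists b, p; exact Logic.I.
Qed.

Definition wchi : Mor (uP (mkPG indexDir wgrp wmap)) (uP X) := fun o =>
  let b := constructive_indefinite_description _ (wchi_ex o) in
  let e := constructive_indefinite_description _ (proj2_sig b) in
  existT (fun b : index => gcar (wgrp b) -> gcar (ggrp X o)) (proj1_sig b)
    (wchi_at o (proj1_sig b) (proj1_sig e)).

Lemma wchi_at_cls o b e (w : word b) :
  wchi_at o b e (cls (weq b) w) = gmap X e (ev b gone w).
Proof. unfold wchi_at; f_equal; apply (rep_cls (weq b)). Qed.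

(** Since [iact b] at the unit is a transition map, the formula of [dom] leaves only the value of
    the [c]-word at 1 and an arrow into the target level of [c]. What remains of [b] is that arrow,
    so two choices of [b] can be compared. *)
Lemma wchi_at_dom o b e c (h : dom b c) (t : dle (tgt b) (tgt c)) (w : word c) :
  wchi_at o b e (wmap b c (dom_ble b c h) (cls (weq c) w)) =
  gmap X (cmp (fhom uX (t : @hom (posetCat D) (tgt b) (tgt c))) e) (ev c gone w).
Proof.
  destruct h as [p [s d]].
  rewrite (wmap_cls _ p), wchi_at_cls, d, (iact_one b (tgt_le b)), (Xr_comp _ _ t).
  symmetry; apply (proj2 (proj1 HX)).
Qed.

Lemma wchi_at_geq o b b' (e : hom o (fob uX (tgt b))) (e' : hom o (fob uX (tgt b'))) :
  @geq (uP (mkPG indexDir wgrp wmap)) (gcar (ggrp X o))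
    (existT (fun b : index => gcar (wgrp b) -> gcar (ggrp X o)) b (wchi_at o b e))
    (existT (fun b : index => gcar (wgrp b) -> gcar (ggrp X o)) b' (wchi_at o b' e')).
Proof.
  destruct (d_upper D (tgt b) (tgt b')) as [j [t t']].
  (* The arrows out of [o] through [b] and [b'] may differ at level [j]. They are merged at [j'],
     and [c] is then taken with target above [j']. *)
  destruct (proj2 CuX o j (cmp (fhom uX (t : @hom (posetCat D) (tgt b) j)) e)
    (cmp (fhom uX (t' : @hom (posetCat D) (tgt b') j)) e')) as [j' [r er]].
  destruct (dom_exists b b' j') as [c [jc [h h']]].
  pose (s := cmp (jc : @hom (posetCat D) j' (tgt c)) r).
  exists c, (dom_ble _ _ h), (dom_ble _ _ h'); intro q; simpl.
  pose (bt := cmp s (t : @hom (posetCat D) (tgt b) j)).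
  pose (bt' := cmp s (t' : @hom (posetCat D) (tgt b') j)).
  rewrite <- (cls_rep (weq c) q), (wchi_at_dom _ _ _ _ _ bt), (wchi_at_dom _ _ _ _ _ bt').
  f_equal; unfold bt, bt', s; rewrite !(proj2 FuX), <- !cmp_assoc, er; reflexivity.
Qed.

Lemma wchi_spec (o : ob (gidx X)) : exists b (e : hom o (fob uX (tgt b))),
  wchi o = existT (fun b : index => gcar (wgrp b) -> gcar (ggrp X o)) b (wchi_at o b e).
Proof.
  unfold wchi; eexists; eexists; reflexivity.
Qed.

Lemma wchi_mor : IsMor wchi.
Proof.
  intros o o' f.
  destruct (wchi_spec o) as [b [e ->]], (wchi_spec o') as [b' [e' ->]].
  destruct (wchi_at_geq o b' b (cmp e' f) e) as [c [p [q h]]].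
  exists c, p, q; intro x; eapply eq_trans; [| exact (h x)]; simpl.
  symmetry; apply (proj2 (proj1 HX)).
Qed.

Lemma wchi_wpsi : meq (mcomp wchi wpsi) (mid (uP X)).
Proof.
  intro o; change (geq (gpre (wchi o) wpsi) (mid (uP X) o)).
  destruct (wchi_spec o) as [b [e ->]]; apply geq_sym.
  destruct (geq_res (A := uP X) (proj1 HX) o (fob uX (src b))
    (cmp (fhom uX (tgt_le b : @hom (posetCat D) (tgt b) (src b))) e) (fun x => x))
    as [k [r [s h]]].
  exists k, r, s; intro x; eapply eq_trans; [exact (h x) |]; simpl.
  rewrite wchi_at_cls, ev_one; simpl.
  rewrite (proj1 (proj2 (gGl (src b)))), (iact_one b (tgt_le b)).
  apply (proj2 (proj1 HX)).
Qed.

(** For [c] dominating [b], a [c]-word restricted to [b] has the same values as the one-letter word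
    [(1, x)], where [x] is the projected value of the [c]-word at 1; this is the formula of [dom]
    read as an equality of words. *)
Lemma wpsi_wchi : meq (mcomp wpsi wchi) (mid (uP (mkPG indexDir wgrp wmap))).
Proof.
  intro b; change (geq (gpost (projT2 (wpsi b)) (wchi (fob uX (src b))))
    (mid (uP (mkPG indexDir wgrp wmap)) b)).
  destruct (wchi_spec (fob uX (src b))) as [b' [e ->]].
  destruct (d_upper D (src b) (tgt b')) as [j [t t']].
  destruct (proj2 CuX _ j (cmp (fhom uX (t' : @hom (posetCat D) (tgt b') j)) e)
    (fhom uX (t : @hom (posetCat D) (src b) j))) as [j' [r er]].
  destruct (dom_exists b b' j') as [c [jc [h h']]].
  pose (s := cmp (jc : @hom (posetCat D) j' (tgt c)) r).
  pose (bt' := cmp s (t' : @hom (posetCat D) (tgt b') j)).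
  assert (eb : forall v : dle (src b) (tgt c),
    cmp (fhom uX bt') e = fhom uX (v : @hom (posetCat D) (src b) (tgt c))).
  { intro v; rewrite (posetCat_hom_eq _ _ v (cmp s (t : @hom (posetCat D) (src b) j))).
    unfold bt', s; rewrite !(proj2 FuX), <- !cmp_assoc, er; reflexivity. }
  exists c, (dom_ble _ _ h'), (dom_ble _ _ h); intro q; simpl.
  rewrite <- (cls_rep (weq c) q), (wchi_at_dom _ _ _ _ _ bt').
  destruct h as [p [v d]]; rewrite (wmap_cls _ p).
  apply cls_eq; [typeclasses eauto |]; intro y; rewrite d, ev_one; simpl.
  rewrite (proj1 (proj2 (proj2 (gGl (src b))))); f_equal.
  exact (f_equal (fun m => gmap X m (ev c gone (rep q))) (eb v)).
Qed.

(** By the last clause of [good], the words [(g, x)] and [(1, f' g x)] have the same values once the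
    letter on the left is restricted from level [i']; and [f'] represents [a] at the source of
    [b]. *)
Lemma wpsi_equivariant (b : index) :
  geq (gpost (fun x => cls (weq b) ((gone, x) :: nil)) (a (fob uX (src b))))
    (existT (fun c : ob (pidx GX) => pobj GX c -> gcar (wgrp b)) (fob uG (src b), fob uX (src b))
       (fun gx => wal b (fst gx) (cls (weq b) ((gone, snd gx) :: nil)))).
Proof.
  destruct (iact_good b) as [_ [_ [_ [i' [p [f' [h e]]]]]]].
  apply (geq_trans HGX _ (gpost (fun x => cls (weq b) ((gone, x) :: nil)) (agerm f'))).
  { apply geq_gpost, geq_sym, h. }
  assert (ew : forall g x, wal b (Gr p g) (cls (weq b) ((gone, Xr p x) :: nil)) =
    cls (weq b) ((gone, f' g x) :: nil)).
  { intros g x; rewrite wal_cls; apply cls_eq; [typeclasses eauto |]; intro y.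
    rewrite ev_wact, !ev_one; simpl fst; simpl snd.
    rewrite !(proj1 (proj2 (proj2 (gGl (src b))))); apply e. }
  apply geq_sym.
  destruct (geq_res HGX (fob uG (src b), fob uX (src b)) (fob uG i', fob uX i')
    (fhom uG (p : @hom (posetCat D) (src b) i'), fhom uX (p : @hom (posetCat D) (src b) i'))
    (fun gx => wal b (fst gx) (cls (weq b) ((gone, snd gx) :: nil)))) as [k [r [s d]]].
  exists k, r, s; intro x; eapply eq_trans; [exact (d x) |]; apply ew.
Qed.

End Levelwise.

(** * Group objects *)

Lemma pair_eta_comp {Z A B : Sys} (f : Hom Z (pS A B)) : << pi1 \; f, pi2 \; f >> = f.
Proof. rewrite <- pair_comp, pair_eta, comp_idl; reflexivity. Qed.

Ltac homs := repeat first
  [ rewrite <- comp_assoc | rewrite pair_comp | rewrite pi1_pair | rewrite pi2_pair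
  | rewrite comp_idl | rewrite comp_idr | rewrite bang_comp
  | rewrite pair_eta_comp | rewrite pair_eta ].

Record HStr (A : Sys) := { hm : Hom (pS A A) A; he : Hom oneS A; hi : Hom A A }.
Arguments hm {_} _.
Arguments he {_} _.
Arguments hi {_} _.

(** Generalised elements: a group object is handled through the groups [Hom T A], natural in [T], so
    that diagram chases become computations with elements. *)
Definition hgrp {A : Sys} (s : HStr A) (T : Sys) : Grp :=
  {| gcar := Hom T A; gmul := fun x y => hm s \; << x, y >>;
     gone := he s \; bang T; ginv := fun x => hi s \; x |}.

Definition IsHG {A : Sys} (s : HStr A) : Prop := forall T, IsGroup (hgrp s T).

Lemma hgrp_mul_comp {A T T' : Sys} (s : HStr A) (x y : gcar (hgrp s T)) (f : Hom T' T) :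
  @gmul (hgrp s T) x y \; f = @gmul (hgrp s T') (x \; f) (y \; f).
Proof. simpl; homs; reflexivity. Qed.

Lemma hgrp_one_comp {A T T' : Sys} (s : HStr A) (f : Hom T' T) :
  @gone (hgrp s T) \; f = @gone (hgrp s T').
Proof. simpl; homs; reflexivity. Qed.

Lemma hgrp_inv_comp {A T T' : Sys} (s : HStr A) (x : gcar (hgrp s T)) (f : Hom T' T) :
  @ginv (hgrp s T) x \; f = @ginv (hgrp s T') (x \; f).
Proof. simpl; homs; reflexivity. Qed.

Definition IsHGM {A B : Sys} (s : HStr A) (t : HStr B) (f : Hom A B) : Prop :=
  forall T, IsHom (hgrp s T) (hgrp t T) (fun x => f \; x).

Record GO := {
  go :> GObj;
  go_sys : IsSys (gos go);
  go_m : IsMor (gom go);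
  go_e : IsMor (goe go);
  go_i : IsMor (goi go)
}.

Canonical sG (Y : GO) : Sys := mkSys (gos Y) (go_sys Y).
Definition hgs (Y : GO) : HStr (sG Y) :=
  {| hm := @homc (pS (sG Y) (sG Y)) (sG Y) (gom Y) (go_m Y);
     he := @homc oneS (sG Y) (goe Y) (go_e Y);
     hi := @homc (sG Y) (sG Y) (goi Y) (go_i Y) |}.

Section GroupObjectLaws.
Variable Y : GO.
Let A := sG Y.
Let m := hm (hgs Y).
Let e := he (hgs Y).
Let i := hi (hgs Y).

Let rm : @reps (pS A A) A (gom Y) m := reps_homc _ _.
Let re : @reps oneS A (goe Y) e := reps_homc _ _.
Let ri : @reps A A (goi Y) i := reps_homc _ _.

Lemma reps_assoc_l : @reps (pS (pS A A) A) A (mcomp (gom Y) (mprod (gom Y) (mid A)))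
  (m \; << m \; pi1, pi2 >>).
Proof. rewrite <- (comp_idl pi2); exact (reps_comp rm (reps_prod rm (reps_id A))). Qed.

Lemma reps_assoc_r : @reps (pS (pS A A) A) A
  (mcomp (gom Y) (mcomp (mprod (mid A) (gom Y)) (massoc A A A)))
  (m \; << pi1 \; pi1, m \; << pi2 \; pi1, pi2 >> >>).
Proof.
  pose proof (reps_comp rm (reps_comp (reps_prod (reps_id A) rm) (reps_assoc A A A))) as h.
  rewrite comp_idl, pair_comp, pi1_pair, <- (comp_assoc m pi2), pi2_pair in h; exact h.
Qed.

Lemma reps_unit_l :
  @reps A A (mcomp (gom Y) (mcomp (mprod (goe Y) (mid A)) (mlunit A))) (m \; << e \; bang A, idh A >>).
Proof.
  pose proof (reps_comp rm (reps_comp (reps_prod re (reps_id A)) (reps_lunit A))) as h.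
  rewrite comp_idl, pair_comp, <- (comp_assoc e), pi1_pair, pi2_pair in h; exact h.
Qed.

Lemma reps_unit_r :
  @reps A A (mcomp (gom Y) (mcomp (mprod (mid A) (goe Y)) (mrunit A))) (m \; << idh A, e \; bang A >>).
Proof.
  pose proof (reps_comp rm (reps_comp (reps_prod (reps_id A) re) (reps_runit A))) as h.
  rewrite comp_idl, pair_comp, <- (comp_assoc e), pi1_pair, pi2_pair in h; exact h.
Qed.

Lemma reps_inv_l : @reps A A (mcomp (gom Y) (mpair (goi Y) (mid A))) (m \; << i, idh A >>).
Proof. exact (reps_comp rm (reps_pair ri (reps_id A))). Qed.

Lemma reps_inv_r : @reps A A (mcomp (gom Y) (mpair (mid A) (goi Y))) (m \; << idh A, i >>).
Proof. exact (reps_comp rm (reps_pair (reps_id A) ri)). Qed.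

Lemma reps_unit_bang : @reps A A (mcomp (goe Y) (mbang A)) (e \; bang A).
Proof. exact (reps_comp re (reps_bang A)). Qed.

Lemma IsGObj_IsHG : IsGObj Y -> IsHG (hgs Y).
Proof.
  intros [_ [_ [_ [_ [h1 [h2 [h3 [h4 h5]]]]]]]] T.
  apply (reps_eq reps_assoc_l reps_assoc_r) in h1.
  apply (reps_eq reps_unit_l (reps_id A)) in h2.
  apply (reps_eq reps_unit_r (reps_id A)) in h3.
  apply (reps_eq reps_inv_l reps_unit_bang) in h4.
  apply (reps_eq reps_inv_r reps_unit_bang) in h5.
  repeat split; simpl; fold m e i.
  - intros x y z; apply (f_equal (fun f => f \; << << x, y >>, z >>)) in h1.
    revert h1; homs; intro h1; symmetry; exact h1.
  - intro x; apply (f_equal (fun f => f \; x)) in h2; revert h2; homs; exact (fun h => h).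
  - intro x; apply (f_equal (fun f => f \; x)) in h3; revert h3; homs; exact (fun h => h).
  - intro x; apply (f_equal (fun f => f \; x)) in h4; revert h4; homs; exact (fun h => h).
  - intro x; apply (f_equal (fun f => f \; x)) in h5; revert h5; homs; exact (fun h => h).
Qed.

(** Each diagrammatic law is the pointwise law at a universal element: the three projections of the
    triple product for associativity, the identity for the others. *)
Lemma IsHG_IsGObj : IsHG (hgs Y) -> IsGObj Y.
Proof.
  intro H; split; [apply go_sys |].
  split; [apply go_m |]; split; [apply go_e |]; split; [apply go_i |].
  split; [| split; [| split; [| split]]].
  - apply (reps_meq reps_assoc_l reps_assoc_r).
    pose proof (proj1 (H (pS (pS A A) A)) (pi1 \; pi1) (pi2 \; pi1) pi2) as h.
    simpl in h; fold m in h; rewrite pair_eta_comp in h; symmetry; exact h.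
  - apply (reps_meq reps_unit_l (reps_id A)).
    exact (proj1 (proj2 (H A)) (idh A)).
  - apply (reps_meq reps_unit_r (reps_id A)).
    exact (proj1 (proj2 (proj2 (H A))) (idh A)).
  - apply (reps_meq reps_inv_l reps_unit_bang).
    rewrite <- (comp_idr i); exact (proj1 (proj2 (proj2 (proj2 (H A)))) (idh A)).
  - apply (reps_meq reps_inv_r reps_unit_bang).
    rewrite <- (comp_idr i); exact (proj2 (proj2 (proj2 (proj2 (H A)))) (idh A)).
Qed.

End GroupObjectLaws.

Lemma IsHGM_iff {A B : Sys} (s : HStr A) (t : HStr B) (f : Hom A B) :
  IsHGM s t f <-> f \; hm s = hm t \; << f \; pi1, f \; pi2 >>.
Proof.
  split.
  - intro h; specialize (h _ pi1 pi2); simpl in h; rewrite pair_eta, comp_idr in h; exact h.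
  - intros h T x y; simpl; rewrite comp_assoc, h; homs; reflexivity.
Qed.

(** The multiplications enter only through [reps], so the equivalence also applies to [sdGO], whose
    multiplication is represented by [sdHG] without being bundled as a [GO]. *)
Lemma IsGOMor_iff {Y Y' : GObj} {SY : IsSys (gos Y)} {SY' : IsSys (gos Y')}
    {s : HStr (mkSys _ SY)} {t : HStr (mkSys _ SY')}
    {F : Mor (gos Y) (gos Y')} {f : Hom (mkSys _ SY) (mkSys _ SY')} :
  @reps (pS (mkSys _ SY) (mkSys _ SY)) (mkSys _ SY) (gom Y) (hm s) ->
  @reps (pS (mkSys _ SY') (mkSys _ SY')) (mkSys _ SY') (gom Y') (hm t) ->
  @reps (mkSys _ SY) (mkSys _ SY') F f ->
  (@IsGOMor Y Y' F <-> IsHGM s t f).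
Proof.
  intros rm rm' rf; rewrite IsHGM_iff; split.
  - intros [_ h]; exact (reps_eq (reps_comp rf rm) (reps_comp rm' (reps_prod rf rf)) h).
  - intro h; split; [exact (reps_IsMor rf) |].
    exact (reps_meq (reps_comp rf rm) (reps_comp rm' (reps_prod rf rf)) h).
Qed.

Lemma IsGOMor_IsHGM {Y Y' : GO} {F : Mor (gos Y) (gos Y')} {f : Hom (sG Y) (sG Y')} :
  reps F f -> (@IsGOMor Y Y' F <-> IsHGM (hgs Y) (hgs Y') f).
Proof.
  intro r; exact (IsGOMor_iff (s := hgs Y) (t := hgs Y') (reps_homc _ _) (reps_homc _ _) r).
Qed.

Lemma reps_zero (Y Y' : GO) : @reps (sG Y) (sG Y') (zeroGO Y Y') (@gone (hgrp (hgs Y') (sG Y))).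
Proof. exact (reps_comp (reps_homc _ (go_e Y')) (reps_bang (sG Y))). Qed.

Definition pgGO (P : ProGrp) (HP : IsProGrp P) : GO :=
  Build_GO (FG P) (proj1 HP) (IsMor_lmul P HP) (IsMor_lone P HP) (IsMor_linv P HP).

Lemma IsGObj_FG (P : ProGrp) : IsProGrp P -> IsGObj (FG P).
Proof.
  intros HP.
  split; [apply HP |].
  split; [apply IsMor_lmul, HP |]; split; [apply IsMor_lone, HP |]; split; [apply IsMor_linv, HP |].
  pose proof (fun i => proj1 (proj2 HP) i) as hg.
  split; [| split; [| split; [| split]]]; intro j; destruct (hg j) as [as_ [l [r [il ir]]]].
  - apply (@geq_ext (prodP (prodP (uP P) (uP P)) (uP P)) _ ((j, j), j)).
    intros [[x y] z]; symmetry; apply as_.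
  - apply (@geq_ext (uP P) _ j); intro x; apply l.
  - apply (@geq_ext (uP P) _ j); intro x; apply r.
  - change (geq (mcomp (lmul P) (mpair (linv P) (mid (uP P))) j) (mcomp (lone P) (mbang (uP P)) j)).
    rewrite lmul_mpair.
    apply (geq_trans (proj1 HP) _ (gpost (fun xy => gmul (fst xy) (snd xy))
      (existT (fun i : ob (pidx (uP P)) => pobj (uP P) i -> (pobj (uP P) j * pobj (uP P) j)%type)
         j (fun x => (ginv x, x))))).
    + apply geq_gpost, (geq_gpair (proj1 HP)); apply (@geq_ext (uP P) _ j); reflexivity.
    + destruct (f_cone _ j (pick_ob (gidx P))) as [k [p [q _]]].
      exists k, p, q; intro x; apply il.
  - change (geq (mcomp (lmul P) (mpair (mid (uP P)) (linv P)) j) (mcomp (lone P) (mbang (uP P)) j)).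
    rewrite lmul_mpair.
    apply (geq_trans (proj1 HP) _ (gpost (fun xy => gmul (fst xy) (snd xy))
      (existT (fun i : ob (pidx (uP P)) => pobj (uP P) i -> (pobj (uP P) j * pobj (uP P) j)%type)
         j (fun x => (x, ginv x))))).
    + apply geq_gpost, (geq_gpair (proj1 HP)); apply (@geq_ext (uP P) _ j); reflexivity.
    + destruct (f_cone _ j (pick_ob (gidx P))) as [k [p [q _]]].
      exists k, p, q; intro x; apply ir.
Qed.

Lemma IsHG_pgGO (P : ProGrp) (HP : IsProGrp P) : IsHG (hgs (pgGO P HP)).
Proof. apply IsGObj_IsHG, IsGObj_FG, HP. Qed.

Lemma IsGMor_IsGOMor {P Q : ProGrp} (F : Mor (uP P) (uP Q)) :
  IsGMor F -> @IsGOMor (FG P) (FG Q) F.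
Proof.
  intros [h1 h2]; split; [exact h1 |]; intro j.
  apply (@geq_ext (prodP (uP P) (uP P)) _ (projT1 (F j), projT1 (F j))).
  intros [x y]; apply h2.
Qed.

(* The functor [FG] is full: a germ which is multiplicative up to refinement
   becomes a homomorphism after finitely many transition maps. *)
Lemma IsGOMor_full {P Q : ProGrp} (HP : IsProGrp P) (F : Mor (uP P) (uP Q)) :
  @IsGOMor (FG P) (FG Q) F -> exists F' : Mor (uP P) (uP Q), IsGMor F' /\ meq F F'.
Proof.
  intros [HF h].
  assert (H : forall j, exists k (r : hom (projT1 (F j)) k),
    IsHom (ggrp P k) (ggrp Q j) (fun x => projT2 (F j) (gmap P r x))).
  { intro j; destruct (h j) as [[k1 k2] [[p1 p2] [[q1 q2] e]]]; simpl in *.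
    (* The germ identity involves two levels [k1], [k2] and four arrows into them. One cone and
       three coequalisers make the four composites a single arrow, along which the germ is
       multiplicative. *)
    destruct (f_cone _ k1 k2) as [k [s1 [s2 _]]].
    destruct (f_coeq _ _ _ (cmp s1 p1) (cmp s2 p2)) as [l1 [t1 e1]].
    destruct (f_coeq _ _ _ (cmp t1 (cmp s1 p1)) (cmp t1 (cmp s1 q1))) as [l2 [t2 e2]].
    destruct (f_coeq _ _ _ (cmp t2 (cmp t1 (cmp s1 p1))) (cmp t2 (cmp t1 (cmp s2 q2)))) as [l3 [t3 e3]].
    exists l3, (cmp t3 (cmp t2 (cmp t1 (cmp s1 p1)))); intros x y.
    pose (z := cmp t3 (cmp t2 t1)).
    specialize (e (gmap P (cmp z s1) x, gmap P (cmp z s2) y)); simpl in e.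
    rewrite (proj2 (proj2 HP)).
    pose proof (proj2 (proj1 HP)) as fc; simpl in fc; rewrite <- !fc in e.
    assert (E1 : cmp t3 (cmp t2 (cmp t1 (cmp s1 p1))) = cmp (cmp z s1) p1)
      by (unfold z; rewrite !cmp_assoc; reflexivity).
    assert (E2 : cmp t3 (cmp t2 (cmp t1 (cmp s1 p1))) = cmp (cmp z s2) p2)
      by (rewrite e1; unfold z; rewrite !cmp_assoc; reflexivity).
    assert (E3 : cmp t3 (cmp t2 (cmp t1 (cmp s1 p1))) = cmp (cmp z s1) q1)
      by (rewrite e2; unfold z; rewrite !cmp_assoc; reflexivity).
    assert (E4 : cmp t3 (cmp t2 (cmp t1 (cmp s1 p1))) = cmp (cmp z s2) q2)
      by (rewrite e3; unfold z; rewrite !cmp_assoc; reflexivity).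
    rewrite <- E1, <- E2, <- E3, <- E4 in e; exact e. }
  pose (K := fun j => constructive_indefinite_description _ (H j)).
  pose (R := fun j => constructive_indefinite_description _ (proj2_sig (K j))).
  pose (F' := (fun j => existT (fun k : ob (gidx P) => gcar (ggrp P k) -> gcar (ggrp Q j))
    (proj1_sig (K j)) (fun x => projT2 (F j) (gmap P (proj1_sig (R j)) x))) : Mor (uP P) (uP Q)).
  assert (e : meq F F').
  { intro j; apply (geq_res (A := uP P) (proj1 HP) (projT1 (F j)) _ (proj1_sig (R j))). }
  exists F'; split; [split | exact e].
  - apply (IsMor_meq (proj1 HP) _ _ e HF).
  - intro j; exact (proj2_sig (R j)).
Qed.

Lemma IsHGM_inv {A B : Sys} (s : HStr A) (t : HStr B) (f : Hom A B) (g : Hom B A) :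
  IsHGM s t f -> g \; f = idh A -> f \; g = idh B -> IsHGM t s g.
Proof.
  intros h e1 e2 T x y.
  rewrite <- (comp_idl x), <- (comp_idl y), <- e2, <- !comp_assoc.
  rewrite <- (h T (g \; x) (g \; y)), !comp_assoc, e1.
  rewrite <- !(comp_assoc _ _ x), <- !(comp_assoc _ _ y), ?comp_idl; reflexivity.
Qed.

(** An inverse in pro-sets suffices: it is multiplicative, being inverse to a morphism of group
    objects, and fullness replaces it by a family of homomorphisms. *)
Lemma IsGIso_intro {P Q : ProGrp} (HP : IsProGrp P) (HQ : IsProGrp Q)
    (F : Mor (uP P) (uP Q)) (K : Mor (uP Q) (uP P)) :
  IsGMor F -> IsMor K -> meq (mcomp K F) (mid _) -> meq (mcomp F K) (mid _) -> IsGIso F.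
Proof.
  intros HF HK e1 e2; split; [exact HF |].
  set (SP := mkSys _ (proj1 HP)); set (SQ := mkSys _ (proj1 HQ)).
  pose proof (@reps_homc SP SQ F (proj1 HF)) as rF.
  pose proof (@reps_homc SQ SP K HK) as rK.
  pose proof (reps_eq (reps_comp rK rF) (reps_id SP) e1) as h1.
  pose proof (reps_eq (reps_comp rF rK) (reps_id SQ) e2) as h2.
  assert (hK : @IsGOMor (FG Q) (FG P) K).
  { apply (@IsGOMor_IsHGM (pgGO Q HQ) (pgGO P HP) K _ rK).
    apply (IsHGM_inv (hgs (pgGO P HP)) (hgs (pgGO Q HQ)) _ _
      (proj1 (@IsGOMor_IsHGM (pgGO P HP) (pgGO Q HQ) F _ rF) (IsGMor_IsGOMor F HF)) h1 h2). }
  destruct (IsGOMor_full HQ K hK) as [K' [gK' eK]].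
  exists K'; split; [exact gK' |].
  pose proof (meq_reps (A := SQ) (B := SP) eK rK) as rK'.
  split.
  - exact (reps_meq (reps_comp rK' rF) (reps_id SP) h1).
  - exact (reps_meq (reps_comp rF rK') (reps_id SQ) h2).
Qed.

(** * Formal limits of semidirect products *)

Lemma sdGrp_group (K H : Grp) (al : gcar H -> gcar K -> gcar K) :
  IsGroup K -> IsGroup H -> IsGAction H K al -> IsGroup (sdGrp K H al).
Proof.
  intros gK gH [a1 [a2 a3]].
  assert (a0 : forall h, al h gone = gone).
  { intro h; exact (IsHom_one gK gK (al h) (a3 h)). }
  destruct gK as [k1 [k2 [k3 [k4 k5]]]], gH as [h1 [h2 [h3 [h4 h5]]]].
  repeat split; simpl.
  - intros [x g] [y h] [z k]; simpl; rewrite a3, a1, k1, h1; reflexivity.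
  - intros [x g]; simpl; rewrite a2, k2, h2; reflexivity.
  - intros [x g]; simpl; rewrite a0, k3, h3; reflexivity.
  - intros [x g]; simpl; rewrite <- a3, k4, a0, h4; reflexivity.
  - intros [x g]; simpl; rewrite <- a1, h5, a2, k5; reflexivity.
Qed.

Section SemidirectLimit.

Variables (G : ProGrp) (D : DirSet) (u : FFun (posetCat D) (gidx G))
  (Xg : dcar D -> Grp) (Xm : forall j j', dle j j' -> gcar (Xg j') -> gcar (Xg j))
  (al : forall j, gcar (ggrp G (fob u j)) -> gcar (Xg j) -> gcar (Xg j)).
Hypotheses (HG : IsProGrp G) (Fu : IsFunctor u) (HX' : IsProGrp (mkPG D Xg Xm))
  (Hact : forall j, IsGAction (ggrp G (fob u j)) (Xg j) (al j))
  (Hcomp : forall j j' (p : dle j j') (g : gcar (ggrp G (fob u j'))) (x : gcar (Xg j')),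
     Xm j j' p (al j' g x) = al j (gmap G (fhom u (p : @hom (posetCat D) j j')) g) (Xm j j' p x)).

Let L := sdLim G D u Xg Xm al.
Let X' := mkPG D Xg Xm.
Let G' := reindex G u.
Let HG' : IsProGrp G' := IsProGrp_reindex G _ u HG Fu.

Lemma IsProGrp_sdLim : IsProGrp L.
Proof.
  destruct HX' as [[x1 x2] [x3 x4]], HG' as [[g1 g2] [g3 g4]]; simpl in *.
  split; [split | split].
  - intros j [x g]; simpl; f_equal; [apply x1 | apply g1].
  - intros i j k p q [x g]; simpl; f_equal; [apply x2 | apply (g2 i j k p q)].
  - intro j; apply sdGrp_group; [apply x3 | apply g3 | apply Hact].
  - intros j j' p [x g] [y h]; simpl; f_equal.
    + eapply eq_trans; [apply x4 |]; f_equal; apply Hcomp.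
    + apply (g4 j j' p).
Qed.

(** In general not multiplicative. Together with [sdLim_p] it is jointly monic on pro-sets, which is
    how morphisms into the limit are compared. *)
Definition sdLim_x : Mor (uP L) (uP X') := fun j =>
  existT (fun k : ob (posetCat D) => gcar (Xg k) * gcar (ggrp G (fob u k)) -> gcar (Xg j)) j fst.

Definition sdLim_act : Mor (prodP (uP G') (uP X')) (uP X') := fun j =>
  existT (fun k : ob (pidx (prodP (uP G') (uP X'))) => pobj (prodP (uP G') (uP X')) k -> gcar (Xg j))
    (j, j) (fun gx => al j (fst gx) (snd gx)).

Let sL : Sys := mkSys (uP L) (proj1 IsProGrp_sdLim).
Let sX' : Sys := mkSys (uP X') (proj1 HX').
Let sG' : Sys := mkSys (uP G') (proj1 HG').

Lemma sdLim_x_mor : IsMor sdLim_x.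
Proof.
  intros j j' p; apply geq_sym.
  apply (geq_res (A := uP L) (proj1 IsProGrp_sdLim) j j' p fst).
Qed.

Lemma sdLim_p_mor : IsMor (sdLim_p G D u Xg Xm al).
Proof.
  intros j j' p; apply geq_sym.
  apply (geq_res (A := uP L) (proj1 IsProGrp_sdLim) j j' p snd).
Qed.

Lemma sdLim_act_mor : IsMor sdLim_act.
Proof.
  intros j j' p; apply geq_sym.
  destruct (geq_res (sysP (pS sG' sX')) (j, j) (j', j') (p, p)
    (fun gx => al j (fst gx) (snd gx))) as [k [r [s e]]].
  exists k, r, s; intro x; eapply eq_trans; [exact (e x) |].
  symmetry; apply Hcomp.
Qed.

Definition hx : Hom sL sX' := @homc sL sX' sdLim_x sdLim_x_mor.
Definition hp : Hom sL sG' := @homc sL sG' (sdLim_p G D u Xg Xm al) sdLim_p_mor.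
Definition hact : Hom (pS sG' sX') sX' := @homc (pS sG' sX') sX' sdLim_act sdLim_act_mor.

Lemma sdLim_mor (Z : Sys) (F : Mor Z sL) :
  IsMor (mcomp sdLim_x F) -> IsMor (mcomp (sdLim_p G D u Xg Xm al) F) -> IsMor F.
Proof.
  intros h1 h2 j j' p; apply (geq_pair (sysP Z)); [apply (h1 j j' p) | apply (h2 j j' p)].
Qed.

Lemma sdLim_ext (Z : Sys) (f f' : Hom Z sL) : hx \; f = hx \; f' -> hp \; f = hp \; f' -> f = f'.
Proof.
  intros e1 e2; apply (reps_eq (reps_raw f) (reps_raw f')); intro j.
  apply (geq_pair (sysP Z)).
  - exact (reps_meq (reps_comp (@reps_homc sL sX' _ sdLim_x_mor) (reps_raw f))
                    (reps_comp (@reps_homc sL sX' _ sdLim_x_mor) (reps_raw f')) e1 j).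
  - exact (reps_meq (reps_comp (@reps_homc sL sG' _ sdLim_p_mor) (reps_raw f))
                    (reps_comp (@reps_homc sL sG' _ sdLim_p_mor) (reps_raw f')) e2 j).
Qed.

Let gL : GO := pgGO L IsProGrp_sdLim.
Let gX' : GO := pgGO X' HX'.
Let gG' : GO := pgGO G' HG'.

Let LL := pS sL sL.

Lemma hx_mul_geq (j : dcar D) :
  geq (mcomp (lmul X') (mpair (mcomp sdLim_x (mfst (uP L) (uP L)))
         (mcomp sdLim_act (mpair (mcomp (sdLim_p G D u Xg Xm al) (mfst (uP L) (uP L)))
                                 (mcomp sdLim_x (msnd (uP L) (uP L)))))) j)
      (mcomp sdLim_x (lmul L) j).
Proof.
  rewrite lmul_mpair.
  apply (geq_gpost (fun xy => gmul (fst xy) (snd xy)) _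
    (existT (fun c : ob (pidx LL) => pobj LL c -> (gcar (Xg j) * gcar (Xg j))%type) (j, j)
      (fun z => (fst (fst z), al j (snd (fst z)) (fst (snd z)))))).
  apply (geq_gpair (sysP LL)).
  - apply (geq_gpost fst _ _ (mfst_at (uP L) (uP L) j j)).
  - change (mcomp sdLim_act (mpair (mcomp (sdLim_p G D u Xg Xm al) (mfst (uP L) (uP L)))
                                 (mcomp sdLim_x (msnd (uP L) (uP L)))) j)
      with (gpost (fun gx => al j (fst gx) (snd gx))
         (gpair (mcomp (sdLim_p G D u Xg Xm al) (mfst (uP L) (uP L)) j)
                (mcomp sdLim_x (msnd (uP L) (uP L)) j))).
    apply (geq_gpost (fun gx => al j (fst gx) (snd gx)) _
      (existT (fun c : ob (pidx LL) => pobj LL c -> (gcar (ggrp G (fob u j)) * gcar (Xg j))%type) (j, j)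
      (fun z => (snd (fst z), fst (snd z))))).
    apply (geq_gpair (sysP LL)).
    + apply (geq_gpost snd _ _ (mfst_at (uP L) (uP L) j j)).
    + apply (geq_gpost fst _ _ (msnd_at (uP L) (uP L) j j)).
Qed.

Lemma hx_mul {T : Sys} (x y : Hom T sL) :
  hx \; @gmul (hgrp (hgs gL) T) x y =
  @gmul (hgrp (hgs gX') T) (hx \; x) (hact \; << hp \; x, hx \; y >>).
Proof.
  assert (E : hx \; hm (hgs gL) =
    hm (hgs gX') \; << hx \; pi1, hact \; << hp \; pi1, hx \; pi2 >> >>).
  { symmetry.
    pose proof (@reps_homc sL sX' sdLim_x sdLim_x_mor) as r1.
    pose proof (@reps_homc sL sG' _ sdLim_p_mor) as r2.
    pose proof (@reps_homc (pS sG' sX') sX' _ sdLim_act_mor) as r3.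
    apply (reps_eq
      (reps_comp (@reps_homc (pS sX' sX') sX' (lmul X') (IsMor_lmul X' HX'))
        (reps_pair (reps_comp r1 (reps_fst sL sL))
          (reps_comp r3 (reps_pair (reps_comp r2 (reps_fst sL sL)) (reps_comp r1 (reps_snd sL sL))))))
      (reps_comp r1 (@reps_homc (pS sL sL) sL (lmul L) (IsMor_lmul L IsProGrp_sdLim)))).
    intro j; apply hx_mul_geq. }
  cbn [gmul hgrp]; rewrite comp_assoc, E; homs; reflexivity.
Qed.

Lemma hp_hom : IsHGM (hgs gL) (hgs gG') hp.
Proof.
  apply (@IsGOMor_IsHGM gL gG' (sdLim_p G D u Xg Xm al) hp (reps_homc _ _)).
  apply IsGMor_IsGOMor; split; [apply sdLim_p_mor |]; intros j x y; reflexivity.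
Qed.

End SemidirectLimit.

(** Equivariance of [psi] becomes one equation of pro-set morphisms, from which the comparison of
    semidirect products is formal. The finite diagrams are taken in the product of the two index
    categories, so that levels of [G] and of [X] are refined together. *)
Lemma levelwise_action (G X : ProGrp) (HG : IsProGrp G) (HX : IsProGrp X)
    (a : Mor (prodP (uP G) (uP X)) (uP X)) : IsProSetAction G X a ->
  exists (D : DirSet) (u : FFun (posetCat D) (gidx G))
    (Xg : dcar D -> Grp)
    (Xm : forall j j', dle j j' -> gcar (Xg j') -> gcar (Xg j))
    (al : forall j, gcar (ggrp G (fob u j)) -> gcar (Xg j) -> gcar (Xg j)),
    IsFunctor u /\ StrongCofinal u /\ IsProGrp (mkPG D Xg Xm) /\
    (forall j, IsGAction (ggrp G (fob u j)) (Xg j) (al j)) /\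
    (forall j j' (p : dle j j') (g : gcar (ggrp G (fob u j'))) (x : gcar (Xg j')),
       Xm j j' p (al j' g x) = al j (gmap G (fhom u (p : @hom (posetCat D) j j')) g) (Xm j j' p x)) /\
    exists psi : Mor (uP X) (uP (mkPG D Xg Xm)), IsGIso psi /\
      meq (mcomp psi a) (mcomp (sdLim_act G D u Xg Xm al) (mprod (canon G u) psi)).
Proof.
  intro Ha.
  set (I := prodCat (gidx G) (gidx X)).
  pose proof (diagFun_functor I) as Fu; pose proof (diagFun_cofinal I) as Cu.
  set (v := diagFun I) in *; set (D0 := dirDiagram I) in *.
  exists (indexDir G X HG HX a Ha D0 v Fu Cu), (indexFun G X HG HX a Ha D0 v Fu Cu),
    (wgrp G X a D0 v), (wmap G X a D0 v), (wal G X a D0 v).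
  split; [apply indexFun_functor |].
  split; [apply indexFun_cofinal |].
  split; [apply wsys_ProGrp |].
  split; [intro j; apply wal_action; assumption |].
  split; [intros j j' p g x; apply wmap_wal; assumption |].
  exists (wpsi G X HG HX a Ha D0 v Fu Cu); split.
  - apply (IsGIso_intro HX (wsys_ProGrp G X HG HX a Ha D0 v Fu Cu) _
             (wchi G X HG HX a Ha D0 v Fu Cu)).
    + apply wpsi_GMor.
    + apply wchi_mor.
    + apply wchi_wpsi.
    + apply wpsi_wchi.
  - intro b; apply wpsi_equivariant; assumption.
Qed.

(** * The semidirect product as a group object, and its isomorphism with the formal limit *)

Section SemidirectGroupObject.

Variables (G X : ProGrp) (HG : IsProGrp G) (HX : IsProGrp X).
Variables (a : Mor (prodP (uP G) (uP X)) (uP X)) (Ma : IsMor a).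

Let gG : GO := pgGO G HG.
Let gX : GO := pgGO X HX.
Let oG : Sys := sG gG.
Let oX : Sys := sG gX.

Definition sdAct : Hom (pS oG oX) oX := @homc (pS oG oX) oX a Ma.

Definition sdHG : HStr (pS oX oG) :=
  {| hm := << hm (hgs gX) \; << pi1 \; pi1, sdAct \; << pi2 \; pi1, pi1 \; pi2 >> >>,
              hm (hgs gG) \; << pi2 \; pi1, pi2 \; pi2 >> >>;
     he := << he (hgs gX), he (hgs gG) >>;
     hi := << sdAct \; << hi (hgs gG) \; pi2, hi (hgs gX) \; pi1 >>, hi (hgs gG) \; pi2 >> |}.

Lemma reps_sdGO_gom :
  @reps (pS (pS oX oG) (pS oX oG)) (pS oX oG) (gom (sdGO G X a)) (hm sdHG).
Proof.
  set (Y := pS oX oG).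
  pose proof (reps_comp (reps_fst oX oG) (reps_fst Y Y)) as x.
  pose proof (reps_comp (reps_snd oX oG) (reps_fst Y Y)) as g.
  pose proof (reps_comp (reps_fst oX oG) (reps_snd Y Y)) as x'.
  pose proof (reps_comp (reps_snd oX oG) (reps_snd Y Y)) as g'.
  pose proof (@reps_homc (pS oX oX) oX (lmul X) (IsMor_lmul X HX)) as mX.
  pose proof (@reps_homc (pS oG oG) oG (lmul G) (IsMor_lmul G HG)) as mG.
  pose proof (@reps_homc (pS oG oX) oX a Ma) as ra.
  exact (reps_pair (reps_comp mX (reps_pair x (reps_comp ra (reps_pair g x'))))
                   (reps_comp mG (reps_pair g g'))).
Qed.

Lemma reps_sdExt_i :
  @reps oX (pS oX oG) (sgi (sdExt G X a)) << idh oX, @gone (hgrp (hgs gG) oX) >>.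
Proof. exact (reps_pair (reps_id oX) (reps_comp (reps_homc _ (go_e gG)) (reps_bang oX))). Qed.

Lemma reps_sdExt_s :
  @reps oG (pS oX oG) (sgs (sdExt G X a)) << @gone (hgrp (hgs gX) oG), idh oG >>.
Proof. exact (reps_pair (reps_comp (reps_homc _ (go_e gX)) (reps_bang oG)) (reps_id oG)). Qed.

Lemma sdHG_mul {T : Sys} (z z' : Hom T (pS oX oG)) :
  @gmul (hgrp sdHG T) z z' =
  << @gmul (hgrp (hgs gX) T) (pi1 \; z) (sdAct \; << pi2 \; z, pi1 \; z' >>),
     @gmul (hgrp (hgs gG) T) (pi2 \; z) (pi2 \; z') >>.
Proof. cbn [gmul hgrp hm sdHG]; homs; reflexivity. Qed.

Section LevelwiseIso.

Variables (D : DirSet) (u : FFun (posetCat D) (gidx G))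
  (Xg : dcar D -> Grp) (Xm : forall j j', dle j j' -> gcar (Xg j') -> gcar (Xg j))
  (al : forall j, gcar (ggrp G (fob u j)) -> gcar (Xg j) -> gcar (Xg j)).
Hypotheses (Fu : IsFunctor u) (Cu : StrongCofinal u) (HX' : IsProGrp (mkPG D Xg Xm))
  (Hact : forall j, IsGAction (ggrp G (fob u j)) (Xg j) (al j))
  (Hcomp : forall j j' (p : dle j j') (g : gcar (ggrp G (fob u j'))) (x : gcar (Xg j')),
     Xm j j' p (al j' g x) = al j (gmap G (fhom u (p : @hom (posetCat D) j j')) g) (Xm j j' p x)).
Variable psi : Mor (uP X) (uP (mkPG D Xg Xm)).
Hypotheses (Ipsi : IsGIso psi)
  (Epsi : meq (mcomp psi a) (mcomp (sdLim_act G D u Xg Xm al) (mprod (canon G u) psi))).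

Let L := sdLim G D u Xg Xm al.
Let HL : IsProGrp L := IsProGrp_sdLim G D u Xg Xm al HG Fu HX' Hact Hcomp.
Let gL : GO := pgGO L HL.
Let gX' : GO := pgGO (mkPG D Xg Xm) HX'.
Let gG' : GO := pgGO (reindex G u) (IsProGrp_reindex G _ u HG Fu).
Let oL : Sys := sG gL.
Let oX' : Sys := sG gX'.
Let oG' : Sys := sG gG'.
Let qx : Hom oL oX' := hx G D u Xg Xm al HG Fu HX' Hact Hcomp.
Let qp : Hom oL oG' := hp G D u Xg Xm al HG Fu HX' Hact Hcomp.
Let rx : @reps oL oX' (sdLim_x G D u Xg Xm al) qx := reps_homc _ _.
Let rp : @reps oL oG' (sdLim_p G D u Xg Xm al) qp := reps_homc _ _.
Let ract : @reps (pS oG' oX') oX' (sdLim_act G D u Xg Xm al)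
  (hact G D u Xg Xm al HG Fu HX' Hcomp) := reps_homc _ _.

Let hpsi : Hom oX oX' := @homc oX oX' psi (proj1 (proj1 Ipsi)).
Let kap : Hom oG oG' := @homc oG oG' (canon G u) (proj1 (canon_GMor G _ u HG)).
Let rpsi : @reps oX oX' psi hpsi := reps_homc _ _.
Let rkap : @reps oG oG' (canon G u) kap := reps_homc _ _.

Lemma hpsi_hom : IsHGM (hgs gX) (hgs gX') hpsi.
Proof. apply (@IsGOMor_IsHGM gX gX' psi hpsi rpsi), IsGMor_IsGOMor, Ipsi. Qed.

Lemma kap_hom : IsHGM (hgs gG) (hgs gG') kap.
Proof. apply (@IsGOMor_IsHGM gG gG' (canon G u) kap rkap), IsGMor_IsGOMor, canon_GMor, HG. Qed.

Lemma hpsi_act : hpsi \; sdAct = hact G D u Xg Xm al HG Fu HX' Hcomp \; << kap \; pi1, hpsi \; pi2 >>.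
Proof.
  exact (reps_eq (reps_comp rpsi (@reps_homc (pS oG oX) oX a Ma))
                 (reps_comp ract (reps_prod rkap rpsi)) Epsi).
Qed.

(** In coordinates this is [psi] times [canon]; the target is indexed by single elements of [D]
    instead of pairs, so it is written out by hand instead of with [mprod]. *)
Definition sdphi : Mor (pS oX oG) oL := fun j =>
  existT (fun c : ob (pidx (pS oX oG)) => pobj (pS oX oG) c -> (gcar (Xg j) * gcar (ggrp G (fob u j)))%type)
    (projT1 (psi j), fob u j) (fun xg => (projT2 (psi j) (fst xg), snd xg)).

Lemma sdphi_x : meq (mcomp psi (mfst oX oG)) (mcomp (sdLim_x G D u Xg Xm al) sdphi).
Proof.
  intro j; apply (geq_gpost (projT2 (psi j)) _ _
    (mfst_at oX oG (projT1 (psi j)) (fob u j))).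
Qed.

Lemma sdphi_p : meq (mcomp (canon G u) (msnd oX oG)) (mcomp (sdLim_p G D u Xg Xm al) sdphi).
Proof. intro j; apply (msnd_at oX oG (projT1 (psi j)) (fob u j)). Qed.

Lemma sdphi_mor : IsMor sdphi.
Proof.
  apply (sdLim_mor G D u Xg Xm al HG Fu HX' Hact Hcomp (pS oX oG)).
  - apply (IsMor_meq (sysP (pS oX oG)) _ _ sdphi_x).
    exact (reps_IsMor (reps_comp rpsi (reps_fst oX oG))).
  - apply (IsMor_meq (sysP (pS oX oG)) _ _ sdphi_p).
    exact (reps_IsMor (reps_comp rkap (reps_snd oX oG))).
Qed.

Let hphi : Hom (pS oX oG) oL := @homc (pS oX oG) oL sdphi sdphi_mor.
Let rphi : @reps (pS oX oG) oL sdphi hphi := reps_homc _ _.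

Lemma hphi_x : qx \; hphi = hpsi \; pi1.
Proof.
  symmetry; exact (reps_eq (reps_comp rpsi (reps_fst oX oG)) (reps_comp rx rphi) sdphi_x).
Qed.

Lemma hphi_p : qp \; hphi = kap \; pi2.
Proof.
  symmetry; exact (reps_eq (reps_comp rkap (reps_snd oX oG)) (reps_comp rp rphi) sdphi_p).
Qed.

Lemma oL_ext {Z : Sys} (f f' : Hom Z oL) : qx \; f = qx \; f' -> qp \; f = qp \; f' -> f = f'.
Proof. apply (sdLim_ext G D u Xg Xm al HG Fu HX' Hact Hcomp). Qed.

(** Checked on the two coordinates of the limit. The first is where equivariance enters, through
    [hpsi_act]; the second uses only that [canon] is multiplicative. *)
Lemma hphi_hom : IsHGM sdHG (hgs gL) hphi.
Proof.
  intros T z z'; apply oL_ext.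
  - transitivity (@gmul (hgrp (hgs gX') T) (qx \; (hphi \; z))
       (hact G D u Xg Xm al HG Fu HX' Hcomp \; << qp \; (hphi \; z), qx \; (hphi \; z') >>)).
    2: { symmetry; apply (hx_mul G D u Xg Xm al HG Fu HX' Hact Hcomp). }
    rewrite sdHG_mul, !comp_assoc, hphi_x, hphi_p, <- !comp_assoc, pi1_pair.
    eapply eq_trans; [apply (hpsi_hom T) |].
    apply (f_equal (@gmul (hgrp (hgs gX') T) (hpsi \; (pi1 \; z)))).
    rewrite comp_assoc.
    eapply eq_trans; [exact (f_equal (fun f => f \; << pi2 \; z, pi1 \; z' >>) hpsi_act) |].
    homs; reflexivity.
  - transitivity (@gmul (hgrp (hgs gG') T) (qp \; (hphi \; z)) (qp \; (hphi \; z'))).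
    2: { symmetry; apply (hp_hom G D u Xg Xm al HG Fu HX' Hact Hcomp T). }
    rewrite sdHG_mul, !comp_assoc, hphi_p, <- !comp_assoc, pi2_pair.
    apply kap_hom.
Qed.

Lemma hphi_inv : exists h : Hom oL (pS oX oG), h \; hphi = idh _ /\ hphi \; h = idh _.
Proof.
  destruct (proj2 Ipsi) as [chi [[Mchi _] [c1 c2]]].
  destruct (canon_GIso G _ u HG Fu Cu) as [_ [dec [[Mdec _] [d1 d2]]]].
  pose (hchi := @homc oX' oX chi Mchi); pose (hdec := @homc oG' oG dec Mdec).
  assert (rchi : @reps oX' oX chi hchi) by apply reps_homc.
  assert (rdec : @reps oG' oG dec hdec) by apply reps_homc.
  pose proof (reps_eq (reps_comp rchi rpsi) (reps_id oX) c1) as e1.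
  pose proof (reps_eq (reps_comp rpsi rchi) (reps_id oX') c2) as e2.
  pose proof (reps_eq (reps_comp rdec rkap) (reps_id oG) d1) as e3.
  pose proof (reps_eq (reps_comp rkap rdec) (reps_id oG') d2) as e4.
  exists << hchi \; qx, hdec \; qp >>; split.
  - rewrite pair_comp, <- !comp_assoc, hphi_x, hphi_p, !comp_assoc, e1, e3, !comp_idl.
    apply pair_eta.
  - apply oL_ext; rewrite comp_assoc, ?hphi_x, ?hphi_p, <- comp_assoc, ?pi1_pair, ?pi2_pair;
      rewrite comp_assoc, ?e2, ?e4, comp_idl, comp_idr; reflexivity.
Qed.

Lemma sdphi_GOIso : @IsGOIso (sdGO G X a) (FG L) sdphi.
Proof.
  destruct hphi_inv as [h [e1 e2]].
  split.
  - exact (proj2 (@IsGOMor_iff (sdGO G X a) (FG L) (sysP (pS oX oG)) (sysP oL)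
      sdHG (hgs gL) _ _ reps_sdGO_gom (reps_homc _ (go_m gL)) rphi) hphi_hom).
  - exists (raw h); split; [| split].
    + exact (proj2 (@IsGOMor_iff (FG L) (sdGO G X a) (sysP oL) (sysP (pS oX oG))
        (hgs gL) sdHG _ _ (reps_homc _ (go_m gL)) reps_sdGO_gom (reps_raw h))
        (IsHGM_inv _ _ _ _ hphi_hom e1 e2)).
    + exact (reps_meq (reps_comp (reps_raw h) rphi) (reps_id (pS oX oG)) e1).
    + exact (reps_meq (reps_comp rphi (reps_raw h)) (reps_id oL) e2).
Qed.

Lemma sdLim_i_p : meq (zeroGO gX' gG') (mcomp (sdLim_p G D u Xg Xm al) (sdLim_i G D u Xg Xm al)).
Proof.
  intro j; destruct (f_cone (posetCat D) (pick_ob (posetCat D)) j) as [k [p [q _]]].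
  exists k, p, q; reflexivity.
Qed.

Lemma sdLim_s_x : meq (zeroGO gG' gX') (mcomp (sdLim_x G D u Xg Xm al) (sdLim_s G D u Xg Xm al)).
Proof.
  intro j; destruct (f_cone (posetCat D) (pick_ob (posetCat D)) j) as [k [p [q _]]].
  exists k, p, q; reflexivity.
Qed.

Lemma sdLim_i_mor : IsMor (sdLim_i G D u Xg Xm al).
Proof.
  apply (sdLim_mor G D u Xg Xm al HG Fu HX' Hact Hcomp oX').
  - exact (IsMor_mid oX' (sysP oX')).
  - apply (IsMor_meq (sysP oX') _ _ sdLim_i_p), (reps_IsMor (reps_zero gX' gG')).
Qed.

Lemma sdLim_s_mor : IsMor (sdLim_s G D u Xg Xm al).
Proof.
  apply (sdLim_mor G D u Xg Xm al HG Fu HX' Hact Hcomp oG').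
  - apply (IsMor_meq (sysP oG') _ _ sdLim_s_x), (reps_IsMor (reps_zero gG' gX')).
  - exact (IsMor_mid oG' (sysP oG')).
Qed.

Lemma sdphi_i : meq (mcomp sdphi (sgi (sdExt G X a))) (mcomp (sdLim_i G D u Xg Xm al) psi).
Proof.
  pose proof (@reps_homc oX' oL _ sdLim_i_mor) as ri; set (i := homc _ _) in ri.
  assert (e1 : qx \; i = idh oX').
  { apply (reps_eq (reps_comp rx ri) (reps_id oX')); apply (meq_refl (mid oX')). }
  assert (e2 : qp \; i = @gone (hgrp (hgs gG') oX')).
  { symmetry; apply (reps_eq (reps_zero gX' gG') (reps_comp rp ri)), sdLim_i_p. }
  apply (reps_meq (reps_comp rphi reps_sdExt_i) (reps_comp ri rpsi)), oL_ext.
  - rewrite !comp_assoc, hphi_x, e1, <- comp_assoc, pi1_pair, comp_idl, comp_idr; reflexivity.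
  - rewrite !comp_assoc, hphi_p, e2, <- comp_assoc, pi2_pair, hgrp_one_comp.
    exact (IsHom_one (IsHG_pgGO G HG oX) (IsHG_pgGO _ _ oX) _ (kap_hom oX)).
Qed.

Lemma sdphi_s : meq (mcomp sdphi (sgs (sdExt G X a))) (mcomp (sdLim_s G D u Xg Xm al) (canon G u)).
Proof.
  pose proof (@reps_homc oG' oL _ sdLim_s_mor) as rs; set (s := homc _ _) in rs.
  assert (e1 : qx \; s = @gone (hgrp (hgs gX') oG')).
  { symmetry; apply (reps_eq (reps_zero gG' gX') (reps_comp rx rs)), sdLim_s_x. }
  assert (e2 : qp \; s = idh oG').
  { apply (reps_eq (reps_comp rp rs) (reps_id oG')); apply (meq_refl (mid oG')). }
  apply (reps_meq (reps_comp rphi reps_sdExt_s) (reps_comp rs rkap)), oL_ext.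
  - rewrite !comp_assoc, hphi_x, e1, <- comp_assoc, pi1_pair, hgrp_one_comp.
    exact (IsHom_one (IsHG_pgGO X HX oG) (IsHG_pgGO _ _ oG) _ (hpsi_hom oG)).
  - rewrite !comp_assoc, hphi_p, e2, <- comp_assoc, pi2_pair, comp_idl, comp_idr; reflexivity.
Qed.

End LevelwiseIso.
End SemidirectGroupObject.

Lemma action_representation (G X : ProGrp) (HG : IsProGrp G) (HX : IsProGrp X)
    (a : Mor (prodP (uP G) (uP X)) (uP X)) : IsProSetAction G X a ->
  exists (D : DirSet) (u : FFun (posetCat D) (gidx G))
         (Xg : dcar D -> Grp)
         (Xm : forall j j', dle j j' -> gcar (Xg j') -> gcar (Xg j))
         (al : forall j, gcar (ggrp G (fob u j)) -> gcar (Xg j) -> gcar (Xg j)),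
    IsFunctor u /\ IsCofinal u /\
    IsProGrp (mkPG D Xg Xm) /\
    (forall j, IsGAction (ggrp G (fob u j)) (Xg j) (al j)) /\
    (forall j j' (p : dle j j') (g : gcar (ggrp G (fob u j'))) (x : gcar (Xg j')),
       Xm j j' p (al j' g x) = al j (gmap G (fhom u (p : @hom (posetCat D) j j')) g) (Xm j j' p x)) /\
    IsGIso (canon G u) /\
    exists psiX : Mor (uP X) (uP (mkPG D Xg Xm)),
      IsGIso psiX /\
      exists phi : Mor (prodP (uP X) (uP G)) (uP (sdLim G D u Xg Xm al)),
        @IsGOIso (sdGO G X a) (FG (sdLim G D u Xg Xm al)) phi /\
        meq (mcomp phi (sgi (sdExt G X a)))
            (mcomp (sdLim_i G D u Xg Xm al) psiX) /\
        meq (mcomp phi (sgs (sdExt G X a)))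
            (mcomp (sdLim_s G D u Xg Xm al) (canon G u)) /\
        meq (mcomp (sdLim_p G D u Xg Xm al) phi)
            (mcomp (canon G u) (sgp (sdExt G X a))).
Proof.
  intro Ha; pose proof (proj1 Ha) as Ma.
  destruct (levelwise_action G X HG HX a Ha)
    as [D [u [Xg [Xm [al [Fu [Cu [HX' [Hact [Hcomp [psi [Ipsi Epsi]]]]]]]]]]]].
  exists D, u, Xg, Xm, al.
  split; [exact Fu |]; split; [exact (proj1 Cu) |]; split; [exact HX' |].
  split; [exact Hact |]; split; [exact Hcomp |].
  split; [apply canon_GIso; assumption |].
  exists psi; split; [exact Ipsi |].
  exists (sdphi G X HG HX D u Xg Xm al Fu HX' Hact Hcomp psi).
  split; [apply (sdphi_GOIso G X HG HX a Ma); assumption |].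
  split; [apply (sdphi_i G X HG HX a D u Xg Xm al Fu HX' Hact Hcomp psi Ipsi) |].
  split; [apply (sdphi_s G X HG HX a D u Xg Xm al Fu HX' Hact Hcomp psi Ipsi) |].
  apply meq_sym, (sdphi_p G X HG HX D u Xg Xm al Fu HX' Hact Hcomp psi).
Qed.

(** * Free groups *)

Section FreeGroup.
Variable S : Type.

Definition fev {H : Grp} (f : S -> gcar H) : list (bool * S) -> gcar H :=
  fold_right (fun (s : bool * S) acc => gmul (if fst s then f (snd s) else ginv (f (snd s))) acc) gone.

(** Words are identified when they agree under every map of letters into every group. The universal
    property is then immediate, with no normal forms. *)
Definition frel (w w' : list (bool * S)) : Prop :=
  forall H : Grp, IsGroup H -> forall f : S -> gcar H, fev f w = fev f w'.

#[local] Instance frel_equiv : Equivalence frel.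
Proof.
  split.
  - intros w H gH f; reflexivity.
  - intros w w' e H gH f; symmetry; apply e, gH.
  - intros w w' w'' e e' H gH f; rewrite (e H gH f); apply e', gH.
Qed.

Lemma fev_app {H : Grp} (gH : IsGroup H) (f : S -> gcar H) (w w' : list (bool * S)) :
  fev f (w ++ w') = gmul (fev f w) (fev f w').
Proof.
  destruct gH as [as_ [l _]]; induction w as [| s w IH]; simpl.
  - rewrite l; reflexivity.
  - rewrite IH, as_; reflexivity.
Qed.

Lemma frel_app v v' w w' : frel v v' -> frel w w' -> frel (v ++ w) (v' ++ w').
Proof.
  intros e e' H gH f; rewrite !(fev_app gH), (e H gH f), (e' H gH f); reflexivity.
Qed.

Definition free : Grp := wordGrp _ (fun s => (negb (fst s), snd s)) frel.

Lemma free_mul (w w' : list (bool * S)) :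
  @gmul free (cls frel w) (cls frel w') = cls frel (w ++ w').
Proof. apply wordGrp_mul; [typeclasses eauto | apply frel_app]. Qed.

Lemma free_group : IsGroup free.
Proof.
  apply wordGrp_group; [typeclasses eauto | apply frel_app | |];
    intros [[] s] H [as_ [l [r [il ir]]]] f; simpl; rewrite r; auto.
Qed.

Definition fext {H : Grp} (f : S -> gcar H) (q : gcar free) : gcar H :=
  fev f (@rep _ frel q).

Lemma fext_cls {H : Grp} (gH : IsGroup H) (f : S -> gcar H) (w : list (bool * S)) :
  fext f (cls frel w) = fev f w.
Proof. apply (rep_cls frel w), gH. Qed.

Lemma fext_hom {H : Grp} (gH : IsGroup H) (f : S -> gcar H) : IsHom free H (fext f).
Proof.
  intros x y; rewrite <- (cls_rep frel x), <- (cls_rep frel y), free_mul, !(fext_cls gH).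
  apply fev_app, gH.
Qed.

Definition feta (s : S) : gcar free := cls frel ((true, s) :: nil).

Lemma fext_feta {H : Grp} (gH : IsGroup H) (f : S -> gcar H) (s : S) : fext f (feta s) = f s.
Proof. unfold feta; rewrite (fext_cls gH); apply gH. Qed.

Lemma fext_ext {H : Grp} (f f' : S -> gcar H) (q : gcar free) :
  (forall s, f s = f' s) -> fext f q = fext f' q.
Proof. intro e; f_equal; extensionality s; apply e. Qed.

Lemma fext_comp {H K : Grp} (gH : IsGroup H) (gK : IsGroup K) (h : gcar H -> gcar K)
    (f : S -> gcar H) (q : gcar free) :
  IsHom H K h -> h (fext f q) = fext (fun s => h (f s)) q.
Proof.
  intro hh; unfold fext; induction (@rep _ frel q) as [| [[] s] w IH]; simpl.
  - apply (IsHom_one gH gK), hh.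
  - rewrite hh, IH; reflexivity.
  - rewrite hh, IH, (IsHom_inv gH gK h hh); reflexivity.
Qed.

Lemma fext_one {H : Grp} (gH : IsGroup H) (q : gcar free) : fext (fun _ => @gone H) q = gone.
Proof.
  destruct gH as [as_ [l [r [il ir]]]].
  unfold fext; induction (@rep _ frel q) as [| [[] s] w IH]; simpl.
  - reflexivity.
  - rewrite IH; apply l.
  - rewrite IH, r, <- (r (ginv gone)); apply il.
Qed.

End FreeGroup.

Definition fmap {S T : Type} (g : S -> T) : gcar (free S) -> gcar (free T) :=
  fext S (fun s => feta T (g s)).

Lemma fext_fmap {S T : Type} {H : Grp} (gH : IsGroup H) (g : S -> T) (f : T -> gcar H) q :
  fext T f (fmap g q) = fext S (fun s => f (g s)) q.
Proof.
  unfold fmap; rewrite (fext_comp S (free_group T) gH (fext T f)); [| apply fext_hom, gH].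
  apply fext_ext; intro s; apply (fext_feta T gH).
Qed.

Lemma fext_id (S : Type) q : fext S (feta S) q = q.
Proof.
  rewrite <- (cls_rep (frel S) q) at 2; unfold fext.
  induction (@rep _ (frel S) q) as [| [[] s] w IH]; [reflexivity | |].
  - change (@gmul (free S) (feta S s) (fev S (feta S) w) = cls (frel S) ((true, s) :: w)).
    rewrite IH; exact (free_mul S ((true, s) :: nil) w).
  - change (@gmul (free S) (ginv (feta S s)) (fev S (feta S) w) = cls (frel S) ((false, s) :: w)).
    rewrite IH, <- (grp_inv_uniq (free_group S) (feta S s) (cls (frel S) ((false, s) :: nil))).
    + exact (free_mul S ((false, s) :: nil) w).
    + unfold feta; rewrite free_mul; apply cls_eq; [apply frel_equiv |].
      intros H [as_ [l [r [il ir]]]] f; simpl; rewrite r; apply ir.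
Qed.

(** With the unit [meta] and the extension [mext], this turns an arbitrary pro-set into a test
    object for kernels of pro-groups. *)
Definition freeP (Z : ProSet) : ProGrp :=
  {| gidx := pidx Z; ggrp := fun i => free (pobj Z i); gmap := fun i j p => fmap (pmap Z p) |}.

Lemma IsProGrp_freeP (Z : ProSet) : IsSys Z -> IsProGrp (freeP Z).
Proof.
  intros [z1 z2]; split; [split | split].
  - intros i q; eapply eq_trans; [| apply fext_id].
    apply (fext_ext (pobj Z i)); intro s; rewrite z1; reflexivity.
  - intros i j k p q x; eapply eq_trans; [| symmetry; apply (fext_fmap (free_group _))].
    apply (fext_ext (pobj Z k)); intro s; rewrite z2; reflexivity.
  - intro i; apply free_group.
  - intros i j p; apply fext_hom, free_group.
Qed.

Definition gext {Z : ProSet} {H : Grp} (v : Germ Z (gcar H)) : Germ (uP (freeP Z)) (gcar H) :=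
  existT (fun i : ob (pidx Z) => gcar (free (pobj Z i)) -> gcar H) (projT1 v) (fext _ (projT2 v)).

Lemma geq_gext {Z : ProSet} {H : Grp} (gH : IsGroup H) (v w : Germ Z (gcar H)) :
  geq v w -> geq (gext v) (gext w).
Proof.
  intros [k [p [q e]]]; exists k, p, q; intro x; simpl.
  rewrite !(fext_fmap gH); apply fext_ext, e.
Qed.

Lemma gext_gpost {Z : ProSet} {H K : Grp} (gH : IsGroup H) (gK : IsGroup K)
    (h : gcar H -> gcar K) (v : Germ Z (gcar H)) :
  IsHom H K h -> geq (gpost h (gext v)) (gext (gpost h v)).
Proof.
  intro hh; apply (@geq_ext (uP (freeP Z)) _ (projT1 v)); intro x.
  apply (fext_comp _ gH gK), hh.
Qed.

Definition mext {Z : ProSet} {P : ProGrp} (F : Mor Z (uP P)) : Mor (uP (freeP Z)) (uP P) :=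
  fun j => gext (F j).

Lemma mext_GMor {Z : ProSet} (HZ : IsSys Z) {P : ProGrp} (HP : IsProGrp P) (F : Mor Z (uP P)) :
  IsMor F -> IsGMor (mext F).
Proof.
  intro HF; pose proof (proj1 (IsProGrp_freeP Z HZ)) as SF.
  destruct HP as [_ [gP hP]]; split.
  - intros j j' b; eapply (geq_trans SF).
    + apply (gext_gpost (gP j') (gP j)), hP.
    + apply (geq_gext (gP j)), (HF j j' b).
  - intro j; apply fext_hom, gP.
Qed.

Lemma mext_mcomp {Z : ProSet} {P Q : ProGrp} (HP : IsProGrp P) (HQ : IsProGrp Q)
    (K : Mor (uP P) (uP Q)) (F : Mor Z (uP P)) :
  IsGMor K -> meq (mcomp K (mext F)) (mext (mcomp K F)).
Proof.
  intros [_ hK] j; apply (gext_gpost (proj1 (proj2 HP) _) (proj1 (proj2 HQ) j) _ _ (hK j)).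
Qed.

Lemma mext_meq {Z : ProSet} {P : ProGrp} (HP : IsProGrp P) (F F' : Mor Z (uP P)) :
  meq F F' -> meq (mext F) (mext F').
Proof. intros e j; apply (geq_gext (proj1 (proj2 HP) j)), e. Qed.

Definition meta (Z : ProSet) : Mor Z (uP (freeP Z)) := fun i =>
  existT (fun k : ob (pidx Z) => pobj Z k -> gcar (free (pobj Z i))) i (feta _).

Lemma meta_mor (Z : ProSet) : IsSys Z -> IsMor (meta Z).
Proof.
  intros HZ i j p; exists j, (idc j), p; intro x; simpl.
  rewrite (proj1 HZ); exact (fext_feta _ (free_group _) (fun s => feta _ (pmap Z p s)) x).
Qed.

Lemma mext_meta {Z : ProSet} {P : ProGrp} (HP : IsProGrp P) (F : Mor Z (uP P)) :
  meq (mcomp (mext F) (meta Z)) F.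
Proof.
  intro j; exists (projT1 (F j)), (idc _), (idc _); intro x.
  apply (fext_feta _ (proj1 (proj2 HP) j)).
Qed.

(** * Kernels *)

(** The kernel property against all pro-sets and all morphisms, multiplicative or not. Kernels of
    pro-groups and kernels of group objects are compared through it. *)
Definition HKer {K Y Q : Sys} (t : HStr Q) (i : Hom K Y) (p : Hom Y Q) : Prop :=
  p \; i = @gone (hgrp t K) /\
  (forall (Z : Sys) (f : Hom Z Y), p \; f = @gone (hgrp t Z) -> exists h, i \; h = f) /\
  (forall (Z : Sys) (h h' : Hom Z K), i \; h = i \; h' -> h = h').

Lemma IsKernelPG_HKer {K Y Q : ProGrp} (HK : IsProGrp K) (HY : IsProGrp Y) (HQ : IsProGrp Q)
    (i : Mor (uP K) (uP Y)) (p : Mor (uP Y) (uP Q))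
    (hi : Hom (sG (pgGO K HK)) (sG (pgGO Y HY))) (hp : Hom (sG (pgGO Y HY)) (sG (pgGO Q HQ))) :
  @reps (sG (pgGO K HK)) (sG (pgGO Y HY)) i hi ->
  @reps (sG (pgGO Y HY)) (sG (pgGO Q HQ)) p hp -> IsGMor i -> IsGMor p -> IsKernelPG i p ->
  HKer (hgs (pgGO Q HQ)) hi hp.
Proof.
  intros ri rp gi gp [h0 hu].
  assert (e0 : hp \; hi = @gone (hgrp (hgs (pgGO Q HQ)) (sG (pgGO K HK)))).
  { exact (reps_eq (reps_comp rp ri) (reps_zero (pgGO K HK) (pgGO Q HQ)) h0). }
  assert (zero : forall (Z : Sys) (F : Mor Z (uP Y)),
    meq (mcomp p F) (mcomp (lone Q) (mbang Z)) ->
    meq (mcomp p (mext F)) (zeroGO (FG (freeP Z)) (FG Q))).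
  { intros Z F e.
    pose proof (proj1 (IsProGrp_freeP Z (sysP Z))) as SF.
    eapply (meq_trans SF); [apply (mext_mcomp HY HQ _ _ gp) |].
    eapply (meq_trans SF); [apply (mext_meq HQ _ _ e) |].
    intro j; apply (@geq_ext (uP (freeP Z)) _ (pick_ob (pidx Z))); intro x.
    apply (fext_one _ (proj1 (proj2 HQ) j)). }
  split; [exact e0 | split].
  - intros Z f ef.
    pose proof (IsProGrp_freeP Z (sysP Z)) as HF.
    assert (e : meq (mcomp p (raw f)) (mcomp (lone Q) (mbang Z))).
    { apply (reps_meq (reps_comp rp (reps_raw f))
         (reps_comp (reps_homc _ (go_e (pgGO Q HQ))) (reps_bang Z))), ef. }
    destruct (hu (freeP Z) HF (mext (raw f)) (mext_GMor (sysP Z) HY _ (IsMor_raw f)) (zero Z _ e))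
      as [[h [gh eh]] _].
    set (SF := mkSys (uP (freeP Z)) (proj1 HF)).
    pose proof (@reps_homc SF (sG (pgGO K HK)) h (proj1 gh)) as rh.
    pose proof (@reps_homc Z SF (meta Z) (meta_mor Z (sysP Z))) as rm.
    pose proof (@reps_homc SF (sG (pgGO Y HY)) (mext (raw f))
      (proj1 (mext_GMor (sysP Z) HY _ (IsMor_raw f)))) as rx.
    exists (@homc SF (sG (pgGO K HK)) _ (proj1 gh) \; @homc Z SF _ (meta_mor Z (sysP Z))).
    rewrite comp_assoc.
    rewrite (reps_eq (reps_comp ri rh) rx eh).
    exact (reps_eq (reps_comp rx rm) (reps_raw f) (mext_meta HY (raw f))).
  - intros Z h h' e.
    pose proof (IsProGrp_freeP Z (sysP Z)) as HF.
    assert (e1 : meq (mcomp p (mcomp i (raw h))) (mcomp (lone Q) (mbang Z))).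
    { apply (reps_meq (reps_comp rp (reps_comp ri (reps_raw h)))
         (reps_comp (reps_homc _ (go_e (pgGO Q HQ))) (reps_bang Z))).
      rewrite comp_assoc, e0; apply hgrp_one_comp. }
    assert (M : IsMor (mcomp i (raw h))) by exact (reps_IsMor (reps_comp ri (reps_raw h))).
    destruct (hu (freeP Z) HF (mext (mcomp i (raw h))) (mext_GMor (sysP Z) HY _ M) (zero Z _ e1))
      as [_ u].
    (* The extensions of [h] and [h'] both factor the extension of [i h] through the kernel, so they
       agree there; restricting along [meta] gives back [h] and [h']. *)
    assert (eh : meq (mext (raw h)) (mext (raw h'))).
    { apply u.
      - exact (mext_GMor (sysP Z) HK _ (IsMor_raw h)).
      - exact (mext_GMor (sysP Z) HK _ (IsMor_raw h')).
      - apply (mext_mcomp HK HY _ _ gi).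
      - eapply (meq_trans (proj1 HF)); [apply (mext_mcomp HK HY _ _ gi) |].
        apply (mext_meq HY).
        exact (reps_meq (reps_comp ri (reps_raw h')) (reps_comp ri (reps_raw h)) (eq_sym e)). }
    set (SF := mkSys (uP (freeP Z)) (proj1 HF)).
    apply (reps_eq (reps_raw h) (reps_raw h')).
    eapply (meq_trans (sysP Z)); [apply meq_sym, (mext_meta HK) |].
    eapply (meq_trans (sysP Z)); [| apply (mext_meta HK)].
    apply (mcomp_meq (sysP Z)); [apply meta_mor, sysP | exact eh | apply meq_refl].
Qed.

(** What has to be added is that the factorisation of a homomorphism is a homomorphism, and this
    follows because [i] is monic on generalised elements. *)
Lemma HKer_IsKernelGO {K Y Q : GO} (i : Mor (gos K) (gos Y)) (p : Mor (gos Y) (gos Q))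
    (hi : Hom (sG K) (sG Y)) (hp : Hom (sG Y) (sG Q)) :
  reps i hi -> reps p hp -> @IsGOMor K Y i -> HKer (hgs Q) hi hp -> @IsKernelGO K Y Q i p.
Proof.
  intros ri rp gi [h0 [hf hu]]; split.
  - exact (reps_meq (reps_comp rp ri) (reps_zero K Q) h0).
  - intros Z0 HZ0 f gf ef.
    pose (Z := Build_GO Z0 (proj1 HZ0) (proj1 (proj2 HZ0)) (proj1 (proj2 (proj2 HZ0)))
                 (proj1 (proj2 (proj2 (proj2 HZ0))))).
    pose proof (@reps_homc (sG Z) (sG Y) f (proj1 gf)) as rf; set (hf' := homc _ _) in rf.
    pose proof (reps_eq (reps_comp rp rf) (reps_zero Z Q) ef) as ef'.
    apply (@IsGOMor_IsHGM K Y i hi ri) in gi.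
    pose proof (proj1 (@IsGOMor_IsHGM Z Y f hf' rf) gf) as gf'.
    split.
    + destruct (hf _ _ ef') as [h eh]; exists (raw h); split.
      * apply (@IsGOMor_IsHGM Z K (raw h) h (reps_raw h)).
        intros T x y; apply hu.
        rewrite comp_assoc, eh, (gf' T), (gi T), !comp_assoc, eh; reflexivity.
      * exact (reps_meq (reps_comp ri (reps_raw h)) rf eh).
    + intros h h' [Mh _] [Mh' _] e e'.
      pose proof (@reps_homc (sG Z) (sG K) h Mh) as rh.
      pose proof (@reps_homc (sG Z) (sG K) h' Mh') as rh'.
      apply (reps_meq rh rh'), hu.
      rewrite (reps_eq (reps_comp ri rh) rf e); symmetry.
      exact (reps_eq (reps_comp ri rh') rf e').
Qed.

Lemma IsKernelGO_IsKernelPG {K Y Q : ProGrp} (i : Mor (uP K) (uP Y)) (p : Mor (uP Y) (uP Q)) :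
  @IsKernelGO (FG K) (FG Y) (FG Q) i p -> IsKernelPG i p.
Proof.
  intros [h0 hu]; split; [exact h0 |]; intros Z HZ f gf ef.
  destruct (hu (FG Z) (IsGObj_FG Z HZ) f (IsGMor_IsGOMor f gf) ef) as [[h [gh eh]] u].
  split.
  - destruct (IsGOMor_full HZ h gh) as [h' [gh' e]]; exists h'; split; [exact gh' |].
    apply (meq_trans (proj1 HZ) _ (mcomp i h)); [| exact eh].
    apply (mcomp_meq (proj1 HZ)); [apply gh' | apply meq_refl | apply meq_sym, e].
  - intros h1 h2 g1 g2; apply u; apply IsGMor_IsGOMor; assumption.
Qed.

(** * The kernel of a morphism from a pro-set to a pro-group *)

Section KernelProSet.

Variables (A : ProSet) (HA : IsSys A) (Q : ProGrp) (HQ : IsProGrp Q).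
Variables (p : Mor A (uP Q)) (Hp : IsMor p).

(** All local representatives of [p], with commuting squares as arrows. Over this category [p]
    becomes a levelwise map [kf], and the fibres of [kf] over the unit form the kernel. *)
Record kidx := {
  km : ob (pidx A);
  kj : ob (gidx Q);
  kf : pobj A km -> gcar (ggrp Q kj);
  kf_rep : @geq A (gcar (ggrp Q kj)) (existT _ km kf) (p kj)
}.

Definition khom (b c : kidx) : Type :=
  { uv : (hom (km b) (km c) * hom (kj b) (kj c))%type |
    forall y, kf b (pmap A (fst uv) y) = gmap Q (snd uv) (kf c y) }.

Lemma khom_eq (b c : kidx) (f g : khom b c) : proj1_sig f = proj1_sig g -> f = g.
Proof. intro e; apply eq_sig_hprop; [intros; apply proof_irrelevance | exact e]. Qed.

Definition kid (b : kidx) : khom b b.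
Proof.
  exists (idc _, idc _); intro y; simpl.
  rewrite (proj1 HA); symmetry; apply (proj1 (proj1 HQ)).
Defined.

Definition kcmp (b c d : kidx) (g : khom c d) (f : khom b c) : khom b d.
Proof.
  exists (cmp (fst (proj1_sig g)) (fst (proj1_sig f)), cmp (snd (proj1_sig g)) (snd (proj1_sig f))).
  intro y; simpl.
  rewrite (proj2 HA), (proj2_sig f), (proj2_sig g); symmetry; apply (proj2 (proj1 HQ)).
Defined.

Lemma kf_res (b : kidx) (m : ob (pidx A)) (h : hom (km b) m) :
  @geq A (gcar (ggrp Q (kj b))) (existT _ m (fun y => kf b (pmap A h y))) (p (kj b)).
Proof.
  apply (geq_trans HA _ (existT _ (km b) (kf b))); [| apply kf_rep].
  apply geq_sym, (geq_res HA _ _ h (kf b)).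
Qed.

Definition kres (b : kidx) (m : ob (pidx A)) (h : hom (km b) m) : kidx :=
  {| km := m; kj := kj b; kf := fun y => kf b (pmap A h y); kf_rep := kf_res b m h |}.

Lemma kres_hom (b : kidx) (m : ob (pidx A)) (h : hom (km b) m) :
  exists f : khom b (kres b m h), fst (proj1_sig f) = h.
Proof.
  unshelve eexists (exist _ (h, idc _) _); [| reflexivity].
  intro y; simpl; symmetry; apply (proj1 (proj1 HQ)).
Qed.

Definition kbase (j : ob (gidx Q)) : kidx :=
  {| km := projT1 (p j); kj := j; kf := projT2 (p j);
     (* A dependent pair is not convertible to the pair of its projections, hence the case analysis
        on [p j]. *)
     kf_rep := match p j as g return geq (existT _ (projT1 g) (projT2 g)) g with
               | existT _ m f => geq_refl _ end |}.

Lemma kf_geq (b : kidx) (j : ob (gidx Q)) (v : hom (kj b) j) :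
  exists k (r : hom (km b) k) (s : hom (projT1 (p j)) k),
    forall y, kf b (pmap A r y) = gmap Q v (projT2 (p j) (pmap A s y)).
Proof.
  destruct (geq_trans HA _ _ (gpost (gmap Q v) (p j)) (kf_rep b) (geq_sym _ _ (Hp _ _ v)))
    as [k [r [s e]]].
  exists k, r, s; exact e.
Qed.

Definition kerCat : FCat.
Proof.
  refine {| ob := kidx; hom := khom; idc := kid; cmp := kcmp |}.
  - intros b c [[f g] h]; apply khom_eq; simpl; rewrite !cmp_idl; reflexivity.
  - intros b c [[f g] h]; apply khom_eq; simpl; rewrite !cmp_idr; reflexivity.
  - intros b c d e f g h; apply khom_eq; simpl; rewrite !cmp_assoc; reflexivity.
  - destruct (f_nonempty (gidx Q)) as [j _]; exists (kbase j); exact Logic.I.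
  - intros b c.
    (* Both representatives are compared with [p j] at a common [j], then the level in [A] is
       deepened until the two restrictions of [p j] coincide; that restriction is the upper
       bound. *)
    destruct (f_cone (gidx Q) (kj b) (kj c)) as [j [v [v' _]]].
    destruct (kf_geq b j v) as [k1 [r1 [s1 e1]]].
    destruct (kf_geq c j v') as [k2 [r2 [s2 e2]]].
    destruct (f_cone _ k1 k2) as [k3 [t1 [t2 _]]].
    destruct (f_coeq _ _ _ (cmp t1 s1) (cmp t2 s2)) as [k4 [h eh]].
    rewrite !cmp_assoc in eh.
    set (d := kres (kbase j) k4 (cmp (cmp h t1) s1)).
    assert (h1 : forall y, kf b (pmap A (cmp (cmp h t1) r1) y) = gmap Q v (kf d y)).
    { intro y; simpl; rewrite (proj2 HA _ _ _ r1), (proj2 HA _ _ _ s1); apply e1. }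
    assert (h2 : forall y, kf c (pmap A (cmp (cmp h t2) r2) y) = gmap Q v' (kf d y)).
    { intro y; change (kf d y) with (projT2 (p j) (pmap A (cmp (cmp h t1) s1) y)).
      rewrite eh, (proj2 HA _ _ _ r2), (proj2 HA _ _ _ s2); apply e2. }
    exists d, (exist _ (cmp (cmp h t1) r1, v) h1), (exist _ (cmp (cmp h t2) r2, v') h2).
    exact Logic.I.
  - intros b c [[f g] h] [[f' g'] h']; simpl in *.
    destruct (f_coeq _ _ _ f f') as [m1 [t1 e1]].
    destruct (f_coeq _ _ _ g g') as [j1 [v ev]].
    (* Coequalising the two components separately does not give a commuting square; one is obtained
       at a deeper level, which must still lie beyond [t1]. *)
    destruct (kf_geq c j1 v) as [k [r [s e]]].
    destruct (f_cone _ m1 k) as [k3 [t2 [t3 _]]].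
    destruct (f_coeq _ _ _ (cmp t2 t1) (cmp t3 r)) as [k4 [t e4]].
    set (d := kres (kbase j1) k4 (cmp (cmp t t3) s)).
    assert (h1 : forall y, kf c (pmap A (cmp (cmp t t3) r) y) = gmap Q v (kf d y)).
    { intro y; simpl; rewrite (proj2 HA _ _ _ r), (proj2 HA _ _ _ s); apply e. }
    exists d, (exist _ (cmp (cmp t t3) r, v) h1).
    apply khom_eq; simpl; f_equal; [| exact ev].
    rewrite <- (cmp_assoc _ _ _ _ _ r), <- e4, <- !cmp_assoc, e1; reflexivity.
Defined.

Definition kset (b : kidx) : Type := { y : pobj A (km b) | kf b y = gone }.

Lemma kset_eq (b : kidx) (y y' : kset b) : proj1_sig y = proj1_sig y' -> y = y'.
Proof. intro e; apply eq_sig_hprop; [intros; apply proof_irrelevance | exact e]. Qed.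

Lemma kmap_one (b c : kidx) (f : khom b c) (y : kset c) :
  kf b (pmap A (fst (proj1_sig f)) (proj1_sig y)) = gone.
Proof.
  rewrite (proj2_sig f), (proj2_sig y).
  apply IsHom_one; [apply HQ | apply HQ | apply HQ].
Qed.

Definition kerP : ProSet :=
  {| pidx := kerCat; pobj := kset;
     pmap := fun (b c : ob kerCat) (f : khom b c) y => exist _ _ (kmap_one b c f y) |}.

Lemma IsSys_kerP : IsSys kerP.
Proof.
  split.
  - intros b y; apply kset_eq, (proj1 HA).
  - intros b c d f g y; apply kset_eq, (proj2 HA).
Qed.

Definition kgerm (m : ob (pidx A)) (b : kidx) (c : hom m (km b)) : Germ kerP (pobj A m) :=
  existT (fun b : kidx => kset b -> pobj A m) b (fun y => pmap A c (proj1_sig y)).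

(** The inclusion into [A_m] can be read at any index lying above [m]. Two readings differ by
    parallel arrows of [A], and [kres] merges them by deepening the level in [A] while keeping the
    target in [Q]. *)
Lemma kgerm_geq (m : ob (pidx A)) (b b' : kidx) (c : hom m (km b)) (c' : hom m (km b')) :
  geq (kgerm m b c) (kgerm m b' c').
Proof.
  destruct (f_cone kerCat b b') as [d [f [f' _]]].
  destruct (f_coeq _ _ _ (cmp (fst (proj1_sig f)) c) (cmp (fst (proj1_sig f')) c')) as [k [h e]].
  destruct (kres_hom d k h) as [[[g1 g2] hg] eg]; simpl in eg; subst g1.
  set (g := exist _ (h, g2) hg : khom d (kres d k h)).
  exists (kres d k h), (@cmp kerCat b d (kres d k h) g f), (@cmp kerCat b' d (kres d k h) g f').
  intro y.
  change (pmap A c (pmap A (cmp h (fst (proj1_sig f))) (proj1_sig y)) =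
          pmap A c' (pmap A (cmp h (fst (proj1_sig f'))) (proj1_sig y))).
  rewrite <- !(proj2 HA), <- !cmp_assoc, e; reflexivity.
Qed.

Lemma kinc_ex (m : ob (pidx A)) : exists b : kidx, exists c : hom m (km b), True.
Proof.
  destruct (f_nonempty (gidx Q)) as [j _].
  destruct (f_cone _ m (km (kbase j))) as [k [c [h _]]].
  exists (kres (kbase j) k h), c; exact Logic.I.
Qed.

Definition kinc : Mor kerP A := fun m =>
  let b := constructive_indefinite_description _ (kinc_ex m) in
  let c := constructive_indefinite_description _ (proj2_sig b) in
  kgerm m (proj1_sig b) (proj1_sig c).

Lemma kinc_at (m : ob (pidx A)) (b : kidx) (c : hom m (km b)) : geq (kinc m) (kgerm m b c).
Proof. apply kgerm_geq. Qed.

Lemma kinc_mor : IsMor kinc.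
Proof.
  intros m m' h; destruct (kinc_ex m') as [b [c _]].
  apply (geq_trans IsSys_kerP _ (gpost (pmap A h) (kgerm m' b c))).
  { apply geq_gpost, kinc_at. }
  apply (geq_trans IsSys_kerP _ (kgerm m b (cmp c h))); [| apply geq_sym, kinc_at].
  apply (@geq_ext kerP _ b); intro y; symmetry; apply (proj2 HA).
Qed.

Lemma kinc_zero : meq (mcomp p kinc) (mcomp (lone Q) (mbang kerP)).
Proof.
  intro j.
  apply (geq_trans IsSys_kerP _ (gpost (projT2 (p j)) (kgerm (projT1 (p j)) (kbase j) (idc _)))).
  { apply (geq_gpost (projT2 (p j))), kinc_at. }
  destruct (f_cone kerCat (kbase j) (pick_ob kerCat)) as [k [f [f' _]]].
  exists k, f, f'; intro y.
  change (kf (kbase j) (pmap A (idc _) (proj1_sig (pmap kerP f y))) = gone).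
  rewrite (proj1 HA); apply (proj2_sig (pmap kerP f y)).
Qed.

Section Factor.
Variables (Z : ProSet) (HZ : IsSys Z) (F : Mor Z A) (HF : IsMor F).
Hypothesis F0 : meq (mcomp p F) (mcomp (lone Q) (mbang Z)).

(** Triviality of [p F] is an equality of germs, so [F] takes values in the fibre over the unit only
    after a further restriction [r], which becomes part of the factorisation. *)
Lemma kfac_ex (b : kidx) : exists k, exists r : hom (projT1 (F (km b))) k,
  forall z, kf b (projT2 (F (km b)) (pmap Z r z)) = gone.
Proof.
  assert (e : geq (gpre (existT _ (km b) (kf b)) F) (mcomp (lone Q) (mbang Z) (kj b))).
  { apply (geq_trans HZ _ (gpre (p (kj b)) F)); [| apply F0].
    apply (geq_gpre HZ _ _ F HF), kf_rep. }
  destruct e as [k [r [s e]]]; exists k, r; intro z; apply e.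
Qed.

Definition kfac : Mor Z kerP := fun b =>
  let k := constructive_indefinite_description _ (kfac_ex b) in
  let r := constructive_indefinite_description _ (proj2_sig k) in
  existT (fun k : ob (pidx Z) => pobj Z k -> kset b) (proj1_sig k)
    (fun z => exist _ (projT2 (F (km b)) (pmap Z (proj1_sig r) z)) (proj2_sig r z)).

Lemma kfac_val (b : kidx) : geq (gpost (@proj1_sig _ _) (kfac b)) (F (km b)).
Proof. apply geq_sym, (geq_res HZ (projT1 (F (km b))) _ _ (projT2 (F (km b)))). Qed.

End Factor.

Lemma geq_kset {Z : ProSet} (b : kidx) (v w : Germ Z (kset b)) :
  geq (gpost (@proj1_sig _ _) v) (gpost (@proj1_sig _ _) w) -> geq v w.
Proof. intros [k [r [s e]]]; exists k, r, s; intro x; apply kset_eq, e. Qed.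

Lemma kfac_mor (Z : ProSet) (HZ : IsSys Z) (F : Mor Z A) (HF : IsMor F)
    (F0 : meq (mcomp p F) (mcomp (lone Q) (mbang Z))) : IsMor (kfac Z HZ F HF F0).
Proof.
  intros b c f; apply geq_kset.
  apply (geq_trans HZ _ (F (km b))); [| apply geq_sym, kfac_val].
  apply (geq_trans HZ _ (gpost (pmap A (fst (proj1_sig f))) (F (km c)))); [| apply HF].
  apply (geq_gpost (pmap A (fst (proj1_sig f))) _ _ (kfac_val Z HZ F HF F0 c)).
Qed.

Lemma kinc_kfac (Z : ProSet) (HZ : IsSys Z) (F : Mor Z A) (HF : IsMor F)
    (F0 : meq (mcomp p F) (mcomp (lone Q) (mbang Z))) : meq (mcomp kinc (kfac Z HZ F HF F0)) F.
Proof.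
  intro m; destruct (kinc_ex m) as [b [c _]].
  apply (geq_trans HZ _ (gpre (kgerm m b c) (kfac Z HZ F HF F0))).
  { apply (geq_gpre HZ _ _ _ (kfac_mor Z HZ F HF F0)), kinc_at. }
  apply (geq_trans HZ _ (gpost (pmap A c) (F (km b)))); [| apply HF].
  apply (geq_gpost (pmap A c) _ _ (kfac_val Z HZ F HF F0 b)).
Qed.

Lemma kinc_mono (Z : ProSet) (HZ : IsSys Z) (H H' : Mor Z kerP) :
  IsMor H -> IsMor H' -> meq (mcomp kinc H) (mcomp kinc H') -> meq H H'.
Proof.
  intros MH MH' e b; apply geq_kset.
  assert (E : forall K : Mor Z kerP, IsMor K ->
    geq (gpost (@proj1_sig _ _) (K b)) (mcomp kinc K (km b))).
  { intros K MK; apply geq_sym.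
    apply (geq_trans HZ _ (gpre (kgerm (km b) b (idc _)) K)).
    - apply (geq_gpre HZ _ _ K MK), kinc_at.
    - apply (@geq_ext Z _ (projT1 (K b))); intro z; apply (proj1 HA). }
  apply (geq_trans HZ _ _ _ (E H MH)), (geq_trans HZ _ _ _ (e (km b))), geq_sym, E, MH'.
Qed.

End KernelProSet.

Lemma HKer_exists (Y : Sys) (Q : ProGrp) (HQ : IsProGrp Q) (p : Hom Y (sG (pgGO Q HQ))) :
  exists (K : ProSet) (HK : IsSys K) (i : Hom (mkSys K HK) Y), HKer (hgs (pgGO Q HQ)) i p.
Proof.
  set (P := raw p : Mor Y (uP Q)).
  pose proof (IsMor_raw p : IsMor P) as HP.
  set (K := kerP Y (sysP Y) Q HQ P HP).
  pose (HK := IsSys_kerP Y (sysP Y) Q HQ P HP : IsSys K).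
  pose (inc := kinc Y (sysP Y) Q HQ P HP : Mor K Y).
  assert (Minc : IsMor inc) by apply kinc_mor.
  exists K, HK, (@homc (mkSys K HK) Y inc Minc).
  pose proof (@reps_homc (mkSys K HK) Y inc Minc) as ri.
  pose proof (reps_raw p) as rp.
  assert (r1 : forall Z : Sys, @reps Z (sG (pgGO Q HQ)) (mcomp (lone Q) (mbang Z))
                 (@gone (hgrp (hgs (pgGO Q HQ)) Z))).
  { intro Z; exact (reps_comp (reps_homc _ (go_e (pgGO Q HQ))) (reps_bang Z)). }
  split; [| split].
  - apply (reps_eq (reps_comp rp ri) (r1 (mkSys K HK))), kinc_zero.
  - intros Z f ef.
    pose proof (reps_meq (reps_comp rp (reps_raw f)) (r1 Z) ef) as F0.
    pose (fac := kfac Y (sysP Y) Q HQ P HP Z (sysP Z) (raw f) (IsMor_raw f) F0).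
    assert (Mfac : @IsMor Z K fac) by apply kfac_mor.
    exists (@homc Z (mkSys K HK) fac Mfac).
    apply (reps_eq (reps_comp ri (@reps_homc Z (mkSys K HK) fac Mfac)) (reps_raw f)).
    apply kinc_kfac.
  - intros Z h h' e; apply (reps_eq (reps_raw h) (reps_raw h')).
    apply (kinc_mono Y (sysP Y) Q HQ P HP Z (sysP Z) _ _ (IsMor_raw h) (IsMor_raw h')).
    exact (reps_meq (reps_comp ri (reps_raw h)) (reps_comp ri (reps_raw h')) e).
Qed.

(** The operations of [Y], restricted along [i], are killed by [p] and so factor through [K]; the
    factorisation is applied to [K x K], which calls for the kernel property on arbitrary pro-sets.
    The group laws are inherited because [i] is monic. *)
Lemma HKer_group {K Y Q : Sys} (s : HStr Y) (t : HStr Q) (i : Hom K Y) (p : Hom Y Q) :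
  IsHG s -> IsHG t -> IsHGM s t p -> HKer t i p ->
  exists k : HStr K, IsHG k /\ IsHGM k s i.
Proof.
  intros gs gt hp [h0 [hf hu]].
  assert (one : forall T, p \; @gone (hgrp s T) = @gone (hgrp t T)).
  { intro T; exact (IsHom_one (gs T) (gt T) _ (hp T)). }
  assert (zero : forall T (x : Hom T K), p \; (i \; x) = @gone (hgrp t T)).
  { intros T x; rewrite comp_assoc, h0; apply hgrp_one_comp. }
  destruct (hf (pS K K) (@gmul (hgrp s (pS K K)) (i \; pi1) (i \; pi2))) as [m em].
  { rewrite (hp (pS K K)), !zero; apply gt. }
  destruct (hf oneS (@gone (hgrp s oneS))) as [e ee]; [apply one |].
  destruct (hf K (@ginv (hgrp s K) i)) as [v ev].
  { rewrite (IsHom_inv (gs K) (gt K) _ (hp K)), <- (comp_idr i), zero.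
    pose proof (grp_inv_uniq (gt K) gone gone) as u; symmetry; apply u, gt. }
  pose (k := {| hm := m; he := e; hi := v |} : HStr K).
  assert (Em : forall T (x y : Hom T K), i \; @gmul (hgrp k T) x y =
                                        @gmul (hgrp s T) (i \; x) (i \; y)).
  { intros T x y; simpl; rewrite comp_assoc, em, hgrp_mul_comp; homs; reflexivity. }
  assert (Ee : forall T, i \; @gone (hgrp k T) = @gone (hgrp s T)).
  { intro T; simpl; rewrite comp_assoc, ee, hgrp_one_comp; reflexivity. }
  assert (Ev : forall T (x : Hom T K), i \; @ginv (hgrp k T) x = @ginv (hgrp s T) (i \; x)).
  { intros T x; simpl; rewrite comp_assoc, ev, hgrp_inv_comp; reflexivity. }
  exists k; split; [| exact Em].
  intro T; destruct (gs T) as [s1 [s2 [s3 [s4 s5]]]]; repeat split; intros; apply hu;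
    repeat (rewrite Em || rewrite Ee || rewrite Ev); auto.
Qed.

Lemma homc_raw {A B : Sys} (f : Hom A B) (H : IsMor (raw f)) : homc (raw f) H = f.
Proof. exact (reps_eq (reps_homc _ H) (reps_raw f) (meq_refl _)). Qed.

Definition GO_of {A : ProSet} {HA : IsSys A} (k : HStr (mkSys A HA)) : GO :=
  Build_GO {| gos := A; gom := raw (hm k); goe := raw (he k); goi := raw (hi k) |}
    HA (IsMor_raw (hm k)) (IsMor_raw (he k)) (IsMor_raw (hi k)).

Lemma hgs_GO_of {A : ProSet} {HA : IsSys A} (k : HStr (mkSys A HA)) : hgs (GO_of k) = k.
Proof.
  destruct k as [m e v]; unfold hgs, GO_of; cbn [hm he hi]; f_equal; apply homc_raw.
Qed.

(* The pro-set kernel [k] of [p] carries a group structure, so it is isomorphic to [X]. *)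
Lemma IsKernelGO_HKer (X Y : GO) (Q : ProGrp) (HQ : IsProGrp Q)
    (i : Mor (gos X) (gos Y)) (p : Mor (gos Y) (uP Q))
    (hi : Hom (sG X) (sG Y)) (hp : Hom (sG Y) (sG (pgGO Q HQ))) :
  IsGObj X -> IsGObj Y -> reps i hi -> @reps (sG Y) (sG (pgGO Q HQ)) p hp ->
  @IsGOMor X Y i -> @IsGOMor Y (FG Q) p ->
  @IsKernelGO X Y (FG Q) i p -> HKer (hgs (pgGO Q HQ)) hi hp.
Proof.
  intros gX gY ri rp gi gp [h0 hu].
  pose proof (proj1 (@IsGOMor_IsHGM X Y i hi ri) gi) as Hi.
  pose proof (proj1 (@IsGOMor_IsHGM Y (pgGO Q HQ) p hp rp) gp) as Hp.
  assert (e0 : hp \; hi = @gone (hgrp (hgs (pgGO Q HQ)) (sG X))).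
  { exact (reps_eq (reps_comp rp ri) (reps_zero X (pgGO Q HQ)) h0). }
  destruct (HKer_exists (sG Y) Q HQ hp) as [K [HK [k ker]]].
  destruct (HKer_group (hgs Y) (hgs (pgGO Q HQ)) k hp (IsGObj_IsHG Y gY) (IsHG_pgGO Q HQ) Hp ker)
    as [s [gs Hk]].
  destruct ker as [k0 [kf ku]].
  set (KG := GO_of s).
  assert (gK : IsGObj KG) by (apply IsHG_IsGObj; unfold KG; rewrite hgs_GO_of; exact gs).
  assert (Hk' : IsHGM (hgs KG) (hgs Y) k) by (unfold KG; rewrite hgs_GO_of; exact Hk).
  pose proof (proj2 (@IsGOMor_IsHGM KG Y (raw k) k (reps_raw k)) Hk') as gk.
  destruct (hu KG gK (raw k) gk (reps_meq (reps_comp rp (reps_raw k)) (reps_zero KG (pgGO Q HQ)) k0))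
    as [[h [gh eh]] _].
  pose proof (@reps_homc (sG KG) (sG X) h (proj1 gh)) as rh; set (h' := homc _ _) in rh.
  pose proof (reps_eq (reps_comp ri rh) (reps_raw k) eh) as eh'.
  pose proof (proj1 (@IsGOMor_IsHGM KG X h h' rh) gh) as Hh.
  destruct (kf (sG X) hi e0) as [l el].
  assert (Hl : IsHGM (hgs X) (hgs KG) l).
  { intros T x y; apply ku.
    rewrite comp_assoc, el.
    eapply eq_trans; [apply (Hi T) |]; eapply eq_trans; [| symmetry; apply (Hk' T)].
    change (@comp (sG X) (sG KG) (sG Y) k l = hi) in el.
    cbv beta; rewrite !comp_assoc, el; reflexivity. }
  (* Both sides factor [i] through itself, so the uniqueness clause for [X] among group objects
     applies. A left inverse of [l] is all that is needed to carry factorisation and uniqueness from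
     [k] over to [i]. *)
  assert (hl : h' \; l = idh (sG X)).
  { destruct (hu X gX i gi h0) as [_ u].
    apply (reps_eq (reps_comp rh (reps_raw l)) (reps_id (sG X))), u.
    - apply (@IsGOMor_IsHGM X X _ _ (reps_comp rh (reps_raw l))).
      intros T x y; cbv beta; rewrite <- !comp_assoc, (Hl T), (Hh T); reflexivity.
    - apply (@IsGOMor_IsHGM X X _ _ (reps_id (sG X))).
      intros T x y; rewrite !comp_idl; reflexivity.
    - apply (reps_meq (reps_comp ri (reps_comp rh (reps_raw l))) ri).
      rewrite comp_assoc, eh'; exact el.
    - apply (reps_meq (reps_comp ri (reps_id (sG X))) ri), comp_idr. }
  split; [exact e0 | split].
  - intros Z f ef; destruct (kf Z f ef) as [g eg]; exists (h' \; g).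
    rewrite comp_assoc, eh'; exact eg.
  - intros Z g g' e.
    rewrite <- (comp_idl g), <- (comp_idl g'), <- hl, <- !comp_assoc; f_equal.
    apply ku; rewrite !comp_assoc, el; exact e.
Qed.

(** * Split extensions *)

Definition IsGObj_GO (Y : GObj) (H : IsGObj Y) : GO :=
  Build_GO Y (proj1 H) (proj1 (proj2 H)) (proj1 (proj2 (proj2 H))) (proj1 (proj2 (proj2 (proj2 H)))).

Lemma IsSplitExtPG_FSE (G X : ProGrp) (HG : IsProGrp G) (HX : IsProGrp X) (E : SplitExtPG X G) :
  IsSplitExtPG E -> IsSplitExtGO (FSE E).
Proof.
  intros [HY [gi [gp [gs [e k]]]]].
  split; [apply IsGObj_FG, HY |].
  split; [apply IsGMor_IsGOMor, gi |]; split; [apply IsGMor_IsGOMor, gp |].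
  split; [apply IsGMor_IsGOMor, gs |]; split; [exact e |].
  set (oX := sG (pgGO X HX)); set (oY := sG (pgGO _ HY)); set (oG := sG (pgGO G HG)).
  pose proof (@reps_homc oX oY (sei E) (proj1 gi)) as ri.
  pose proof (@reps_homc oY oG (sep E) (proj1 gp)) as rp.
  apply (@HKer_IsKernelGO (pgGO X HX) (pgGO _ HY) (pgGO G HG) (sei E) (sep E) _ _ ri rp).
  - apply (IsGMor_IsGOMor (sei E) gi).
  - exact (IsKernelPG_HKer HX HY HG (sei E) (sep E) _ _ ri rp gi gp k).
Qed.

Lemma IsoSEGO_IsoSEPG (G X : ProGrp) (HG : IsProGrp G) (HX : IsProGrp X) (E E' : SplitExtPG X G) :
  IsSplitExtPG E -> IsSplitExtPG E' -> IsoSEGO (FSE E) (FSE E') -> IsoSEPG E E'.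
Proof.
  intros [HY [gi [gp [gs _]]]] [HY' [gi' [gp' [gs' _]]]] [f [[gf [h [gh [e1 e2]]]] [ei [es ep]]]].
  destruct (IsGOMor_full HY f gf) as [f' [gf' ef]].
  destruct (IsGOMor_full HY' h gh) as [h' [gh' eh]].
  pose proof (proj1 HY) as SY; pose proof (proj1 HY') as SY'.
  pose proof (meq_sym _ _ ef) as fe; pose proof (meq_sym _ _ eh) as he.
  exists f'; split; [split; [exact gf' |] | split; [| split]].
  - exists h'; split; [exact gh' |]; split.
    + apply (meq_trans SY _ (mcomp h f)); [| exact e1].
      apply (mcomp_meq SY); [apply gf' | exact he | exact fe].
    + apply (meq_trans SY' _ (mcomp f h)); [| exact e2].
      apply (mcomp_meq SY'); [apply gh' | exact fe | exact he].
  - apply (meq_trans (proj1 HX) _ (mcomp f (sei E))); [| exact ei].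
    apply (mcomp_meq (proj1 HX)); [apply gi | exact fe | apply meq_refl].
  - apply (meq_trans (proj1 HG) _ (mcomp f (ses E))); [| exact es].
    apply (mcomp_meq (proj1 HG)); [apply gs | exact fe | apply meq_refl].
  - apply (meq_trans SY _ (mcomp (sep E') f)); [| exact ep].
    apply (mcomp_meq SY); [apply gf' | apply meq_refl | exact fe].
Qed.

Lemma HKer_iso {K Y Y' Q : Sys} (t : HStr Q) (i : Hom K Y) (p : Hom Y Q)
    (f : Hom Y' Y) (g : Hom Y Y') :
  g \; f = idh Y' -> f \; g = idh Y -> HKer t i p -> HKer t (g \; i) (p \; f).
Proof.
  intros e1 e2 [h0 [hf hu]]; split; [| split].
  - rewrite comp_assoc, <- (comp_assoc p), e2, comp_idr; exact h0.
  - intros Z h eh; destruct (hf Z (f \; h)) as [l el].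
    + rewrite comp_assoc; exact eh.
    + exists l; rewrite <- comp_assoc, el, comp_assoc, e1, comp_idl; reflexivity.
  - intros Z h h' eh; apply hu.
    apply (f_equal (fun x => f \; x)) in eh.
    rewrite !comp_assoc, e2, comp_idl in eh; exact eh.
Qed.

Lemma IsHGM_comp {A B C : Sys} (r : HStr A) (s : HStr B) (t : HStr C) (g : Hom B C) (f : Hom A B) :
  IsHGM s t g -> IsHGM r s f -> IsHGM r t (g \; f).
Proof.
  intros hg hf T x y; rewrite <- !comp_assoc, (hf T x y); apply (hg T).
Qed.

Lemma grp_conj_mul {H : Grp} (gH : IsGroup H) (g x y : gcar H) :
  gmul (gmul g (gmul x y)) (ginv g) =
  gmul (gmul (gmul g x) (ginv g)) (gmul (gmul g y) (ginv g)).
Proof.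
  destruct gH as [as_ [l [r [il ir]]]].
  rewrite !as_, <- (as_ _ _ g), il, r; reflexivity.
Qed.

(** Multiplicativity of [(x, g) -> x g] on a semidirect product for conjugation: the left side is
    the image of the product of [(x, g)] and [(y, h)]. *)
Lemma grp_conj_twist {H : Grp} (gH : IsGroup H) (x y g h : gcar H) :
  gmul (gmul x (gmul (gmul g y) (ginv g))) (gmul g h) = gmul (gmul x g) (gmul y h).
Proof.
  destruct gH as [as_ [l [r [il ir]]]].
  rewrite !as_, <- (as_ _ _ g), il, r; reflexivity.
Qed.

(** * Split extensions of group objects come from pro-groups *)

Section FromGroupObjects.

Variables (G X : ProGrp) (HG : IsProGrp G) (HX : IsProGrp X).
Variable Dx : SplitExtGO (FG X) (FG G).
Hypothesis HD : IsSplitExtGO Dx.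

Local Notation gX := (pgGO X HX).
Local Notation gG := (pgGO G HG).
Local Notation gY := (IsGObj_GO (sgY Dx) (proj1 HD)).
Local Notation oX := (sG gX).
Local Notation oG := (sG gG).
Local Notation oY := (sG gY).

Let Gi : @IsGOMor gX gY (sgi Dx) := proj1 (proj2 HD).
Let Gp : @IsGOMor gY gG (sgp Dx) := proj1 (proj2 (proj2 HD)).
Let Gs : @IsGOMor gG gY (sgs Dx) := proj1 (proj2 (proj2 (proj2 HD))).

Let i : Hom oX oY := @homc oX oY (sgi Dx) (proj1 Gi).
Let p : Hom oY oG := @homc oY oG (sgp Dx) (proj1 Gp).
Let s : Hom oG oY := @homc oG oY (sgs Dx) (proj1 Gs).
Let ri : @reps oX oY (sgi Dx) i := reps_homc _ _.
Let rp : @reps oY oG (sgp Dx) p := reps_homc _ _.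
Let rs : @reps oG oY (sgs Dx) s := reps_homc _ _.

Let Hi : IsHGM (hgs gX) (hgs gY) i := proj1 (@IsGOMor_IsHGM gX gY _ i ri) Gi.
Let Hp : IsHGM (hgs gY) (hgs gG) p := proj1 (@IsGOMor_IsHGM gY gG _ p rp) Gp.
Let Hs : IsHGM (hgs gG) (hgs gY) s := proj1 (@IsGOMor_IsHGM gG gY _ s rs) Gs.

Let grG : IsHG (hgs gG) := IsHG_pgGO G HG.
Let grY : IsHG (hgs gY) := IsGObj_IsHG gY (proj1 HD).

Lemma split_ps : p \; s = idh oG.
Proof.
  apply (reps_eq (reps_comp rp rs) (reps_id oG)); exact (proj1 (proj2 (proj2 (proj2 (proj2 HD))))).
Qed.

Lemma split_ker : HKer (hgs gG) i p.
Proof.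
  apply (IsKernelGO_HKer gX gY G HG (sgi Dx) (sgp Dx) i p);
    [apply IsGObj_FG, HX | exact (proj1 HD) | exact ri | exact rp | exact Gi | exact Gp |].
  exact (proj2 (proj2 (proj2 (proj2 (proj2 HD))))).
Qed.

Notation "x *[ Y , T ] y" := (@gmul (hgrp (hgs Y) T) x y) (at level 40, Y at level 9, T at level 9).
Notation "x ^-[ Y , T ]" := (@ginv (hgrp (hgs Y) T) x) (at level 3, Y at level 9, T at level 9).

(** Once the middle object is isomorphic to a pro-group, the whole extension can be moved there:
    fullness makes the transported maps levelwise, and [HKer] is invariant under isomorphism. *)
Lemma split_transport (L : ProGrp) (HL : IsProGrp L)
    (f : Hom (sG (pgGO L HL)) oY) (g : Hom oY (sG (pgGO L HL))) :
  IsHGM (hgs (pgGO L HL)) (hgs gY) f -> g \; f = idh _ -> f \; g = idh _ ->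
  exists E : SplitExtPG X G, IsSplitExtPG E /\ IsoSEGO (FSE E) Dx.
Proof.
  intros Hf e1 e2.
  pose proof (IsHGM_inv _ _ _ _ Hf e1 e2) as Hg.
  set (gL := pgGO L HL) in *; set (oL := sG gL) in *.
  pose proof (proj2 (@IsGOMor_IsHGM gX gL _ _ (reps_raw (g \; i))) (IsHGM_comp _ _ _ _ _ Hg Hi)) as G1.
  pose proof (proj2 (@IsGOMor_IsHGM gL gG _ _ (reps_raw (p \; f))) (IsHGM_comp _ _ _ _ _ Hp Hf)) as G2.
  pose proof (proj2 (@IsGOMor_IsHGM gG gL _ _ (reps_raw (g \; s))) (IsHGM_comp _ _ _ _ _ Hg Hs)) as G3.
  destruct (@IsGOMor_full X L HX _ G1) as [i' [gi' ei']].
  destruct (@IsGOMor_full L G HL _ G2) as [p' [gp' ep']].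
  destruct (@IsGOMor_full G L HG _ G3) as [s' [gs' es']].
  pose proof (@meq_reps oX oL _ i' _ ei' (reps_raw _)) as ri'.
  pose proof (@meq_reps oL oG _ p' _ ep' (reps_raw _)) as rp'.
  pose proof (@meq_reps oG oL _ s' _ es' (reps_raw _)) as rs'.
  exists (Build_SplitExtPG X G L i' p' s'); split.
  - split; [exact HL |]; split; [exact gi' |]; split; [exact gp' |]; split; [exact gs' |].
    split.
    + apply (reps_meq (reps_comp rp' rs') (reps_id oG)).
      rewrite comp_assoc, <- (comp_assoc p), e2, comp_idr; exact split_ps.
    + apply IsKernelGO_IsKernelPG.
      apply (@HKer_IsKernelGO gX gL gG i' p' _ _ ri' rp' (IsGMor_IsGOMor i' gi')).
      apply HKer_iso; [exact e1 | exact e2 | exact split_ker].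
  - exists (raw f); split; [split |].
    + exact (proj2 (@IsGOMor_IsHGM gL gY _ _ (reps_raw f)) Hf).
    + exists (raw g); split; [exact (proj2 (@IsGOMor_IsHGM gY gL _ _ (reps_raw g)) Hg) |]; split.
      * exact (reps_meq (reps_comp (reps_raw g) (reps_raw f)) (reps_id oL) e1).
      * exact (reps_meq (reps_comp (reps_raw f) (reps_raw g)) (reps_id oY) e2).
    + split; [| split].
      * apply (reps_meq (reps_comp (reps_raw f) ri') ri).
        rewrite comp_assoc, e2; apply comp_idl.
      * apply (reps_meq (reps_comp (reps_raw f) rs') rs).
        rewrite comp_assoc, e2; apply comp_idl.
      * exact (reps_meq (reps_comp rp (reps_raw f)) rp' eq_refl).
Qed.

Definition IsConj (a : Hom (pS oG oX) oX) : Prop :=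
  forall T (g : Hom T oG) (x : Hom T oX),
    i \; (a \; << g, x >>) = ((s \; g) *[gY, T] (i \; x)) *[gY, T] ((s \; g) ^-[gY, T]).

Lemma split_pi {T : Sys} (x : Hom T oX) : p \; (i \; x) = @gone (hgrp (hgs gG) T).
Proof. rewrite comp_assoc, (proj1 split_ker); apply hgrp_one_comp. Qed.

Lemma split_psg {T : Sys} (g : Hom T oG) : p \; (s \; g) = g.
Proof. rewrite comp_assoc, split_ps; apply comp_idl. Qed.

(** Conjugates of [i x] by [s g] are sent by [p] to [g g^-1 = 1], so they factor through [i]. The
    conjugation map from [G x X] is not a homomorphism in general, so the factorisation rests on the
    kernel property for arbitrary pro-sets. *)
Lemma split_conj : exists a, IsConj a.
Proof.
  set (T := pS oG oX).
  destruct (proj1 (proj2 split_ker) T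
    (((s \; pi1) *[gY, T] (i \; pi2)) *[gY, T] ((s \; pi1) ^-[gY, T]))) as [a ea].
  - rewrite (Hp T), (Hp T), (IsHom_inv (grY T) (grG T) _ (Hp T)), split_pi, split_psg.
    destruct (grG T) as [g1 [g2 [g3 [g4 g5]]]]; rewrite g3, g5; reflexivity.
  - subst T; exists a; intros T' g x; rewrite comp_assoc, ea, !hgrp_mul_comp, hgrp_inv_comp.
    rewrite <- !comp_assoc, pi1_pair, pi2_pair; reflexivity.
Qed.

Section Conjugation.
Variable a : Hom (pS oG oX) oX.
Hypothesis Ha : IsConj a.

Lemma i_mono {T : Sys} (x y : Hom T oX) : i \; x = i \; y -> x = y.
Proof. apply (proj2 (proj2 split_ker)). Qed.

Lemma conj_mul {T : Sys} (g h : Hom T oG) (x : Hom T oX) :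
  a \; << g *[gG, T] h, x >> = a \; << g, a \; << h, x >> >>.
Proof.
  apply i_mono; rewrite !Ha, (Hs T).
  assert (inv : (((s \; g) *[gY, T] (s \; h)) ^-[gY, T]) =
                ((s \; h) ^-[gY, T]) *[gY, T] ((s \; g) ^-[gY, T])).
  { symmetry; apply (grp_inv_uniq (grY T)).
    destruct (grY T) as [y1 [y2 [y3 [y4 y5]]]].
    rewrite <- y1, (y1 (s \; h)), y5, y2, y5; reflexivity. }
  rewrite inv; destruct (grY T) as [y1 [y2 [y3 [y4 y5]]]]; rewrite !y1; reflexivity.
Qed.

Lemma conj_one {T : Sys} (x : Hom T oX) : a \; << @gone (hgrp (hgs gG) T), x >> = x.
Proof.
  apply i_mono; rewrite Ha, (IsHom_one (grG T) (grY T) _ (Hs T)).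
  destruct (grY T) as [y1 [y2 [y3 [y4 y5]]]].
  rewrite y2, <- (y2 (@ginv (hgrp (hgs gY) T) _)), y5, y3; reflexivity.
Qed.

Lemma conj_hom {T : Sys} (g : Hom T oG) (x y : Hom T oX) :
  a \; << g, x *[gX, T] y >> = (a \; << g, x >>) *[gX, T] (a \; << g, y >>).
Proof.
  apply i_mono; rewrite (Hi T), !Ha, (Hi T); apply (grp_conj_mul (grY T)).
Qed.

Lemma conj_IsProSetAction : IsProSetAction G X (raw a).
Proof.
  pose proof (reps_raw a) as ra.
  pose proof (@reps_homc (pS oX oX) oX (lmul X) (IsMor_lmul X HX)) as mX.
  pose proof (@reps_homc (pS oG oG) oG (lmul G) (IsMor_lmul G HG)) as mG.
  pose proof (@reps_homc oneS oG (lone G) (IsMor_lone G HG)) as eG.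
  split; [exact (IsMor_raw a) |]; split; [| split].
  - apply (reps_meq (reps_comp ra (reps_prod mG (reps_id oX)))
      (reps_comp ra (reps_comp (reps_prod (reps_id oG) ra) (reps_assoc oG oG oX)))).
    pose proof (conj_mul (T := pS (pS oG oG) oX) (pi1 \; pi1) (pi2 \; pi1) pi2) as e.
    homs; revert e; simpl; homs; exact (fun e => e).
  - apply (reps_meq (reps_comp ra (reps_comp (reps_prod eG (reps_id oX)) (reps_lunit oX)))
      (reps_id oX)).
    pose proof (conj_one (idh oX)) as e; homs; exact e.
  - apply (reps_meq (reps_comp ra (reps_prod (reps_id oG) mX))
      (reps_comp mX (reps_pair (reps_comp ra (reps_prod (reps_id oG) (reps_fst oX oX)))
                               (reps_comp ra (reps_prod (reps_id oG) (reps_snd oX oX)))))).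
    pose proof (conj_hom (T := pS oG (pS oX oX)) pi1 (pi1 \; pi2) (pi2 \; pi2)) as e.
    homs; revert e; simpl; homs; exact (fun e => e).
Qed.

Let st : HStr (pS oX oG) := sdHG G X HG HX (raw a) (IsMor_raw a).

Definition split_theta : Hom (pS oX oG) oY := (i \; pi1) *[gY, (pS oX oG)] (s \; pi2).

Lemma split_theta_at {T : Sys} (z : Hom T (pS oX oG)) :
  split_theta \; z = (i \; (pi1 \; z)) *[gY, T] (s \; (pi2 \; z)).
Proof. unfold split_theta; rewrite hgrp_mul_comp, <- !comp_assoc; reflexivity. Qed.

Lemma split_theta_hom : IsHGM st (hgs gY) split_theta.
Proof.
  intros T z z'; rewrite !split_theta_at.
  unfold st; rewrite sdHG_mul; unfold sdAct; rewrite homc_raw, pi1_pair, pi2_pair.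
  rewrite (Hi T), (Hs T), Ha; apply (grp_conj_twist (grY T)).
Qed.

(** The inverse sends [y] to [(r y, p y)], where [i (r y) = y (s (p y))^-1]. As with conjugation,
    [r] is the factorisation of a map that is only a morphism of pro-sets. *)
Lemma split_theta_inv : exists h, h \; split_theta = idh _ /\ split_theta \; h = idh _.
Proof.
  destruct (proj1 (proj2 split_ker) oY
    (idh oY *[gY, oY] ((s \; p) ^-[gY, oY]))) as [r er].
  { rewrite (Hp oY), (IsHom_inv (grY oY) (grG oY) _ (Hp oY)), split_psg, comp_idr.
    apply (grG oY). }
  exists << r, p >>.
  assert (E : split_theta \; << r, p >> = idh oY).
  { rewrite split_theta_at, pi1_pair, pi2_pair, er.
    destruct (grY oY) as [y1 [y2 [y3 [y4 y5]]]]; rewrite <- y1, y4, y3; reflexivity. }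
  split; [| exact E].
  assert (P : p \; split_theta = pi2).
  { unfold split_theta; rewrite (Hp (pS oX oG)), split_pi, split_psg.
    exact (proj1 (proj2 (grG (pS oX oG))) pi2). }
  rewrite pair_comp, P; apply pair_ext; rewrite ?pi1_pair, ?pi2_pair, comp_idr; [| reflexivity].
  apply i_mono; rewrite comp_assoc, er, hgrp_mul_comp, hgrp_inv_comp, comp_idl.
  rewrite <- comp_assoc, P; unfold split_theta.
  destruct (grY (pS oX oG)) as [y1 [y2 [y3 [y4 y5]]]]; rewrite <- y1, y5, y3; reflexivity.
Qed.

End Conjugation.

(** The levelwise representation of the conjugation action identifies the semidirect product with a
    pro-group [L], and [split_theta] identifies it with the middle object of [Dx]; composing them
    meets the hypothesis of [split_transport]. *)
Lemma split_representation : exists E : SplitExtPG X G, IsSplitExtPG E /\ IsoSEGO (FSE E) Dx.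
Proof.
  destruct split_conj as [a Ha].
  destruct (action_representation G X HG HX (raw a) (conj_IsProSetAction a Ha))
    as [D [u [Xg [Xm [al [Fu [_ [HX' [Hact [Hcomp [_ [psi [_ [phi [[gphi [ph' [gph' [f1 f2]]]] _]]]]]]]]]]]]]]].
  pose proof (IsProGrp_sdLim G D u Xg Xm al HG Fu HX' Hact Hcomp) as HL.
  set (L := sdLim G D u Xg Xm al) in *.
  destruct split_theta_inv as [t [t1 t2]].
  pose proof (@reps_homc (pS oX oG) (sG (pgGO L HL)) phi (proj1 gphi)) as rphi.
  pose proof (@reps_homc (sG (pgGO L HL)) (pS oX oG) ph' (proj1 gph')) as rph'.
  set (f := homc _ _) in rphi; set (f' := homc _ _) in rph'.
  pose proof (reps_eq (reps_comp rph' rphi) (reps_id (pS oX oG)) f1) as e1.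
  pose proof (reps_eq (reps_comp rphi rph') (reps_id (sG (pgGO L HL))) f2) as e2.
  assert (Hf' : IsHGM (hgs (pgGO L HL)) (sdHG G X HG HX (raw a) (IsMor_raw a)) f').
  { exact (proj1 (@IsGOMor_iff (FG L) (sdGO G X (raw a)) (sysP (sG (pgGO L HL))) (sysP (pS oX oG))
      (hgs (pgGO L HL)) (sdHG G X HG HX (raw a) (IsMor_raw a)) _ _ (reps_homc _ (go_m (pgGO L HL)))
      (reps_sdGO_gom G X HG HX (raw a) (IsMor_raw a)) rph') gph'). }
  apply (split_transport L HL (split_theta \; f') (f \; t)).
  - exact (IsHGM_comp _ _ _ _ _ (split_theta_hom a Ha) Hf').
  - rewrite comp_assoc, <- (comp_assoc f), t1, comp_idr; exact e2.
  - rewrite comp_assoc, <- (comp_assoc split_theta), e1, comp_idr; exact t2.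
Qed.

End FromGroupObjects.

Theorem mainTheorem6 :
  forall (G X : ProGrp), IsProGrp G -> IsProGrp X ->
  (* Part 1: levelwise representation of an action a in Grp(Pro(Set)) *)
  (forall a : Mor (prodP (uP G) (uP X)) (uP X),
     IsProSetAction G X a ->
     exists (D : DirSet) (u : FFun (posetCat D) (gidx G))
            (Xg : dcar D -> Grp)
            (Xm : forall j j', dle j j' -> gcar (Xg j') -> gcar (Xg j))
            (al : forall j, gcar (ggrp G (fob u j)) -> gcar (Xg j) -> gcar (Xg j)),
       IsFunctor u /\ IsCofinal u /\
       IsProGrp (mkPG D Xg Xm) /\
       (forall j, IsGAction (ggrp G (fob u j)) (Xg j) (al j)) /\
       (forall j j' (p : dle j j') (g : gcar (ggrp G (fob u j'))) (x : gcar (Xg j')),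
          Xm j j' p (al j' g x) = al j (gmap G (fhom u p) g) (Xm j j' p x)) /\
       IsGIso (canon G u) /\
       exists psiX : Mor (uP X) (uP (mkPG D Xg Xm)),
         IsGIso psiX /\
         exists phi : Mor (prodP (uP X) (uP G)) (uP (sdLim G D u Xg Xm al)),
           @IsGOIso (sdGO G X a) (FG (sdLim G D u Xg Xm al)) phi /\
           meq (mcomp phi (sgi (sdExt G X a)))
               (mcomp (sdLim_i G D u Xg Xm al) psiX) /\
           meq (mcomp phi (sgs (sdExt G X a)))
               (mcomp (sdLim_s G D u Xg Xm al) (canon G u)) /\
           meq (mcomp (sdLim_p G D u Xg Xm al) phi)
               (mcomp (canon G u) (sgp (sdExt G X a))))
  /\
  (* Part 2: Pro(Grp) -> Grp(Pro(Set)) induces a bijection on actions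
     (isomorphism classes of split extensions of G by X) *)
  ((forall E : SplitExtPG X G, IsSplitExtPG E -> IsSplitExtGO (FSE E)) /\
   (forall E E' : SplitExtPG X G, IsSplitExtPG E -> IsSplitExtPG E' ->
      IsoSEGO (FSE E) (FSE E') -> IsoSEPG E E') /\
   (forall Dx : SplitExtGO (FG X) (FG G), IsSplitExtGO Dx ->
      exists E : SplitExtPG X G, IsSplitExtPG E /\ IsoSEGO (FSE E) Dx)).
Proof.
  intros G X HG HX; split; [| split; [| split]].
  - intros a Ha; exact (action_representation G X HG HX a Ha).
  - intro E; apply IsSplitExtPG_FSE; assumption.
  - intros E E'; apply IsoSEGO_IsoSEPG; assumption.
  - intros Dx HD; exact (split_representation G X HG HX Dx HD).
Qed.
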